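(* Let $n$ be a multiple of $9$ with $n\ge 27$. Then there exists a set $P$ of $n$ points in general position in the plane such that, simultaneously for all integers $k$ with $0\le k\le 4n/9-1$, $$E_{\le k}(P)=E_{\le k}(n)=\begin{cases} 3\binom{k+2}{2} & \text{if } 0\le k\le n/3-1,\\[4pt] 3\binom{k+2}{2}+3\binom{k-n/3+2}{2} & \text{if } n/3\le k\le 4n/9-2,\\[4pt] 3\binom{(4n/9-1)+2}{2}+3\binom{(4n/9-1)-n/3+2}{2}+3 & \text{if } k=4n/9-1. \end{cases}$$
   Context: General position means no three points are collinear. For a set $P$ of $n$ points in general position in the plane and an integer $0\le k\le n/2-1$, a $k$-edge of $P$ is a line through two points of $P$ leaving exactly $k$ points of $P$ on one side; $E_k(P)$ is the number of $k$-edges of $P$ and $E_{\le k}(P)=\sum_{j=0}^kE_j(P)$. $E_{\le k}(n)$ is the minimum of $E_{\le k}(P)$ over all sets $P$ of $n$ points in general position in the plane. *)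

(* Defs.v *)
From mathcomp Require Import all_boot all_order all_algebra finmap.
From mathcomp Require Import boolp classical_sets reals.
From mathcomp Require Import ring.

Set Implicit Arguments.
Unset Strict Implicit.
Unset Printing Implicit Defensive.

Import Order.TTheory GRing.Theory Num.Theory.

Local Open Scope ring_scope.

Section Plane.
Variable R : realType.
Implicit Types (p q r x : 'rV[R]_2) (P Q : {fset 'rV[R]_2}).

Definition line p q : set 'rV[R]_2 := range (fun t : R => p + t *: (q - p)).

(* Twice the signed area of the triangle p q x: for p <> q, the two open sides
   of [line p q] are {x | 0 < orient p q x} and {x | orient p q x < 0}. *)
Definition orient p q x : R :=
  (q 0 0 - p 0 0) * (x 0 1 - p 0 1) - (q 0 1 - p 0 1) * (x 0 0 - p 0 0).

Definition general_position P : Prop :=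
  forall p q r, p \in P -> q \in P -> r \in P ->
    p != q -> p != r -> q != r -> ~ line p q r.

Definition left_side P p q : {fset 'rV[R]_2} :=
  [fset x in P | 0 < orient p q x]%fset.

Definition right_side P p q : {fset 'rV[R]_2} :=
  [fset x in P | orient p q x < 0]%fset.

(* A finite set of lines (as subsets of the plane), so that a line spanned by
   several ordered pairs, or leaving k points on each side, is counted once. *)
Definition k_edges (P : {fset 'rV[R]_2}) (k : nat) : {fset set 'rV[R]_2} :=
  [fset line p q | p in P, q in P
     & (p != q) && ((#|` left_side P p q| == k) || (#|` right_side P p q| == k))
  ]%fset.

Definition E (k : nat) P : nat := #|` k_edges P k|.

Definition E_le (k : nat) P : nat := (\sum_(0 <= j < k.+1) E j P)%N.

Lemma line_orient p q x : line p q x -> orient p q x = 0.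
Proof.
by case=> t _ <-; rewrite /orient !mxE; ring.
Qed.

(* Witnessed by n points on a parabola. *)
Lemma general_position_exists (n : nat) :
  exists P : {fset 'rV[R]_2}, #|` P| = n /\ general_position P.
Proof.
pose f (i : nat) : 'rV[R]_2 := \row_j (i%:R ^+ j.+1).
have f_inj : injective f.
  move=> i j /rowP /(_ 0); rewrite !mxE !expr1 => /eqP.
  by rewrite eqr_nat => /eqP.
exists [fset f i | i in iota 0 n]%fset; split.
  rewrite card_imfset //=.
  by rewrite undup_id ?iota_uniq ?size_iota.
move=> p q r /imfsetP[a /= _ ->] /imfsetP[b /= _ ->] /imfsetP[c /= _ ->].
rewrite !(inj_eq f_inj) => ab ac bc /line_orient.
rewrite /orient !mxE /= !expr1 => h0.
have : (b%:R - a%:R) * (c%:R - a%:R) * (c%:R - b%:R) = 0 :> R.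
  by rewrite -[RHS]h0; ring.
move/eqP; rewrite !mulf_eq0 !subr_eq0 !eqr_nat.
by rewrite ![_ == a]eq_sym [c == b]eq_sym (negPf ab) (negPf ac) (negPf bc).
Qed.

Lemma E_le_attained (n k : nat) :
  exists m, `[< exists P : {fset 'rV[R]_2},
                [/\ #|` P| = n, general_position P & E_le k P = m] >].
Proof.
have [P [cP gP]] := general_position_exists n.
by exists (E_le k P); apply/asboolP; exists P.
Qed.

End Plane.

(* The least value of E_le k over all n-point sets in general position. *)
Definition E_le_min (R : realType) (n k : nat) : nat :=
  ex_minn (E_le_attained R n k).

(* Main.v *)
Require Import Defs.
From mathcomp Require Import all_boot all_order all_algebra finmap.
From mathcomp Require Import boolp classical_sets reals.
From mathcomp Require Import zify ring lra fintype finset.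

Set Implicit Arguments.
Unset Strict Implicit.
Unset Printing Implicit Defensive.

(** Write n = 9t.  Both inequalities are about the number of ordered pairs
    (x, y) of points with fewer than K = k + 1 points to the right of the
    directed line from x to y; for 2k + 2 < n this number is E_{<=k}, as such
    a line is directed in a single way ([E_le_ub], [E_le_lb]).  The common
    value, [profile t K], is
      3 C(K+1, 2) + 3 C(K-3t+1, 2), plus 3 when K = 4t.

    Lower bound.  Projecting the points on a rotating line gives a sequence of
    orders in which adjacent elements are swapped one pair at a time, and the
    number of elements before a swapping pair is the number of points to its
    right ([direction_sweep], [crit_le_flat]).  So one counts, over a half
    turn, the K-shallow swaps: those with fewer than K elements before or
    after them.
    - For K < 4t the count goes by induction, deleting three elements p, q, r
      that each come first at some time ([shallow_step]).  Each is in at least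
      2K such swaps and two of them share at most one, which gives 6K - 3.
      The triple is chosen so that, in a suitable half turn, one or two of the
      three are always on the left ([guard_triple]): then every (K-2)-shallow
      swap of the other elements is K-shallow once p, q, r are put back, and
      so are the swaps at one further position.  The traffic through that
      position is at least 3K - n, because elements that never cross it fall
      in three disjoint sets ([three_phases]).
    - For K = 4t exactly t ranks are left in the middle, and all C(n, 2) pairs
      must swap.  A swap deep in the middle either involves one of the s
      elements that never leave the middle or is paid for by the last entry
      of one of its two elements into the middle ([deep_ub]).  Entries are
      swaps of the kind counted for K but not for K - 1, so few of them means
      few deep swaps, and comparing with C(n, 2) produces the additional 3
      ([middle_lb]).

    Upper bound.  The configuration has three wings of 3t points, permuted by
    a linear map of order three and determinant one, and a line through points
    of two wings leaves the third wing entirely on its left.  Two consecutive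
    wings can be separated by a vertical line, so a pair of points taken one
    from each is determined by the numbers of points of either wing below its
    line ([line_of_counts]); hence there are no more flat pairs between
    different wings than admissible pairs of numbers ([bichromatic_count]).  A
    wing consists of three nearly straight clusters P, Q, S of t, t - 1 and t
    points and of one more point e, placed so that the lines spanned by two
    points of the same cluster, and those of the types PQ and Qe, leave at
    least 4t points on both sides, and all others on at least one side
    (lemmas [PP_sides] to [Se_sides]).  The exceptions are counted in
    [cheap_count], and the two counts add up to [profile] ([flat_ub]). *)

(** * Allowable sequences *)

(** An infinite sequence of linear orders with half period [H]: after [H] steps
    the order is reversed, each step exchanges at most one pair, and a pair is
    exchanged only once within a half period.  Taking all times in [nat]
    allows a half period to start anywhere. *)
Record allowable (T : finType) (H : nat) (lt : nat -> rel T) : Prop := Allowable {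
  seq_irr : forall t x, lt t x x = false;
  seq_trans : forall t, transitive (lt t);
  seq_total : forall t x y, x != y -> lt t x y || lt t y x;
  seq_half : forall t x y, lt (t + H) x y = lt t y x;
  seq_step : forall t x y u v, lt t x y -> lt t.+1 y x ->
    lt t u v -> lt t.+1 v u -> x = u /\ y = v;
  seq_once : forall s t u x y, s <= t -> t <= u -> u <= s + H ->
    lt s x y -> lt t y x -> lt u y x }.

Lemma sum_window (H : nat) (F : nat -> nat) (s : nat) :
  (forall t, F (t + H) = F t) ->
  \sum_(s <= t < s + H) F t = \sum_(0 <= t < H) F t.
Proof.
move=> FH; elim: s => [|s IHs]; first by rewrite add0n.
rewrite -IHs; case: H FH IHs => [|h] FH _; first by rewrite !addn0 !big_geq.
rewrite addSn big_nat_recr /=; last by lia.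
by rewrite FH [RHS]big_ltn 1?addnC //; lia.
Qed.

Lemma telescope_leq (F c : nat -> nat) (a b : nat) : a <= b ->
  (forall t, a <= t < b -> F t.+1 <= F t + c t) ->
  F b <= F a + \sum_(a <= t < b) c t.
Proof.
move=> /subnK <-; elim: (b - a) => [|d IHd] Fc; first by rewrite add0n big_geq ?addn0.
rewrite addSn big_nat_recr /=; last by lia.
have := Fc (d + a); have : F (d + a) <= F a + \sum_(a <= t < d + a) c t.
  by apply: IHd => t ht; apply: Fc; lia.
lia.
Qed.

Section AllowableSequence.
Variables (T : finType) (H : nat) (lt : nat -> rel T).
Hypothesis A : allowable H lt.
Implicit Types (S : {set T}) (x y z : T) (t s u : nat).

Definition rk S t x := #|[set z in S | lt t z x]|.
Definition swap t x y := lt t x y && lt t.+1 y x.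
(** [c] is tested at the gate of the swap: the number of elements of [S] that
    precede the swapping pair.  Restricting to a subset [S] is what makes
    deletion of elements possible. *)
Definition hit S t (c : pred nat) :=
  [exists x in S, exists y in S, swap t x y && c (rk S t x)].

Lemma seq_asym t x y : lt t x y -> lt t y x = false.
Proof.
by move=> xy; apply/negP => yx; have := seq_trans A xy yx; rewrite (seq_irr A).
Qed.

Lemma seq_neg t x y : x != y -> lt t y x = ~~ lt t x y.
Proof.
move=> nxy; case: (boolP (lt t x y)) => h; first by rewrite (seq_asym h).
by have := seq_total A t nxy; rewrite (negPf h).
Qed.

Lemma seq_neq t x y : lt t x y -> x != y.
Proof. by move=> h; apply/eqP => e; rewrite e (seq_irr A) in h. Qed.

Lemma swap_neq t x y : swap t x y -> x != y.
Proof. by case/andP => /seq_neq. Qed.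

Lemma swap_lt t x y z w : swap t x y -> (z, w) != (x, y) -> (z, w) != (y, x) ->
  lt t.+1 z w = lt t z w.
Proof.
move=> /andP[xy yx] n1 n2.
have [->|nzw] := eqVneq z w; first by rewrite !(seq_irr A).
case: (boolP (lt t z w)) => h; last first.
  apply/negP => h'; rewrite -(seq_neg _ nzw) in h.
  by case: (seq_step A xy yx h h') => e1 e2; rewrite e1 e2 eqxx in n2.
apply/negPn/negP => h'; rewrite -(seq_neg _ nzw) in h'.
by case: (seq_step A xy yx h h') => e1 e2; rewrite e1 e2 eqxx in n1.
Qed.

Lemma noswap_lt t x y : ~~ swap t x y -> ~~ swap t y x -> lt t.+1 x y = lt t x y.
Proof.
have [->|nxy] := eqVneq x y; first by rewrite !(seq_irr A).
by rewrite /swap (seq_neg t nxy) (seq_neg t.+1 nxy); case: (lt t x y); case: (lt t.+1 x y).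
Qed.

Lemma swap_side t x y z : swap t x y -> z != x -> z != y -> lt t z y = lt t z x.
Proof.
move=> h zx zy; have /andP[xy yx] := h.
case: (boolP (lt t z x)) => k; first exact: (seq_trans A k xy).
apply/negP => zy'; rewrite -(seq_neg _ zx) in k.
have a : lt t.+1 x z.
  by rewrite (swap_lt h) //; apply/eqP => -[] *; subst; rewrite ?eqxx in zx zy.
have b : lt t.+1 z y.
  by rewrite (swap_lt h) //; apply/eqP => -[] *; subst; rewrite ?eqxx in zx zy.
by have := seq_trans A a b; rewrite (seq_asym yx).
Qed.

Lemma rk_swapl t S x y : swap t x y -> x \in S -> rk S t y = (rk S t x).+1.
Proof.
move=> h xS; have /andP[xy yx] := h; rewrite /rk.
have -> : [set z in S | lt t z y] = x |: [set z in S | lt t z x].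
  apply/setP => z; rewrite !inE; have [->|zx] := eqVneq z x; first by rewrite xS xy.
  have [->|zy] := eqVneq z y; first by rewrite (seq_irr A) (seq_asym xy).
  by rewrite (swap_side h).
by rewrite cardsU1 !inE (seq_irr A) andbF.
Qed.

Lemma rk_swapSx t S x y : swap t x y -> y \in S -> rk S t.+1 x = (rk S t x).+1.
Proof.
move=> h yS; have /andP[xy yx] := h; rewrite /rk.
have -> : [set z in S | lt t.+1 z x] = y |: [set z in S | lt t z x].
  apply/setP => z; rewrite !inE; have [->|zy] := eqVneq z y; first by rewrite yS yx.
  have [->|zx] := eqVneq z x; first by rewrite !(seq_irr A).
  by rewrite (swap_lt h) //; apply/eqP => -[] *; subst; rewrite ?eqxx in zx zy.
by rewrite cardsU1 !inE (seq_asym xy) andbF.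
Qed.

Lemma rk_swapSy t S x y : swap t x y -> rk S t.+1 y = rk S t x.
Proof.
move=> h; have /andP[xy yx] := h; apply: eq_card => z; rewrite !inE.
have [->|zy] := eqVneq z y; first by rewrite (seq_asym xy) (seq_irr A).
have [->|zx] := eqVneq z x; first by rewrite (seq_asym yx) (seq_irr A).
rewrite (swap_lt h) ?(swap_side h) //.
  by apply/eqP => -[] *; subst; rewrite eqxx in zx.
by apply/eqP => -[] *; subst; rewrite eqxx in zy.
Qed.

Lemma rk_swap_other t S x y z : swap t x y -> z != x -> z != y ->
  rk S t.+1 z = rk S t z.
Proof.
move=> h zx zy; apply: eq_card => w; rewrite !inE (swap_lt h) //.
  by apply/eqP => -[] *; subst; rewrite eqxx in zy.
by apply/eqP => -[] *; subst; rewrite eqxx in zx.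
Qed.

Lemma step_cases t S :
  (exists x y, [/\ x \in S, y \in S & swap t x y]) \/
  (forall x y, x \in S -> y \in S -> ~~ swap t x y).
Proof.
case: (boolP [exists x in S, exists y in S, swap t x y]) => h; [left | right].
  by case/exists_inP: h => x xS /exists_inP[y yS h]; exists x, y.
move=> x y xS yS; apply: contra h => h; apply/exists_inP; exists x => //.
by apply/exists_inP; exists y.
Qed.

Lemma rk_noswap t S z : (forall x y, x \in S -> y \in S -> ~~ swap t x y) ->
  z \in S -> rk S t.+1 z = rk S t z.
Proof.
move=> h zS; apply: eq_card => w; rewrite !inE; case: (boolP (w \in S)) => //= wS.
by rewrite noswap_lt // h.
Qed.

Lemma hit_swap t S c x y : x \in S -> y \in S -> swap t x y ->
  hit S t c = c (rk S t x).
Proof.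
move=> xS yS h; apply/idP/idP.
  case/exists_inP => u uS /exists_inP[v vS /andP[]].
  by case/andP => uv vu; case/andP: h => xy yx; case: (seq_step A xy yx uv vu) => ->.
move=> k; apply/exists_inP; exists x => //; apply/exists_inP; exists y => //.
by rewrite h.
Qed.

Lemma hit_noswap t S c : (forall x y, x \in S -> y \in S -> ~~ swap t x y) ->
  hit S t c = false.
Proof.
move=> h; case: (boolP (hit S t c)) => // /exists_inP[u uS /exists_inP[v vS /andP[k _]]].
by have := h _ _ uS vS; rewrite k.
Qed.

Lemma rk_ltn S t x : x \in S -> rk S t x < #|S|.
Proof.
move=> xS; apply: proper_card; apply/properP; split.
  by apply/subsetP => z; rewrite inE => /andP[].
by exists x => //; rewrite inE (seq_irr A) andbF.
Qed.

Lemma rk_mono S t x y : x \in S -> lt t x y -> rk S t x < rk S t y.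
Proof.
move=> xS xy; apply: proper_card; apply/properP; split.
  by apply/subsetP => z; rewrite !inE => /andP[-> zx]; exact: (seq_trans A zx xy).
by exists x; rewrite !inE xS ?xy // (seq_irr A).
Qed.

Lemma rk_inj S t : {in S &, injective (rk S t)}.
Proof.
move=> x y xS yS e; apply/eqP/negPn/negP => nxy.
case/orP: (seq_total A t nxy) => h; first by have := rk_mono xS h; rewrite e ltnn.
by have := rk_mono yS h; rewrite e ltnn.
Qed.

Lemma rk_imset S t : (fun x => inord (rk S t x) : 'I_#|S|.+1) @: S =
  [set i : 'I_#|S|.+1 | i < #|S|].
Proof.
apply/eqP; rewrite eqEcard; apply/andP; split.
  apply/subsetP => _ /imsetP[x xS ->]; rewrite inE inordK ?rk_ltn //.
  by rewrite ltnS ltnW ?rk_ltn.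
rewrite card_in_imset; last first.
  move=> x y xS yS /(congr1 val) /=; have := rk_ltn t xS; have := rk_ltn t yS.
  by move=> hx hy; rewrite !inordK ?ltnS 1?ltnW //; apply: rk_inj.
rewrite (_ : [set _ | _] = [set~ ord_max]) ?cardsC1 ?card_ord //.
by apply/setP => i; rewrite !inE -val_eqE /=; have := ltn_ord i; lia.
Qed.

Lemma rk_surj S t g : g < #|S| -> exists2 x, x \in S & rk S t x = g.
Proof.
move=> hg; have : (inord g : 'I_#|S|.+1) \in [set i : 'I_#|S|.+1 | i < #|S|].
  by rewrite inE inordK //; lia.
rewrite -(rk_imset S t) => /imsetP[x xS /(congr1 val)].
by rewrite /= !inordK; [exists x| have := rk_ltn t xS; lia | lia].
Qed.

Lemma card_rk_lt S t G : G <= #|S| -> #|[set x in S | rk S t x < G]| = G.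
Proof.
elim: G => [|G IH] hG.
  by apply/eqP; rewrite cards_eq0; apply/eqP/setP => x; rewrite !inE ltn0 andbF.
have [x xS xG] := rk_surj t hG.
have -> : [set y in S | rk S t y < G.+1] = x |: [set y in S | rk S t y < G].
  apply/setP => y; rewrite !inE; have [->|nyx] := eqVneq y x; first by rewrite xS xG ltnS leqnn.
  case: (boolP (y \in S)) => //= yS; rewrite ltnS leq_eqVlt; case: eqP => // e.
  by case/eqP: nyx; apply: (@rk_inj S t _ _ yS xS); rewrite e xG.
by rewrite cardsU1 IH ?inE ?xS ?xG ?ltnn //; lia.
Qed.

Lemma swap_half t x y : swap (t + H) x y = swap t y x.
Proof. by rewrite /swap -addSn !(seq_half A). Qed.

Lemma rk_half S t x : x \in S -> rk S (t + H) x + rk S t x = #|S|.-1.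
Proof.
move=> xS; have -> : #|S|.-1 = #|S :\ x| by rewrite (cardsD1 x S) xS.
rewrite -(cardsID [set z | lt t x z] (S :\ x)); congr (_ + _).
  apply: eq_card => z; rewrite !inE (seq_half A).
  by case: (boolP (lt t x z)) => h; rewrite ?andbF // eq_sym (seq_neq h) //= andbT.
apply: eq_card => z; rewrite !inE; have [->|nzx] := eqVneq z x.
  by rewrite (seq_irr A) andbF.
by rewrite (seq_neg _ nzx) negbK andbC.
Qed.

Lemma rk_lt2 S t x y : x \in S -> y \in S -> swap t x y -> rk S t x + 2 <= #|S|.
Proof. by move=> xS yS h; have := rk_ltn t yS; rewrite (rk_swapl h xS); lia. Qed.

(** In the second half of the period the order is reversed, so gates are
    counted from the other end. *)
Lemma hit_half S t c : hit S (t + H) c = hit S t (fun g => c (#|S| - 2 - g)).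
Proof.
case: (step_cases t S) => [[x [y [xS yS h]]]|h].
  rewrite (hit_swap _ xS yS h) (@hit_swap _ _ _ y x) ?swap_half //.
  have := rk_half t yS; rewrite (rk_swapl h xS); have := rk_lt2 xS yS h => h1 h2.
  by congr c; lia.
by rewrite !hit_noswap // => x y xS yS; rewrite ?swap_half; apply: h.
Qed.

Lemma eq_hit S t (c d : pred nat) : (forall g, g + 2 <= #|S| -> c g = d g) ->
  hit S t c = hit S t d.
Proof.
move=> cd; case: (step_cases t S) => [[x [y [xS yS h]]]|h]; last by rewrite !hit_noswap.
by rewrite !(hit_swap _ xS yS h) cd // (rk_lt2 xS yS h).
Qed.

End AllowableSequence.

(** * Swaps near the two ends *)

Lemma sum_bool_le1 (P : pred nat) (a b : nat) :
  (forall t u, a <= t < b -> a <= u < b -> P t -> P u -> t = u) ->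
  \sum_(a <= t < b) P t <= 1.
Proof.
move=> h; have -> : \sum_(a <= t < b) P t = size (filter P (index_iota a b)).
  by rewrite size_filter -sum1_count [RHS]big_mkcond; apply: eq_bigr => t _; case: (P t).
case E : (filter P _) => [|t [|u l]] //.
have m v : v \in t :: u :: l -> P v /\ a <= v < b.
  by rewrite -E mem_filter mem_index_iota => /andP[].
have [Pt ht] := m t (mem_head _ _).
have [Pu hu] : P u /\ a <= u < b by apply: m; rewrite !inE eqxx orbT.
have : uniq (t :: u :: l) by rewrite -E filter_uniq ?iota_uniq.
by rewrite (h t u ht hu Pt Pu) /= inE eqxx.
Qed.

(** Gates with fewer than [K] elements on one side, among [n] elements. *)
Definition crit n K g := (g < K) || (n < g + K + 2).

Section Shallow.
Variables (T : finType) (H : nat) (lt : nat -> rel T).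
Hypothesis A : allowable H lt.
Implicit Types (S : {set T}) (x y z : T) (t s u : nat).
Local Notation rk := (rk lt).
Local Notation swap := (swap lt).
Local Notation hit := (hit lt).

Lemma rk0_lt S t x z : x \in S -> z \in S -> rk S t x = 0 -> z != x -> lt t x z.
Proof.
move=> xS zS /eqP; rewrite cards_eq0 => /eqP/setP/(_ z); rewrite !inE zS /= => h nzx.
by rewrite (seq_neg A) // h.
Qed.

(** Everything is behind a first element, and each other element overtakes it
    once within the half period, so its rank can only grow. *)
Lemma rk_incr S s t u x : x \in S -> rk S s x = 0 -> s <= t -> t <= u -> u <= s + H ->
  rk S t x <= rk S u x.
Proof.
move=> xS x0 st tu us; apply: subset_leq_card; apply/subsetP => z.
rewrite !inE => /andP[zS zx]; rewrite zS /=.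
exact: (seq_once A st tu us (rk0_lt xS zS x0 (seq_neq A zx)) zx).
Qed.

Lemma rk_decr S s t u x : x \in S -> rk S s x = 0 -> t <= u -> u <= s -> s <= t + H ->
  rk S u x <= rk S t x.
Proof.
move=> xS x0 tu us st; apply: subset_leq_card; apply/subsetP => z.
rewrite !inE => /andP[zS zx]; rewrite zS /=; apply/negPn/negP => h.
have nzx := seq_neq A zx; rewrite -(seq_neg A _ nzx) in h.
have := seq_once A tu us st h zx.
by rewrite (seq_asym A (rk0_lt xS zS x0 nzx)).
Qed.

Definition moved S t z := [exists y in S, swap t z y || swap t y z].

Lemma moved_swap S t x y z : x \in S -> y \in S -> swap t x y ->
  moved S t z = (z == x) || (z == y).
Proof.
move=> xS yS h; have /andP[xy yx] := h; apply/exists_inP/idP.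
  by case=> u uS /orP[] /andP[k1 k2]; case: (seq_step A xy yx k1 k2) => -> ->;
    rewrite eqxx ?orbT.
by case/orP=> /eqP->; [exists y | exists x]; rewrite ?h ?orbT.
Qed.

Lemma both_swap t x y p q : swap t x y ->
  swap t p q || swap t q p = ((p == x) && (q == y)) || ((p == y) && (q == x)).
Proof.
move=> h; have /andP[xy yx] := h; apply/idP/idP.
  by case/orP=> /andP[k1 k2]; case: (seq_step A xy yx k1 k2) => -> ->; rewrite !eqxx ?orbT.
by case/orP=> /andP[/eqP-> /eqP->]; rewrite h ?orbT.
Qed.

Lemma sum_both s x y :
  \sum_(s <= t < s + H) (swap t x y || swap t y x) <= 1.
Proof.
have key : forall x y t u, s <= t -> t < u -> u < s + H -> swap t x y ->
    ~~ (swap u x y || swap u y x).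
  move=> {}x {}y t u st tu us /andP[xy yx].
  have k v : t < v -> v <= t + H -> lt v y x.
    by move=> h1 h2; apply: (seq_once A (leqnSn t) h1 h2 xy yx).
  by rewrite /swap !(seq_asym A (k u _ _)) ?(seq_asym A (k u.+1 _ _)) ?andbF //=; lia.
apply: sum_bool_le1 => t u /andP[st ts] /andP[su us] ht hu.
case: (ltngtP t u) => // tu.
  by case/orP: ht => h; have := key _ _ t u st tu us h; rewrite ?hu // orbC hu.
by case/orP: hu => h; have := key _ _ u t su tu ts h; rewrite ?ht // orbC ht.
Qed.

Lemma crit_half S t K : hit S (t + H) (crit #|S| K) = hit S t (crit #|S| K).
Proof.
by rewrite (hit_half A); apply: (eq_hit A) => g hg; rewrite /crit orbC; congr (_ || _); lia.
Qed.

Lemma moved_half S t x : moved S (t + H) x = moved S t x.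
Proof. by apply: eq_existsb => y; rewrite !(swap_half A) orbC. Qed.

(** Within a half period the rank of [x] goes from 0 to #|S| - 1, crossing each
    of the [K] first and [K] last gates. *)
Lemma extreme_shallow S K s x : x \in S -> rk S s x = 0 -> 2 * K < #|S| ->
  2 * K <= \sum_(0 <= t < H) (hit S t (crit #|S| K) && moved S t x).
Proof.
move=> xS x0 hK; rewrite -(sum_window s); last first.
  by move=> t; rewrite crit_half moved_half.
(* the number of shallow gates that x has already crossed *)
pose F t := minn (rk S t x) K + (rk S t x - (#|S| - 1 - K)).
have Fs : F s = 0 by rewrite /F x0; lia.
have Fe : F (s + H) = 2 * K by rewrite /F; have := rk_half A s xS; rewrite x0; lia.
pose c t := (hit S t (crit #|S| K) && moved S t x : nat).
have := @telescope_leq F c s (s + H) (leq_addr _ _); rewrite Fs Fe; apply => t _.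
rewrite /F /c.
case: (step_cases lt t S) => [[u [v [uS vS h]]]|h]; last by rewrite (rk_noswap A h xS); lia.
rewrite (hit_swap A _ uS vS h) (moved_swap _ uS vS h).
have [->|xu] := eqVneq x u.
  rewrite (rk_swapSx A h vS) /= andbT /crit; lia.
have [->|xv] := eqVneq x v.
  by rewrite (rk_swapSy A _ h) (rk_swapl A h uS); lia.
by rewrite (rk_swap_other A _ h xu xv); lia.
Qed.

(** The last [G] elements at time [t] are the leaders at time [t + H]. *)
Definition leaders S t G := [set x in S | rk S t x < G].

(** The block changes only by a swap at gate [G - 1], which replaces one element;
    [B] is the element expelled, if any. *)
Lemma leaders_step S t G : 0 < G ->
  exists2 B : {set T}, #|B| <= hit S t (pred1 G.-1) & leaders S t G \subset B :|: leaders S t.+1 G.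
Proof.
move=> G0; case: (step_cases lt t S) => [[x [y [xS yS h]]]|h]; last first.
  exists set0; rewrite ?cards0 // set0U; apply/subsetP => z; rewrite !inE => /andP[zS].
  by rewrite zS (rk_noswap A h zS).
rewrite (hit_swap A _ xS yS h) /=.
have sub z : z != x -> z \in leaders S t G -> z \in leaders S t.+1 G.
  move=> zx; rewrite !inE => /andP[zS]; rewrite zS /=; have [->|zy] := eqVneq z y.
    by rewrite (rk_swapSy A _ h) (rk_swapl A h xS); lia.
  by rewrite (rk_swap_other A _ h zx zy).
have [e|e] := eqVneq (rk S t x) G.-1.
  exists [set x]; rewrite ?cards1 //; apply/subsetP => z hz; rewrite inE in_set1.
  by have [//|zx] := eqVneq z x; rewrite (sub z).
exists set0; rewrite ?cards0 // set0U; apply/subsetP => z.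
have [->|zx] := eqVneq z x; last exact: sub.
by rewrite !inE xS (rk_swapSx A h yS) /=; lia.
Qed.

(** An element of the initial block that is missing in the final one has been
    expelled by a swap of its own. *)
Lemma flow S G a b : 0 < G <= #|S| -> a <= b ->
  G <= #|leaders S a G :&: leaders S b G| + \sum_(a <= t < b) hit S t (pred1 G.-1).
Proof.
case/andP=> G0 GS ab.
pose F t := G - #|leaders S a G :&: leaders S t G|.
have := @telescope_leq F (fun t => hit S t (pred1 G.-1)) a b ab _.
have Fa : F a = 0 by rewrite /F setIid /leaders (card_rk_lt A) // subnn.
rewrite Fa add0n => h.
have : F b <= \sum_(a <= t < b) hit S t (pred1 G.-1); last by rewrite /F; lia.
apply: h => t _; rewrite /F; have [B hB sB] := leaders_step S t G0.
have : #|leaders S a G :&: leaders S t G| <= #|B| + #|leaders S a G :&: leaders S t.+1 G|.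
  apply: leq_trans (leq_trans _ (leq_card_setU B (leaders S a G :&: leaders S t.+1 G))) _ => //.
  apply: subset_leq_card; apply/subsetP => z /setIP[za zt].
  by have := subsetP sB z zt; rewrite !(inE, za) /= => ->.
lia.
Qed.

Lemma flow_last S G a b : 0 < G -> G < #|S| -> a <= b ->
  G <= #|leaders S (a + H) G :&: leaders S (b + H) G|
       + \sum_(a <= t < b) hit S t (pred1 (#|S| - 1 - G)).
Proof.
move=> G0 GS ab; have : 0 < G <= #|S| by lia.
move/(@flow S G (a + H) (b + H))/(_ _)/leq_trans => h; apply: h; first by rewrite leq_add2r.
rewrite leq_add2l big_addn addnK; apply: leq_sum => t _.
rewrite (hit_half A) leq_eqVlt; apply/orP; left; apply/eqP; congr nat_of_bool.
by apply: (eq_hit A) => g hg /=; apply/eqP/eqP; lia.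
Qed.

Lemma leaders_opp S t G : 2 * G <= #|S| -> [disjoint leaders S t G & leaders S (t + H) G].
Proof.
move=> hG; apply/pred0P => z /=; apply/negP => /andP[]; rewrite !inE.
by move=> /andP[zS h1] /andP[_ h2]; have := rk_half A t zS; have := rk_ltn A t zS; lia.
Qed.

(** The elements that stay among the first [G] in the first phase, among the
    last [G] in the second and among the first [G] in the third form three
    disjoint sets, since nothing is among the first and the last [G] at the
    same time, and these blocks are exchanged between times [a] and [a + H].
    All other elements of the three blocks are paid for by swaps. *)
Lemma three_phases S G a b c : 0 < G -> 2 * G < #|S| -> a <= b -> b <= c -> c <= a + H ->
  3 * G <= #|S| + \sum_(a <= t < b) hit S t (pred1 G.-1)
    + \sum_(b <= t < c) hit S t (pred1 (#|S| - 1 - G))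
    + \sum_(c <= t < a + H) hit S t (pred1 G.-1).
Proof.
move=> G0 GS ab bc ca.
have h1 : G <= #|leaders S a G :&: leaders S b G| + \sum_(a <= t < b) hit S t (pred1 G.-1).
  by apply: flow => //; lia.
have h2 : G <= #|leaders S (b + H) G :&: leaders S (c + H) G|
       + \sum_(b <= t < c) hit S t (pred1 (#|S| - 1 - G)).
  by apply: flow_last => //; lia.
have h3 : G <= #|leaders S c G :&: leaders S (a + H) G|
       + \sum_(c <= t < a + H) hit S t (pred1 G.-1).
  by apply: flow => //; lia.
have d t : [disjoint leaders S t G & leaders S (t + H) G] by apply: leaders_opp; lia.
have dd t z : z \in leaders S t G -> z \in leaders S (t + H) G -> False.
  by move=> k1 k2; have /pred0P/(_ z) := d t; rewrite /= k1 k2.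
set X := _ :&: _ in h1; set Y := _ :&: _ in h2; set Z := _ :&: _ in h3.
have XY : X :&: Y = set0.
  by apply/setP => z; rewrite [RHS]inE; apply/negP => /setIP[/setIP[_ k1] /setIP[k2 _]]; exact: dd k1 k2.
have XYZ : (X :|: Y) :&: Z = set0.
  apply/setP => z; rewrite [RHS]inE; apply/negP => /setIP[/setUP[|] /setIP[k1 k2] /setIP[k3 k4]].
    exact: dd k1 k4.
  exact: dd k3 k2.
have : #|X :|: Y :|: Z| <= #|S|.
  apply: subset_leq_card; apply/subsetP => z; rewrite !inE.
  by case/orP => [/orP[]|] /andP[/andP[]].
rewrite cardsU XYZ cardsU XY !cards0; lia.
Qed.

Definition num_crit S K := \sum_(0 <= t < H) hit S t (crit #|S| K).

Lemma rk_setD3 S p q r t x : p \in S -> q \in S -> r \in S ->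
  p != q -> p != r -> q != r ->
  rk S t x = rk (S :\: [set p; q; r]) t x + lt t p x + lt t q x + lt t r x.
Proof.
move=> pS qS rS pq pr qr; rewrite /rk.
rewrite (cardsD1 p) (cardsD1 q) (cardsD1 r) !inE pS qS rS.
rewrite (eq_sym q p) (eq_sym r p) (eq_sym r q) (negPf pq) (negPf pr) (negPf qr) /=.
have -> : #|[set z in S | lt t z x] :\ p :\ q :\ r| =
  #|[set z in S :\: [set p; q; r] | lt t z x]|.
  by apply: eq_card => z; rewrite !inE; case: (z == p); case: (z == q); case: (z == r).
lia.
Qed.

(** A left guard has more than [K] elements after it and a right guard more
    than [K] before it.  Hence a swap preceded by at most [K + 1] elements has
    all right guards after it, and a swap followed by at most [K + 1] elements
    has all left guards before it. *)
Definition guards S K t z (b : bool) :=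
  if b then rk S t z + K + 2 <= #|S| else K < rk S t z.

(** With j left guards among p, q, r, a swap at gate g of the remaining set
    sits at gate at most g + j of [S] if it is close to the left end, and
    symmetrically at the right end. *)
Lemma guarded_crit S K p q r t x y (bp bq br : bool) :
  p \in S -> q \in S -> r \in S -> p != q -> p != r -> q != r ->
  guards S K t p bp -> guards S K t q bq -> guards S K t r br ->
  0 < bp + bq + br < 3 ->
  let S3 := S :\: [set p; q; r] in
  x \in S3 -> y \in S3 -> swap t x y ->
  (rk S3 t x + (bp + bq + br) < K) || (#|S| + (3 - (bp + bq + br)) < rk S3 t x + K + 5) ->
  crit #|S| K (rk S t x).
Proof.
move=> pS qS rS pq pr qr gp gq gr b3 S3 xS3 yS3 h.
have xS : x \in S by move: xS3; rewrite inE => /andP[].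
have yS : y \in S by move: yS3; rewrite inE => /andP[].
have e := rk_setD3 t x pS qS rS pq pr qr; rewrite -/S3 in e.
have ry := rk_swapl A h xS.
have xy2 := rk_lt2 A xS yS h.
have out z : z \in [set p; q; r] -> z != x /\ z != y.
  by move=> hz; split; apply/eqP => k; move: xS3 yS3; rewrite !inE -k;
     move: hz; rewrite !inE => ->.
have side z b : z \in S -> z \in [set p; q; r] -> guards S K t z b ->
   (lt t z x -> ~~ b -> K + 1 < rk S t x) /\ (~~ lt t z x -> b -> rk S t x + 2 + K + 2 <= #|S|).
  move=> zS hz; have [zx zy] := out z hz; rewrite /guards => g; split=> k1 k2.
    by move: (rk_mono A zS k1) g; rewrite (negPf k2); clear; lia.
  move: g; rewrite k2; rewrite -(seq_neg A _ zx) in k1.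
  have : lt t y z by rewrite (seq_neg A) // (swap_side A h) // (seq_asym A k1).
  by move/(rk_mono A yS); rewrite ry; clear; lia.
have [|sp1 sp2] := side p bp pS _ gp; first by rewrite !inE eqxx.
have [|sq1 sq2] := side q bq qS _ gq; first by rewrite !inE eqxx orbT.
have [|sr1 sr2] := side r br rS _ gr; first by rewrite !inE eqxx orbT.
rewrite /crit; case/orP => k.
  have : rk S t x < K; last by move=> ->.
  move: sp1 sq1 sr1 e b3 k; move: (rk S t x) (rk S3 t x) => X g; clear.
  case: (lt t p x); case: (lt t q x); case: (lt t r x); case: bp; case: bq;
    case: br => /=; lia.
have : #|S| < rk S t x + K + 2; last by move=> ->; rewrite orbT.
move: sp2 sq2 sr2 e b3 k xy2; move: (rk S t x) (rk S3 t x) => X g; clear.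
by case: (lt t p x); case: (lt t q x); case: (lt t r x); case: bp; case: bq;
    case: br => /=; lia.
Qed.

(** At each step a swap is counted for p, q, r together at most twice, twice
    only if it exchanges two of them, and not at all if it takes place in the remaining
    set. *)
Lemma triple_count S t p q r K (c3 : pred nat) (bp bq br : bool) :
  p \in S -> q \in S -> r \in S -> p != q -> p != r -> q != r ->
  guards S K t p bp -> guards S K t q bq -> guards S K t r br ->
  0 < bp + bq + br < 3 ->
  (forall g, c3 g -> (g + (bp + bq + br) < K) || (#|S| + (3 - (bp + bq + br)) < g + K + 5)) ->
  let c z := (hit S t (crit #|S| K) && moved S t z : nat) in
  let b x y := (swap t x y || swap t y x : nat) in
  c p + c q + c r + hit (S :\: [set p; q; r]) t c3
    <= hit S t (crit #|S| K) + b p q + b p r + b q r.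
Proof.
move=> pS qS rS pq pr qr gp gq gr b3 hc /=.
set S3 := S :\: _; have S3S x : x \in S3 -> x \in S by rewrite inE => /andP[].
case: (step_cases lt t S) => [[x [y [xS yS h]]]|h]; last first.
  by rewrite !hit_noswap // => x y /S3S xS /S3S yS; apply: h.
rewrite !(moved_swap _ xS yS h) !(both_swap _ _ h) (hit_swap A _ xS yS h).
have nxy := swap_neq A h.
case: (boolP ((x \in S3) && (y \in S3))) => [/andP[x3 y3]|n3].
  rewrite (hit_swap A _ x3 y3 h).
  have o z : z \in [set p; q; r] -> (z == x) = false /\ (z == y) = false.
    by move=> hz; split; apply/negP => /eqP k; move: x3 y3; rewrite !inE -k;
     move: hz; rewrite !inE => ->.
  have [|-> ->] := o p _; first by rewrite !inE eqxx.
  have [|-> ->] := o q _; first by rewrite !inE eqxx orbT.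
  have [|-> ->] := o r _; first by rewrite !inE eqxx orbT.
  rewrite !andbF /= !add0n !addn0; case: (boolP (c3 _)) => // k.
  by rewrite (guarded_crit pS qS rS pq pr qr gp gq gr b3 x3 y3 h) // hc.
rewrite (@hit_noswap _ _ _ S3); last first.
  move=> u v u3 v3; apply: contra n3 => /andP[k1 k2].
  by case/andP: h => xy yx; case: (seq_step A xy yx k1 k2) => -> ->; rewrite u3 v3.
have d z w v : z != w -> (z == v) && (w == v) = false.
  by move=> zw; apply/negP => /andP[/eqP k1 /eqP k2]; rewrite k1 k2 eqxx in zw.
move: (d _ _ x pq) (d _ _ y pq) (d _ _ x pr) (d _ _ y pr) (d _ _ x qr) (d _ _ y qr).
have e z : (z == x) && (z == y) = false.
  by apply/negP => /andP[/eqP k1 /eqP k2]; rewrite -k1 -k2 eqxx in nxy.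
move: (e p) (e q) (e r).
case: (crit _ _ _) => /=.
by case: (p == x); case: (p == y); case: (q == x); case: (q == y); case: (r == x); case: (r == y).
by move=> *.
Qed.

Lemma rk_stepS S t x : x \in S -> rk S t.+1 x <= (rk S t x).+1.
Proof.
move=> xS; case: (step_cases lt t S) => [[u [v [uS vS h]]]|h]; last by rewrite (rk_noswap A h xS).
have [->|xu] := eqVneq x u; first by rewrite (rk_swapSx A h vS).
have [->|xv] := eqVneq x v; first by rewrite (rk_swapSy A _ h) (rk_swapl A h uS); lia.
by rewrite (rk_swap_other A _ h xu xv).
Qed.

Lemma hit_or S t (c d : pred nat) : (forall g, g + 2 <= #|S| -> ~~ (c g && d g)) ->
  hit S t (fun g => c g || d g) = hit S t c + hit S t d :> nat.
Proof.
move=> cd; case: (step_cases lt t S) => [[u [v [uS vS h]]]|h]; last by rewrite !hit_noswap.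
rewrite !(hit_swap A _ uS vS h); have := cd _ (rk_lt2 A uS vS h).
by case: (c _); case: (d _).
Qed.

Lemma num_critE S K s : num_crit S K = \sum_(s <= t < s + H) hit S t (crit #|S| K).
Proof. by rewrite (sum_window s) // => t; rewrite crit_half. Qed.

(** [p] is first at time 0, and the window starts at the first time [a] when it
    has more than [K] elements before it: from then on [p] is a right guard.
    Among the elements that come first after time [a], let [r] be the earliest
    one that was close to the right end at time [a], and [q] its predecessor.
    While waiting to become first, [q] is a left guard, and it becomes a right
    guard at some later time [c]; [r] starts close to the right end, hence as
    a right guard, and is a left guard from time [b] on.  Since [b <= c], the
    left guards are q, then q and r, then r alone. *)
Lemma guard_triple S K : 0 < K -> 2 * K + 2 <= #|S| ->
  exists p q r a b c, [/\ [/\ p \in S, q \in S & r \in S],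
    [/\ p != q, p != r & q != r],
    [/\ exists s, rk S s p = 0, exists s, rk S s q = 0 & exists s, rk S s r = 0],
    [/\ a <= b, b <= c & c <= a + H] &
    forall t, a <= t < a + H -> [/\ guards S K t p false,
      guards S K t q (t < c) & guards S K t r (b <= t)]].
Proof.
move=> K0 hK.
have [p pS p0] : exists2 p, p \in S & rk S 0 p = 0 by apply: (rk_surj A); lia.
have : exists t, K < rk S t p.
  by exists (0 + H); have := rk_half A 0 pS; rewrite p0; lia.
move=> /ex_minnP[a ha mina].
have aH : a <= H by apply: mina; have := rk_half A 0 pS; rewrite p0 add0n; lia.
have gp t : a <= t < a + H -> K < rk S t p.
  case/andP=> at_ ta; case: (leqP t H) => tH.
    by apply: leq_trans ha _; apply: rk_incr p0 _ _ _ => //; lia.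
  have := rk_half A (t - H) pS; rewrite subnK; last by lia.
  by case: (ltnP K (rk S (t - H) p)) => [/mina|]; lia.
have pa : rk S a p <= K + 1.
  case: (posnP a) ha mina => [->|a0 ha mina]; first by rewrite p0.
  have := rk_stepS a.-1 pS; rewrite prednK //.
  by case: (ltnP K (rk S a.-1 p)) => [/mina|]; lia.
(* the first element at time t was not close to the right end at time a *)
pose Q t := [exists x in S, (rk S t x == 0) && (rk S a x + K + 2 <= #|S|)].
have Qa : Q a.
  have [x xS x0] : exists2 x, x \in S & rk S a x = 0 by apply: (rk_surj A); lia.
  by apply/exists_inP; exists x; rewrite // x0 eqxx; lia.
have : exists d, ~~ Q (a + d).
  exists H; apply/exists_inP => -[x xS /andP[/eqP x0 hx]].
  by have := rk_half A a xS; rewrite x0; lia.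
case/ex_minnP=> d Qd mind.
have d0 : 0 < d by case: (posnP d) Qd => // ->; rewrite addn0 Qa.
have dH : d <= H.
  apply: mind; apply/exists_inP => -[x xS /andP[/eqP x0 hx]].
  by have := rk_half A a xS; rewrite x0; lia.
set s := a + d in Qd.
have sE : s.-1.+1 = s by rewrite prednK // /s; lia.
have : Q s.-1.
  case: (boolP (Q s.-1)) => // k; have := mind d.-1.
  by rewrite (_ : a + d.-1 = s.-1) /s; [move=> /(_ k); lia | lia].
case/exists_inP => q qS /andP[/eqP q0 hq].
have [r rS r0] : exists2 r, r \in S & rk S s r = 0 by apply: (rk_surj A); lia.
have hr : #|S| < rk S a r + K + 2.
  rewrite ltnNge; apply: contra Qd => k; apply/exists_inP; exists r => //.
  by rewrite r0 eqxx.
have pq : p != q by apply/eqP => e; have := gp s.-1; rewrite e q0; lia.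
have pr : p != r.
  apply/eqP => e; case: (ltnP s (a + H)) => k.
    by have := gp s; rewrite e r0; lia.
  by have := rk_half A a pS; rewrite (_ : a + H = s) ?e ?r0 -?e; lia.
have qr : q != r by apply/eqP => e; rewrite -e in hr; lia.
have : exists u, (s <= u) && ((K < rk S u q) || (u == a + H)).
  by exists (a + H); rewrite eqxx orbT andbT; lia.
case/ex_minnP=> c /andP[sc hc] minc.
have cH : c <= a + H by apply: minc; rewrite eqxx orbT andbT; lia.
have : exists u, (a <= u) && (rk S u r <= K).
  by exists s; rewrite r0; lia.
case/ex_minnP=> b /andP[ab hb] minb.
have bs : b <= s by apply: minb; rewrite r0; lia.
have gq1 u : a <= u < c -> rk S u q + K + 2 <= #|S|.
  case/andP=> au uc; case: (ltnP u s) => us.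
    suff : rk S u q <= rk S a q by lia.
    by apply: rk_decr q0 _ _ _ => //; lia.
  case: (leqP (rk S u q) K) => k; first by lia.
  by have := minc u; rewrite us k; lia.
have gq2 u : c <= u < a + H -> K < rk S u q.
  case/andP=> cu uH; case/orP: hc => [hc|/eqP hc]; last by lia.
  by apply: leq_trans hc _; apply: rk_incr q0 _ _ _ => //; lia.
have gr1 u : a <= u < b -> K < rk S u r.
  by case/andP=> au ub; rewrite ltnNge; apply/negP => k; have := minb u; rewrite au k; lia.
have gr2 u : b <= u < a + H -> rk S u r + K + 2 <= #|S|.
  case/andP=> bu uH; suff : rk S u r <= K by lia.
  case: (leqP u s) => us.
    by apply: leq_trans hb; apply: rk_decr r0 _ _ _ => //; lia.
  have : rk S u r <= rk S (a + H) r by apply: rk_incr r0 _ _ _ => //; lia.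
  by have := rk_half A a rS; lia.
exists p, q, r, a, b, c; split=> //; first by split; [exists 0 | exists s.-1 | exists s].
  by split=> //; exact: leq_trans bs sc.
move=> t ht; have /andP[at_ tH] := ht; split; rewrite /guards; first exact: gp.
  by case: (ltnP t c) => tc; [apply: gq1; rewrite at_ | apply: gq2; rewrite tc].
by case: (leqP b t) => tb; [apply: gr2; rewrite tb | apply: gr1; rewrite at_].
Qed.

(** The summand 6K - 3 comes from the swaps of p, q, r, the summand 3K - #|S|
    from the swaps of the remaining set at one extra gate: the (K-1)-st from
    the left while there is one left guard, the (K-1)-st from the right while
    there are two. *)
Lemma shallow_step S K : 0 < K -> 2 * K + 2 <= #|S| ->
  exists2 S3 : {set T}, #|S3| = #|S| - 3 &
    6 * K - 3 + (3 * K - #|S|) + num_crit S3 (K - 2) <= num_crit S K.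
Proof.
move=> K0 hK.
have [p [q [r [a [b [c [[pS qS rS] [pq pr qr] [xp xq xr] [ab bc cH] gd]]]]]]] := guard_triple K0 hK.
set S3 := S :\: [set p; q; r].
have c3 : #|S3| = #|S| - 3.
  rewrite /S3 cardsD (setIidPr _); last first.
    by apply/subsetP => z; rewrite !inE => /orP[/orP[]|] /eqP->.
  rewrite setUAC -setUA cardsU1 !inE negb_or pq pr.
  by rewrite cards2 eq_sym qr.
exists S3 => //.
pose m z t := (hit S t (crit #|S| K) && moved S t z : nat).
pose bo x y t := (swap t x y || swap t y x : nat).
have mz z : z \in S -> (exists s, rk S s z = 0) -> 2 * K <= \sum_(a <= t < a + H) m z t.
  move=> zS [u z0]; rewrite sum_window /m; last by move=> t; rewrite crit_half moved_half.
  by apply: extreme_shallow z0 _ => //; clear -hK; lia.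
have {mz} [mp mq mr] := And3 (mz p pS xp) (mz q qS xq) (mz r rS xr).
have bpq : \sum_(a <= t < a + H) bo p q t <= 1 by apply: sum_both.
have bpr : \sum_(a <= t < a + H) bo p r t <= 1 by apply: sum_both.
have bqr : \sum_(a <= t < a + H) bo q r t <= 1 by apply: sum_both.
(* the gates of the remaining set that the guards make shallow; there are none if K = 1 *)
pose E gate g := (1 < K) && (crit #|S3| (K - 2) g || (g == gate)).
pose e t := (hit S3 t (E (if (b <= t) && (t < c) then #|S3| - 1 - (K - 1) else (K - 1).-1)) : nat).
have main t : a <= t < a + H ->
   m p t + m q t + m r t + e t <= hit S t (crit #|S| K) + bo p q t + bo p r t + bo q r t.
  move=> /gd[gp gq gr]; apply: (triple_count pS qS rS pq pr qr gp gq gr).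
    by move: bc; clear; case: (ltnP t c); case: (leqP b t); lia.
  move=> g; rewrite /E /crit c3; move: bc hK; clear.
  by case: (leqP b t); case: (ltnP t c) => /=; lia.
have : \sum_(a <= t < a + H) (m p t + m q t + m r t + e t)
  <= \sum_(a <= t < a + H) (hit S t (crit #|S| K) + bo p q t + bo p r t + bo q r t).
  by rewrite !big_nat; apply: leq_sum => t ht; exact: main.
rewrite !big_split /= (num_critE S K a).
suff : (3 * K - #|S|) + num_crit S3 (K - 2) <= \sum_(a <= t < a + H) e t.
  move: mp mq mr bpq bpr bqr K0.
  move: (\sum_(a <= t < a + H) m p t) (\sum_(a <= t < a + H) m q t) (\sum_(a <= t < a + H) m r t).
  move: (\sum_(a <= t < a + H) bo p q t) (\sum_(a <= t < a + H) bo p r t) (\sum_(a <= t < a + H) bo q r t).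
  move: (\sum_(a <= t < a + H) e t) (num_crit S3 _) (\sum_(a <= t < a + H) hit _ _ _); clear; lia.
case: (ltnP 1 K) => K1; last first.
  have -> : num_crit S3 (K - 2) = 0; last by move: K1 hK; clear; lia.
  rewrite /num_crit big1 // => t _; apply/eqP; rewrite eqb0; apply/negP.
  rewrite (_ : hit _ _ _ = hit S3 t pred0); first by case/exists_inP => ? _ /exists_inP[? _]; rewrite andbF.
  by apply: (eq_hit A) => g hg; apply/negbTE; rewrite /crit; clear -K1 hg; lia.
have h t gate : crit #|S3| (K - 2) gate = false ->
   hit S3 t (E gate) = hit S3 t (crit #|S3| (K - 2)) + hit S3 t (pred1 gate) :> nat.
  move=> hg; rewrite -hit_or /E ?K1 //= => g _; apply/negP => /andP[k /eqP ge].
  by rewrite ge hg in k.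
have g1 : crit #|S3| (K - 2) (K - 1).-1 = false by rewrite /crit c3; clear -hK K1; lia.
have g2 : crit #|S3| (K - 2) (#|S3| - 1 - (K - 1)) = false.
  by rewrite /crit c3; clear -hK K1; lia.
have := @three_phases S3 (K - 1) a b c _ _ ab bc cH.
move=> /(_ ltac:(clear -K1; lia) ltac:(rewrite c3; clear -K1 hK; lia)) tp.
have -> : \sum_(a <= t < a + H) e t = num_crit S3 (K - 2)
  + \sum_(a <= t < b) hit S3 t (pred1 (K - 1).-1)
  + \sum_(b <= t < c) hit S3 t (pred1 (#|S3| - 1 - (K - 1)))
  + \sum_(c <= t < a + H) hit S3 t (pred1 (K - 1).-1).
  rewrite (num_critE S3 _ a).
  have cut F : \sum_(a <= t < a + H) F t = \sum_(a <= t < b) F t + \sum_(b <= t < c) F t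
      + \sum_(c <= t < a + H) F t.
    rewrite (@big_cat_nat _ _ _ c a (a + H)) //=; last exact: leq_trans ab bc.
    by rewrite (@big_cat_nat _ _ _ b a c).
  rewrite !cut.
  have ph u v gate : crit #|S3| (K - 2) gate = false ->
      (forall t, u <= t < v -> (if (b <= t) && (t < c) then #|S3| - 1 - (K - 1) else (K - 1).-1) = gate) ->
      \sum_(u <= t < v) e t = \sum_(u <= t < v) hit S3 t (crit #|S3| (K - 2))
        + \sum_(u <= t < v) hit S3 t (pred1 gate).
    move=> hg hgate; rewrite -big_split /= !big_nat; apply: eq_bigr => t /hgate ht.
    by rewrite /e ht h.
  rewrite (ph a b (K - 1).-1) //; last by move=> t /andP[_ tb]; rewrite leqNgt tb.
  rewrite (ph b c (#|S3| - 1 - (K - 1))) //; last by move=> t ->.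
  rewrite (ph c (a + H) (K - 1).-1) //; last by move=> t /andP[ct _]; rewrite (ltnNge t) ct andbF.
  move: (\sum_(a <= t < b) _) (\sum_(b <= t < c) _) (\sum_(c <= t < a + H) _).
  move: (\sum_(a <= t < b) _) (\sum_(b <= t < c) _) (\sum_(c <= t < a + H) _).
  by clear; lia.
move: tp; rewrite c3.
move: (\sum_(a <= t < b) _) (\sum_(b <= t < c) _) (\sum_(c <= t < a + H) _) (num_crit _ _).
by clear -K1 hK; lia.
Qed.

(** Replacing K, #|S| by K - 2, #|S| - 3 changes the left-hand side by
    6K - 3 + (3K - #|S|), with truncated subtraction. *)
Lemma shallow_lb K S : 2 * K + 2 <= #|S| ->
  3 * 'C(K.+1, 2) + \sum_(0 <= j < K) (3 * j + 3 - #|S|) <= num_crit S K.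
Proof.
elim/ltn_ind: K S => K IH S hK; case: (posnP K) => [->|K0].
  by rewrite big_geq // bin_small.
have [S3 c3 h] := shallow_step K0 hK; apply: leq_trans h.
case: (ltnP 1 K) => K1; last first.
  have -> : K = 1 by clear -K0 K1; lia.
  by rewrite big_nat1 /= binn; clear; lia.
have := IH (K - 2) _ S3; rewrite c3 => /(_ ltac:(clear -K1; lia) ltac:(clear -K1 hK; lia)).
case: K K1 K0 hK {IH} => [|[|k]] // _ _ hK; rewrite subSS subSS subn0 => h.
apply: leq_trans (leq_add (leqnn _) h) => {h}.
have -> : \sum_(0 <= j < k.+2) (3 * j + 3 - #|S|) = 3 * k.+2 - #|S| + \sum_(0 <= j < k) (3 * j + 3 - (#|S| - 3)).
  rewrite big_nat_recr //= addnC big_nat_recl //= (_ : 3 * 0 + 3 - #|S| = 0); last by clear -hK; lia.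
  rewrite add0n; congr (_ + _); first by clear; lia.
  by apply: eq_bigr => j _; clear -hK; lia.
have e : 'C(k.+3, 2) = 'C(k.+1, 2) + 2 * k + 3 by rewrite !binS !bin0 !bin1; clear; lia.
rewrite e; move: ('C(_, _)) (\sum_(0 <= j < k) _); clear; lia.
Qed.

End Shallow.

(** * Swaps among the middle ranks *)

Section Deep.
Variables (T : finType) (H : nat) (lt : nat -> rel T).
Hypothesis A : allowable H lt.
Variables (S : {set T}) (K : nat).
Hypotheses (H0 : 0 < H) (K0 : 0 < K) (hK : 2 * K < #|S|).
Implicit Types (x y z : T) (t s u : nat).
Local Notation rk := (rk lt).
Local Notation swap := (swap lt).
Local Notation hit := (hit lt).
Local Notation moved := (moved lt).

(** Central elements keep [K] elements on either side; deep swaps exchange two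
    of them, and boundary swaps bring exactly one new element in. *)
Definition central t x := (K <= rk S t x) && (rk S t x + K < #|S|).
Definition enters t x := ~~ central t x && central t.+1 x.
Definition deep t := hit S t (fun g => (K <= g) && (g + K + 2 <= #|S|)).
Definition boundary t := hit S t (fun g => (g == K.-1) || (g + K + 1 == #|S|)).
Definition resident := [set x in S | [forall t : 'I_H, central t x]].
Definition movers t := [set z in S | moved S t z].

Lemma central_half t x : x \in S -> central (t + H) x = central t x.
Proof. by move=> xS; rewrite /central; have := rk_half A t xS; have := rk_ltn A t xS; clear; lia. Qed.

Lemma card_central t : #|[set x in S | central t x]| = #|S| - 2 * K.
Proof.
have h1 := card_rk_lt A t (leq_subr K #|S|).
have h2 : #|[set x in S | rk S t x < K]| = K by apply: (card_rk_lt A); clear -hK; lia.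
have -> : [set x in S | central t x] = [set x in S | rk S t x < #|S| - K] :\: [set x in S | rk S t x < K].
  by apply/setP => x; rewrite !inE /central; case: (x \in S) => //=; clear -hK; lia.
rewrite cardsD (setIidPr _) ?h1 ?h2; first by clear; lia.
by apply/subsetP => x; rewrite !inE => /andP[->] /=; clear -hK; lia.
Qed.

Lemma central_mod t x : x \in S -> central (t %% H) x = central t x.
Proof.
move=> xS; rewrite {2}(divn_eq t H); elim: (t %/ H) => [|q IHq]; first by rewrite mul0n.
by rewrite mulSn -addnA addnC central_half.
Qed.

Lemma resident_central t : resident \subset [set x in S | central t x].
Proof.
apply/subsetP => x; rewrite !inE => /andP[xS /forallP h]; rewrite xS /=.
by rewrite -(central_mod t xS); apply: (h (Ordinal (ltn_pmod t H0))).
Qed.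

Lemma movers_swap t x y : x \in S -> y \in S -> swap t x y -> movers t = [set x; y].
Proof.
move=> xS yS h; apply/setP => z; rewrite !inE (moved_swap A _ xS yS h).
by case: eqVneq => [->|_]; rewrite ?xS //; case: eqVneq => [->|_]; rewrite ?yS ?andbF.
Qed.

(** A pair swaps once per half period, so swaps can be counted as pairs. *)
Lemma movers_inj : {in [set t : 'I_H | hit S t predT] &, injective (fun t : 'I_H => movers t)}.
Proof.
move=> t u; rewrite !inE => /exists_inP[x xS /exists_inP[y yS /andP[hx _]]].
case/exists_inP=> z zS /exists_inP[w wS /andP[hz _]].
rewrite (movers_swap xS yS hx) (movers_swap zS wS hz) => e.
have nxy := swap_neq A hx.
have xw : x \in [set z; w] by rewrite -e !inE eqxx.
have yw : y \in [set z; w] by rewrite -e !inE eqxx orbT.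
have hb : swap u x y || swap u y x.
  rewrite (both_swap A _ _ hz); move: xw yw; rewrite !inE.
  case/orP => /eqP ex; case/orP => /eqP ey; rewrite ex ey ?eqxx ?orbT //;
  by rewrite ex ey eqxx in nxy.
apply: val_inj => /=; case: (ltngtP t u) => // tu; exfalso.
  have := sum_both A 0 x y; rewrite big_mkord add0n (bigD1 t) //= (bigD1 u) /=.
    by rewrite hx hb.
  by rewrite -val_eqE neq_ltn tu orbT.
have := sum_both A 0 x y; rewrite big_mkord add0n (bigD1 t) //= (bigD1 u) /=.
  by rewrite hx hb.
by rewrite -val_eqE neq_ltn tu.
Qed.

Lemma card_hits (c : pred nat) :
  \sum_(0 <= t < H) hit S t c = #|(fun t : 'I_H => movers t) @: [set t : 'I_H | hit S t c]|.
Proof.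
rewrite card_in_imset; last first.
  move=> t u ht hu; apply: movers_inj; rewrite inE.
    by move: ht; rewrite inE => /exists_inP[x xS /exists_inP[y yS /andP[h _]]]; rewrite (hit_swap A _ xS yS h).
  by move: hu; rewrite inE => /exists_inP[x xS /exists_inP[y yS /andP[h _]]]; rewrite (hit_swap A _ xS yS h).
by rewrite big_mkord -sum1dep_card [RHS]big_mkcond /=; apply: eq_bigr => t _; case: (hit _ _ _).
Qed.

(** The order is reversed after a half period, so every pair swaps. *)
Lemma all_pairs_swap : 'C(#|S|, 2) <= \sum_(0 <= t < H) hit S t predT.
Proof.
rewrite card_hits -cards_draws; apply: subset_leq_card; apply/subsetP => P.
rewrite inE => /andP[PS /cards2P[x [y [nxy eP]]]].
have [xS yS] : x \in S /\ y \in S by split; apply: (subsetP PS); rewrite eP !inE eqxx ?orbT.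
have key (u v : T) : lt 0 u v -> exists2 t : 'I_H, swap t u v & true.
  move=> uv; have : exists t, lt t v u by exists (0 + H); rewrite (seq_half A).
  case/ex_minnP=> t ht mint; have t0 : 0 < t.
    by case: (posnP t) ht => // ->; rewrite (seq_asym A uv).
  have tH : t <= H by apply: mint; rewrite -[H]add0n (seq_half A).
  have pt : t.-1 < H by rewrite prednK.
  exists (Ordinal pt) => //; rewrite /swap /= prednK // ht andbT.
  rewrite (seq_neg A) ?(seq_neq A ht) //; apply/negP => /mint.
  by rewrite leqNgt prednK ?leqnn.
have [t h] : exists t : 'I_H, swap t x y || swap t y x.
  case/orP: (seq_total A 0 nxy) => k.
    by have [t h _] := key x y k; exists t; rewrite h.
  by have [t h _] := key y x k; exists t; rewrite h orbT.
apply/imsetP; exists t; case/orP: h => h.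
- by rewrite inE (hit_swap A _ xS yS h).
- by rewrite inE (hit_swap A _ yS xS h).
- by rewrite (movers_swap xS yS h).
- by rewrite (movers_swap yS xS h) setUC.
Qed.

Lemma sum_enters t : \sum_(x in S) enters t x <= boundary t.
Proof.
rewrite /boundary; case: (step_cases lt t S) => [[x [y [xS yS h]]]|h]; last first.
  rewrite big1 // => z zS; rewrite /enters /central (rk_noswap A h zS).
  by rewrite andNb.
rewrite (hit_swap A _ xS yS h) (bigD1 x) //= (bigD1 y) /=; last by rewrite yS eq_sym (swap_neq A h).
rewrite big1 ?addn0; last first.
  move=> z /andP[/andP[zS zx] zy]; rewrite /enters /central (rk_swap_other A _ h zx zy).
  by rewrite andNb.
rewrite /enters /central (rk_swapSx A h yS) (rk_swapSy A _ h) (rk_swapl A h xS).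
by move: (rk S t x) => g; clear -hK K0; lia.
Qed.

(** Going back in time from a deep swap, consider the last moment when one of
    the two elements was not yet central.  There is one because [x] is not
    always central. *)
Lemma deep_entry t x y : x \in S -> y \in S -> x \notin resident -> swap t x y ->
  (K <= rk S t x) && (rk S t x + K + 2 <= #|S|) ->
  exists u : 'I_H, (enters u x && central u.+1 y) || (enters u y && central u.+1 x).
Proof.
move=> xS yS xR h hg.
have xc : central (t + H) x && central (t + H) y.
  rewrite !central_half // /central (rk_swapl A h xS); move: hg; clear -K0; lia.
have : exists v, (v < t + H) && ~~ (central v x && central v y).
  move: xR; rewrite inE xS /= negb_forall => /existsP[u hu].
  exists u; rewrite (leq_trans (ltn_ord u)) ?leq_addl //=.
  by apply: contra hu => /andP[].
case/(@ex_maxnP _ (t + H)) => [v /andP[/ltnW] //|v /andP[vt hv] maxv].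
have hv1 : central v.+1 x && central v.+1 y.
  case: (ltngtP v.+1 (t + H)) => k; last by rewrite k.
    by apply/negPn/negP => k'; have := maxv v.+1; rewrite k k' => /(_ isT); rewrite ltnn.
  by rewrite ltnNge vt in k.
have hvm : v.+1 %% H = (v %% H).+1 %% H by rewrite -addn1 -modnDml addn1.
exists (Ordinal (ltn_pmod v H0)) => /=.
rewrite /enters !central_mod //.
have e z : z \in S -> central (v %% H).+1 z = central v.+1 z.
  by move=> zS; rewrite -(central_mod v.+1) // hvm central_mod.
rewrite !e //; case/andP: hv1 => -> ->; rewrite !andbT -negb_and andbC.
by rewrite andbC.
Qed.

(** [s] is the number of residents.  A deep swap involving a resident is one of
    at most s(#|S| - 1) pairs.  Any other is attached to an entry of one of
    its elements, at a moment when the other one is a central nonresident;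
    there are #|S| - 2K - 1 - s of those besides the entering element. *)
Lemma deep_ub : exists2 s, s <= #|S| - 2 * K &
  \sum_(0 <= t < H) deep t <=
    (\sum_(0 <= t < H) boundary t) * (#|S| - 2 * K - 1 - s) + s * (#|S| - 1).
Proof.
exists #|resident|.
  by rewrite -(card_central 0) subset_leq_card ?resident_central.
rewrite card_hits.
(* W1: entries with a central nonresident partner; W2: residents with any partner *)
pose W1 := [set w : 'I_H * (T * T) | [&& w.2.1 \in S, enters w.1 w.2.1 &
   w.2.2 \in [set x in S | central w.1.+1 x] :\: resident :\ w.2.1]].
pose W2 := [set w : T * T | (w.1 \in resident) && (w.2 \in S :\ w.1)].
have sub : (fun t : 'I_H => movers t) @: [set t : 'I_H | deep t] \subset
   (fun w : 'I_H * (T * T) => [set w.2.1; w.2.2]) @: W1 :|: (fun w : T * T => [set w.1; w.2]) @: W2.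
  apply/subsetP => _ /imsetP[t ht ->]; move: ht; rewrite inE => /exists_inP[x xS /exists_inP[y yS /andP[h hg]]].
  rewrite (movers_swap xS yS h); have nxy := swap_neq A h.
  apply/setUP; case: (boolP (x \in resident)) => [xR|xR].
    right; apply/imsetP; exists (x, y) => //.
    by rewrite inE /= xR inE yS andbT inE eq_sym.
  case: (boolP (y \in resident)) => [yR|yR].
    right; apply/imsetP; exists (y, x); last by rewrite setUC.
    by rewrite inE /= yR inE xS andbT inE.
  left; have [u] := deep_entry xS yS xR h hg.
  case/orP => /andP[k1 k2]; apply/imsetP.
    by exists (u, (x, y)); rewrite // inE /= xS k1 in_setD1 in_setD yR eq_sym nxy inE yS.
  by exists (u, (y, x)); [rewrite inE /= yS k1 in_setD1 in_setD xR nxy inE xS | rewrite setUC].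
apply: leq_trans (subset_leq_card sub) _; apply: leq_trans (leq_card_setU _ _) _.
apply: leq_add; apply: leq_trans (leq_imset_card _ _) _; last first.
  have -> : #|W2| = \sum_(x in resident) \sum_(y in S :\ x) 1.
    by rewrite pair_big_dep -sum1dep_card; apply: eq_bigl.
  rewrite -sum_nat_const; apply: leq_sum => x; rewrite inE sum1_card => /andP[xS _].
  by rewrite (cardsD1 x S) xS /=; clear; lia.
have -> : #|W1| = \sum_(u < H) \sum_(x in S | enters u x)
    #|[set z in S | central u.+1 z] :\: resident :\ x|.
  transitivity (\sum_(u < H) \sum_(v | [&& v.1 \in S, enters u v.1 &
     v.2 \in [set x in S | central u.+1 x] :\: resident :\ v.1]) 1).
    by rewrite pair_big_dep -sum1dep_card; apply: eq_bigl.
  apply: eq_bigr => u _; under [RHS]eq_bigr => x _ do rewrite -sum1_card.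
  by rewrite pair_big_dep; apply: eq_bigl => v; rewrite andbA.
rewrite big_mkord big_distrl /=; apply: leq_sum => u _.
apply: leq_trans (leq_mul (sum_enters u) (leqnn _)).
rewrite big_distrl /= [X in X <= _]big_mkcondr /=; apply: leq_sum => x xS.
case: (boolP (enters u x)) => // xe; rewrite mul1n.
have xc : x \in [set z in S | central u.+1 z] by move: xe; rewrite inE xS => /andP[].
have xr : x \notin resident.
  by apply: contraL xe => /(subsetP (resident_central u)); rewrite inE /enters => /andP[_ ->].
have := cardsD1 x ([set z in S | central u.+1 z] :\: resident).
rewrite in_setD xc xr cardsD (setIidPr (resident_central _)) card_central.
by move: #|_ :\ x| => m; clear; lia.
Qed.

Lemma card_swaps : \sum_(0 <= t < H) hit S t predT = num_crit H lt S K + \sum_(0 <= t < H) deep t.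
Proof.
rewrite /num_crit -big_split; apply: eq_bigr => t _ /=.
rewrite -(hit_or A); last by move=> g _; rewrite /crit; clear; lia.
by congr nat_of_bool; apply: (eq_hit A) => g _; apply/idP/idP => // _; rewrite /crit; clear; lia.
Qed.

(** The boundary gates are those that become shallow when K - 1 increases to K. *)
Lemma crit_boundary : num_crit H lt S K = num_crit H lt S K.-1 + \sum_(0 <= t < H) boundary t.
Proof.
rewrite /num_crit -big_split; apply: eq_bigr => t _ /=.
rewrite -(hit_or A); last by move=> g _; rewrite /crit; clear -K0 hK; lia.
by congr nat_of_bool; apply: (eq_hit A) => g hg; rewrite /crit; clear -K0 hK hg; lia.
Qed.

End Deep.

Lemma bin2_double n : 2 * 'C(n, 2) + n = n * n.
Proof. by elim: n => // n IHn; rewrite binS bin1; lia. Qed.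

Lemma sum_excess m K : \sum_(0 <= j < K) (3 * j + 3 - 3 * m) = 3 * 'C(K - m + 1, 2).
Proof.
elim: K => [|K IHK]; first by rewrite big_geq // sub0n.
rewrite big_nat_recr //= IHK; case: (leqP m K) => mK.
  by rewrite subSn // !addn1 [in RHS]binS bin1; lia.
have -> : K - m = 0 by lia.
have -> : K.+1 - m = 0 by lia.
by rewrite bin_small //; lia.
Qed.

(** Let N be the number of boundary swaps and c the number of (4t-1)-shallow
    ones, for which [shallow_lb] holds.  If c + N were smaller than claimed, N
    would be small and, as c + N + d >= C(9t, 2), the number d of deep swaps
    would be large.  But d <= N(t-1-s) + s(9t-1), which is at most t(9t-1) if
    s >= t - 1 and at most (t-1) max(N, 9t-1) otherwise. *)
Lemma middle_lb (T : finType) (H : nat) (lt : nat -> rel T) (S : {set T}) (t : nat) :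
  allowable H lt -> 0 < H -> 2 < t -> #|S| = 9 * t ->
  3 * 'C(4 * t + 1, 2) + 3 * 'C(t + 1, 2) + 3 <= num_crit H lt S (4 * t).
Proof.
move=> A H0 t3 cS.
have K0 : 0 < 4 * t by clear -t3; lia.
have hK : 2 * (4 * t) < #|S| by rewrite cS; clear -t3; lia.
have tot := all_pairs_swap A S.
rewrite (card_swaps A S (4 * t)) (crit_boundary A K0 hK) in tot.
rewrite (crit_boundary A K0 hK).
have [s hs hd] := deep_ub A H0 K0 hK.
have low : 3 * 'C((4 * t).-1.+1, 2) + \sum_(0 <= j < (4 * t).-1) (3 * j + 3 - #|S|)
    <= num_crit H lt S (4 * t).-1.
  by apply: (shallow_lb A); rewrite cS; clear -t3; lia.
rewrite cS in tot hs hd low.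
rewrite prednK // (_ : 9 * t = 3 * (3 * t)) ?sum_excess in low; last by clear; lia.
rewrite (_ : (4 * t).-1 - 3 * t + 1 = t) in low; last by clear -t3; lia.
move: tot hs hd low (bin2_double (9 * t)) (bin2_double (4 * t)) (bin2_double t)
  (bin2_double (4 * t + 1)) (bin2_double (t + 1)).
move: (num_crit _ _ _ _) (\sum_(0 <= i < H) boundary _ _ _ _) (\sum_(0 <= i < H) deep _ _ _ _).
move: ('C(9 * t, 2)) ('C(4 * t, 2)) ('C(t, 2)) ('C(4 * t + 1, 2)) ('C(t + 1, 2)).
rewrite (_ : 9 * t - 2 * (4 * t) = t); last by clear; lia.
clear -t3 => c9 c4 c1 c4' c1' c N d tot hs hd low e9 e4 e1 e4' e1'.
rewrite leqNgt; apply/negP => small.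
have [st|st] := leqP t.-1 s.
  have hd' : d <= t * (9 * t - 1).
    apply: leq_trans hd _; rewrite (_ : t - 1 - s = 0) ?muln0 ?leq_mul2r ?hs ?orbT //; lia.
  nia.
have [N9|N9] := leqP (9 * t - 1) N.
  have hd' : d <= N * (t - 1).
    apply: leq_trans hd _; rewrite [X in _ <= N * X](_ : t - 1 = (t - 1 - s) + s); last by lia.
    by rewrite mulnDr leq_add2l mulnC leq_mul2r N9 orbT.
  nia.
have hd' : d <= (9 * t - 1) * (t - 1).
  apply: leq_trans hd _; rewrite [X in _ <= _ * X](_ : t - 1 = (t - 1 - s) + s); last by lia.
  by rewrite mulnDr leq_add // ?leq_mul2r ?(ltnW N9) ?orbT // mulnC.
have t3' : 3 * t <= t * t by rewrite leq_mul2r t3 orbT.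
have e : (9 * t - 1) * (t - 1) + 10 * t = 9 * (t * t) + 1.
  by case: t t3 {e9 e4 e1 e4' e1' t3' hd' hs st N9 low hd tot small} => // t _; rewrite !subn1 mulnS; lia.
move: hd'; move: ((9 * t - 1) * (t - 1)) e => X e hd'.
clear hd hs st N9; lia.
Qed.

Import Order.TTheory GRing.Theory Num.Theory.

(** * The allowable sequence of a point set *)

Section DirectionSweep.
Local Open Scope ring_scope.
Variables (R : realType) (T : finType) (pt : T -> 'rV[R]_2).
Hypothesis pt_inj : injective pt.
Hypothesis free : forall x y z, x != y -> x != z -> y != z ->
  orient (pt x) (pt y) (pt z) != 0.
Implicit Types (x y z : T).

Let X x := pt x 0 0.
Let Y x := pt x 0 1.
Let dx (p : T * T) := X p.2 - X p.1.
Let dy (p : T * T) := Y p.2 - Y p.1.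
Let cross p q := dx p * dy q - dy p * dx q.
Let lex x y := (X x < X y) || ((X x == X y) && (Y x < Y y)).

Lemma lex_total x y : x != y -> lex x y || lex y x.
Proof.
rewrite /lex => nxy; have [//|//|eX] := ltgtP (X x) (X y).
have [//|//|eY] := ltgtP (Y x) (Y y); case/eqP: nxy; apply: pt_inj.
apply/rowP => i; case: i => -[|[|//]] hi.
  by rewrite (_ : Ordinal hi = 0) //; apply: val_inj.
by rewrite (_ : Ordinal hi = 1) //; apply: val_inj.
Qed.

Lemma lex_asym x y : lex x y -> lex y x = false.
Proof. by rewrite /lex; case: ltgtP => //= _; case: ltgtP. Qed.

Lemma lex_neg x y : x != y -> lex y x = ~~ lex x y.
Proof.
move=> nxy; case: (boolP (lex x y)) => h; first by rewrite (lex_asym h).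
by have := lex_total nxy; rewrite (negPf h).
Qed.

Lemma lex_dir p : lex p.1 p.2 -> (0 < dx p) || ((dx p == 0) && (0 < dy p)).
Proof. by rewrite /lex /dx /dy !subr_gt0 subr_eq0 (eq_sym (X p.2)). Qed.

Let before p q := 0 <= cross p q.

(** Directions of lexicographically increasing pairs lie in a half plane, where
    a nonnegative cross product is a transitive comparison of angles. *)
Lemma before_trans : {in [pred p | lex p.1 p.2] & &, transitive before}.
Proof.
move=> q p r; rewrite !inE => /lex_dir hq /lex_dir hp /lex_dir hr.
rewrite /before /cross.
case/orP: hq => [q0|/andP[/eqP q0 qy]].
  have {}hp : 0 <= dx p by case/orP: hp => [/ltW|/andP[/eqP->]].
  have {}hr : 0 <= dx r by case/orP: hr => [/ltW|/andP[/eqP->]].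
  move=> h1 h2; rewrite -(pmulr_lge0 _ q0).
  have -> : (dx p * dy r - dy p * dx r) * dx q =
    (dx p * dy q - dy p * dx q) * dx r + (dx q * dy r - dy q * dx r) * dx p by ring.
  by rewrite addr_ge0 // mulr_ge0.
rewrite q0 mul0r mulr0 subr0 sub0r => h1 h2.
have r0 : dx r <= 0 by rewrite -(pmulr_rle0 _ qy) -oppr_ge0.
case/orP: hr => [|/andP[/eqP -> ry]]; first by rewrite ltNge r0.
rewrite mulr0 subr0; apply: mulr_ge0; last exact: ltW.
by case/orP: hp => [/ltW|/andP[/eqP->]].
Qed.

Let L := sort before [seq p <- enum {: T * T} | lex p.1 p.2].
Let M := size L.
Let H := M.+1.
Let idx x y := index (x, y) L.

Lemma mem_L x y : ((x, y) \in L) = lex x y.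
Proof. by rewrite mem_sort mem_filter mem_enum andbT. Qed.

Lemma idx_lt x y : lex x y -> (idx x y < M)%N.
Proof. by rewrite -mem_L -index_mem. Qed.

Lemma idx_cross a b c d : lex a b -> lex c d -> 0 < cross (a, b) (c, d) ->
  (idx a b < idx c d)%N.
Proof.
move=> hab hcd h; rewrite ltnNge; apply/negP; rewrite leq_eqVlt => /orP[/eqP e|k].
  have e2 : (a, b) = (c, d).
    by rewrite -[LHS](@nth_index _ (a, b) _ L) ?mem_L // -/(idx a b) -e nth_index ?mem_L.
  by move: h; rewrite e2 /cross mulrC subrr ltxx.
have tot : total before.
  by move=> p q; rewrite /before; case: (leP 0 (cross p q)) => //= hp;
     rewrite -oppr_le0 (_ : - cross q p = cross p q) ?(ltW hp) // /cross; ring.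
have allL : all [pred p | lex p.1 p.2] L by rewrite all_sort filter_all.
have := sorted_ltn_nth_in before_trans (a, b) allL (sort_sorted tot _).
move=> /(_ (idx c d) (idx a b)); rewrite !inE !idx_lt // => /(_ isT isT k).
rewrite !nth_index ?mem_L // /before => k2.
have : cross (c, d) (a, b) = - cross (a, b) (c, d) by rewrite /cross; ring.
by move=> e; move: k2; rewrite e oppr_ge0 leNgt h.
Qed.

Lemma idx_crossE a b c d : lex a b -> lex c d -> cross (a, b) (c, d) != 0 ->
  (idx a b < idx c d)%N = (0 < cross (a, b) (c, d)).
Proof.
move=> hab hcd h; apply/idP/idP; last exact: idx_cross.
move=> k; rewrite lt_neqAle eq_sym h /= leNgt; apply/negP => h'.
have : (idx c d < idx a b)%N.
  apply: idx_cross => //; rewrite (_ : cross _ _ = - cross (a, b) (c, d)) ?oppr_gt0 //.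
  by rewrite /cross; ring.
by rewrite ltnNge (ltnW k).
Qed.

Lemma orientE x y z : orient (pt x) (pt y) (pt z) = cross (x, y) (x, z).
Proof. by []. Qed.

Local Open Scope nat_scope.

(** The sweeping direction meets the i-th pair of [L] at the times congruent to
    i modulo [H]; [turn] counts how often it has done so, with an offset that
    makes the count 0 at time 0.  The pair is reversed when the count is odd. *)
Let turn t x y := (t + (M - idx x y)) %/ H.
Let lt (t : nat) x y := if lex x y then ~~ odd (turn t x y) else lex y x && odd (turn t y x).

Lemma lt_lexE t x y : lex x y -> lt t x y = ~~ odd (turn t x y).
Proof. by rewrite /lt => ->. Qed.

Lemma lt_lexrE t x y : lex y x -> lt t x y = odd (turn t y x).
Proof. by move=> h; rewrite /lt (lex_asym h) h. Qed.

Lemma divH_add m : (m + H) %/ H = (m %/ H).+1.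
Proof. by rewrite divnDr ?dvdnn // divnn /= addn1. Qed.

Lemma turn_half t x y : turn (t + H) x y = (turn t x y).+1.
Proof. by rewrite /turn addnAC divH_add. Qed.

Lemma turn_mono t a b c d : idx a b <= idx c d ->
  turn t c d <= turn t a b <= (turn t c d).+1.
Proof.
move=> h; rewrite /turn -divH_add; apply/andP; split; apply: leq_div2r; rewrite /H; lia.
Qed.

Lemma lt_negb t x y : x != y -> lt t y x = ~~ lt t x y.
Proof.
move=> nxy; case/orP: (lex_total nxy) => h.
  by rewrite (lt_lexE t h) (lt_lexrE t h) negbK.
by rewrite (lt_lexE t h) (lt_lexrE t h).
Qed.

Lemma lt_irrefl t x : lt t x x = false.
Proof. by rewrite /lt /lex !ltxx eqxx. Qed.

Lemma lex_trans x y z : lex x y -> lex y z -> lex x z.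
Proof.
rewrite /lex => /orP[h1|/andP[/eqP-> h1]] /orP[h2|/andP[/eqP h2' h2]].
- by rewrite (lt_trans h1 h2).
- by rewrite -h2' h1.
- by rewrite h2.
- by rewrite h2' eqxx (lt_trans h1 h2) orbT.
Qed.

Lemma lex_neq x y : lex x y -> x != y.
Proof. by apply: contraTneq => ->; rewrite /lex !ltxx eqxx. Qed.

(** The direction of the long side of a triangle lies between those of the other
    two.  This is what makes the orders transitive. *)
Lemma idx_between a b c : lex a b -> lex b c ->
  idx a b < idx a c < idx b c \/ idx b c < idx a c < idx a b.
Proof.
move=> ab bc; have ac := lex_trans ab bc.
have := free (lex_neq ab) (lex_neq ac) (lex_neq bc); rewrite orientE => h.
have e1 : cross (a, c) (b, c) = cross (a, b) (a, c) by rewrite /cross /dx /dy /=; ring.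
have e2 : cross (a, c) (a, b) = (- cross (a, b) (a, c))%R by rewrite /cross /dx /dy /=; ring.
have e3 : cross (b, c) (a, c) = (- cross (a, b) (a, c))%R by rewrite /cross /dx /dy /=; ring.
rewrite !idx_crossE ?e1 ?e2 ?e3 ?oppr_eq0 // oppr_gt0 !andbb.
by move: h; rewrite neq_lt => /orP[] ->; [right | left].
Qed.

Lemma odd_turn_between t a b c : lex a b -> lex b c ->
  odd (turn t a b) = odd (turn t b c) -> odd (turn t a c) = odd (turn t a b).
Proof.
move=> ab bc.
have h := @turn_mono t; case: (idx_between ab bc) => /andP[/ltnW k1 /ltnW k2].
  move: (h _ _ _ _ k1) (h _ _ _ _ k2) (h _ _ _ _ (leq_trans k1 k2)).
  by move: (turn t a b) (turn t b c) (turn t a c); clear; lia.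
move: (h _ _ _ _ k1) (h _ _ _ _ k2) (h _ _ _ _ (leq_trans k1 k2)).
by move: (turn t a b) (turn t b c) (turn t a c); clear; lia.
Qed.

Lemma no_cycle_min t x y z : lex x y -> lex x z -> y != z ->
  ~~ [&& lt t x y, lt t y z & lt t z x].
Proof.
move=> xy xz nyz; rewrite (lt_lexE _ xy) (lt_lexrE _ xz).
case/orP: (lex_total nyz) => yz.
  rewrite (lt_lexE _ yz); have := @odd_turn_between t _ _ _ xy yz.
  by case: (odd _) => //=; case: (odd _) => //= ->.
rewrite (lt_lexrE _ yz); have := @odd_turn_between t _ _ _ xz yz.
by case: (odd (turn t x z)); case: (odd (turn t z y)); case: (odd (turn t x y)) => // ->.
Qed.

Lemma lt_transitive t : transitive (lt t).
Proof.
move=> y x z xy yz.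
have nxy : x != y by apply: contraTneq xy => ->; rewrite lt_irrefl.
have nyz : y != z by apply: contraTneq yz => ->; rewrite lt_irrefl.
have [exz|nxz] := eqVneq x z; first by move: yz; rewrite -exz (lt_negb _ nxy) xy.
rewrite (lt_negb t (x := z)) 1?eq_sym //; apply/negP => zx.
case/orP: (lex_total nxy) => lxy; case/orP: (lex_total nyz) => lyz.
- by have := no_cycle_min t lxy (lex_trans lxy lyz) nyz; rewrite xy yz zx.
- case/orP: (lex_total nxz) => lxz.
    by have := no_cycle_min t lxy lxz nyz; rewrite xy yz zx.
  by have := no_cycle_min t lxz lyz nxy; rewrite xy yz zx.
- by have := no_cycle_min t lyz lxy; rewrite eq_sym nxz xy yz zx => /(_ isT).
- by have := no_cycle_min t (lex_trans lyz lxy) lyz nxy; rewrite xy yz zx.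
Qed.

Lemma turn_step t x y : lex x y ->
  turn t.+1 x y = (idx x y == t %% H) + turn t x y.
Proof.
move=> /idx_lt h; rewrite /turn addSn divnS //; congr (nat_of_bool _ + _).
set i := idx x y in h *; set r := t %% H.
have rH : r < H by rewrite ltn_mod.
have -> : (H %| (t + (M - i)).+1) = (H %| r + (M - i).+1).
  by rewrite -addnS /dvdn -modnDml.
apply/dvdnP/eqP => [[k]|<-]; last by exists 1; rewrite /H; lia.
case: k => [|[|k]]; rewrite /H /= in rH *; [lia|lia|].
by rewrite !mulSn; move: (k * _) => kk; lia.
Qed.

Lemma lt_flip t x y : lex x y || lex y x ->
  lt t.+1 x y = lt t x y (+) (idx (if lex x y then x else y) (if lex x y then y else x) == t %% H).
Proof.
case: (boolP (lex x y)) => [h _|_ /= h].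
  by rewrite !(lt_lexE _ h) turn_step // oddD oddb; case: (_ == _); case: (odd _).
by rewrite !(lt_lexrE _ h) turn_step // oddD oddb addbC.
Qed.

Lemma swap_idx t x y : lt t x y -> lt t.+1 y x ->
  idx (if lex x y then x else y) (if lex x y then y else x) == t %% H.
Proof.
move=> xy; have nxy : x != y by apply: contraTneq xy => ->; rewrite lt_irrefl.
rewrite (lt_negb _ nxy) lt_flip ?lex_total // xy.
by case: (_ == _).
Qed.

Lemma sweep_allowable : allowable H lt.
Proof.
split.
- exact: lt_irrefl.
- exact: lt_transitive.
- by move=> t x y nxy; rewrite (lt_negb _ nxy); case: (lt t x y).
- move=> t x y; rewrite /lt !turn_half /=.
  have [->|nxy] := eqVneq x y; first by rewrite /lex !ltxx eqxx.
  by rewrite (lex_neg nxy); case: (lex x y) => //=; rewrite negbK.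
- move=> t x y u v xy yx uv vu.
  have nxy : x != y by apply: contraTneq xy => ->; rewrite lt_irrefl.
  have nuv : u != v by apply: contraTneq uv => ->; rewrite lt_irrefl.
  move: (swap_idx xy yx) (swap_idx uv vu) => /eqP i1 /eqP i2; rewrite -i2 in i1.
  have iinj a b c d : lex a b -> lex c d -> idx a b = idx c d -> (a, b) = (c, d).
    move=> ab cd e.
    by rewrite -[LHS](@nth_index _ (a, b) _ L) ?mem_L // -/(idx a b) e nth_index ?mem_L.
  move: i1; case: ifP => k1; case: ifP => k2.
  + by move/(iinj _ _ _ _ k1 k2) => [].
  + move/(iinj _ _ _ _ k1); rewrite (lex_neg nuv) k2 => /(_ isT)[e1 e2].
    by subst; rewrite (lt_negb _ nxy) xy in uv.
  + have k1' : lex y x by rewrite (lex_neg nxy) k1.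
    by move/(iinj _ _ _ _ k1' k2) => [e1 e2]; subst; rewrite (lt_negb _ nxy) xy in uv.
  + have k1' : lex y x by rewrite (lex_neg nxy) k1.
    have k2' : lex v u by rewrite (lex_neg nuv) k2.
    by move/(iinj _ _ _ _ k1' k2') => [-> ->].
- move=> s t u x y st tu us xy yx.
  have nxy : x != y by apply: contraTneq xy => ->; rewrite lt_irrefl.
  have mono a b i j : i <= j -> turn i a b <= turn j a b.
    by move=> ij; rewrite /turn; apply: leq_div2r; rewrite leq_add2r.
  have last a b : turn u a b <= (turn s a b).+1 by rewrite -turn_half mono.
  case/orP: (lex_total nxy) => h.
    move: xy yx; rewrite !(lt_lexE _ h) !(lt_lexrE _ h).
    move: (mono x y _ _ st) (mono x y _ _ tu) (last x y); clear; lia.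
  move: xy yx; rewrite !(lt_lexE _ h) !(lt_lexrE _ h).
  move: (mono y x _ _ st) (mono y x _ _ tu) (last y x); clear; lia.
Qed.

(** At the moment when the direction of (a, b) is met, the pairs that have made
    one turn more are those that come earlier in [L]. *)
Lemma turn_at t a b c d : lex a b -> lex c d -> idx a b == t %% H ->
  turn t c d = turn t a b + (idx c d < idx a b).
Proof.
move=> /idx_lt h1 /idx_lt h2 /eqP e; rewrite /turn.
rewrite [in LHS](divn_eq t H) [in RHS](divn_eq t H) -e -!addnA !divnMDl // -addnA.
move: (idx a b) (idx c d) h1 h2 => i j h1 h2; congr (_ + _).
rewrite subnKC ?(ltnW h1) // [M %/ H]divn_small //.
case: (ltnP j i) => ji; last by rewrite divn_small // /H; lia.
by rewrite (_ : i + (M - j) = (i - j).-1 + H) ?divH_add ?divn_small // /H; lia.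
Qed.

(** When x and y swap, the points are projected along the line xy, so that the
    points before both are those on one side. *)
Lemma swap_right t x y z : lt t x y -> lt t.+1 y x -> z != x -> z != y ->
  lt t z x = (orient (pt x) (pt y) (pt z) < 0)%R.
Proof.
move=> xy yx nzx nzy; have i0 := swap_idx xy yx.
have nxy : x != y by apply: contraTneq xy => ->; rewrite lt_irrefl.
have nxz : x != z by rewrite eq_sym.
have nyz : y != z by rewrite eq_sym.
have fr := free nxy nxz nyz; rewrite orientE in fr *.
have fr' := fr; rewrite -oppr_eq0 in fr'.
have e1 : cross (x, z) (x, y) = (- cross (x, y) (x, z))%R by rewrite /cross /dx /dy /=; ring.
have e2 : cross (z, x) (x, y) = cross (x, y) (x, z) by rewrite /cross /dx /dy /=; ring.
have e3 : cross (x, z) (y, x) = cross (x, y) (x, z) by rewrite /cross /dx /dy /=; ring.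
have e4 : cross (z, x) (y, x) = (- cross (x, y) (x, z))%R by rewrite /cross /dx /dy /=; ring.
case/orP: (lex_total nxy) => hxy.
  move: xy; rewrite hxy in i0; rewrite (lt_lexE _ hxy) => xy.
  case/orP: (lex_total nxz) => hxz.
    rewrite (lt_lexrE _ hxz) (turn_at hxy hxz i0) oddD (negPf xy) oddb /=.
    by rewrite idx_crossE ?e1 // oppr_gt0.
  rewrite (lt_lexE _ hxz) (turn_at hxy hxz i0) oddD (negPf xy) oddb /=.
  by rewrite idx_crossE ?e2 // -leNgt le_eqVlt (negPf fr).
move: xy; rewrite (lex_asym hxy) in i0; rewrite (lt_lexrE _ hxy) => xy.
case/orP: (lex_total nxz) => hxz.
  rewrite (lt_lexrE _ hxz) (turn_at hxy hxz i0) oddD xy oddb /=.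
  by rewrite idx_crossE ?e3 // -leNgt le_eqVlt (negPf fr).
rewrite (lt_lexE _ hxz) (turn_at hxy hxz i0) oddD xy oddb /= negbK.
by rewrite idx_crossE ?e4 // oppr_gt0.
Qed.

Lemma direction_sweep : exists (H : nat) (lt : nat -> rel T),
  [/\ 0 < H, allowable H lt & forall t x y z, swap lt t x y -> z != x -> z != y ->
     lt t z x = (orient (pt x) (pt y) (pt z) < 0)%R].
Proof.
exists H, lt; split=> //; first exact: sweep_allowable.
by move=> t x y z /andP[]; apply: swap_right.
Qed.

End DirectionSweep.

Section Sides.
Variables (R : realType) (T : finType) (pt : T -> 'rV[R]_2).

Definition rside x y := #|[set z | (orient (pt x) (pt y) (pt z) < 0)%R]|.

(** Ordered pairs, so that the two directions of a line are counted separately. *)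
Definition flat K := [set p : T * T | (p.1 != p.2) && (rside p.1 p.2 < K)].

Definition free := forall x y z, x != y -> x != z -> y != z ->
  orient (pt x) (pt y) (pt z) != 0%R.

Lemma orient_swap (p q r : 'rV[R]_2) : orient q p r = (- orient p q r)%R.
Proof. by rewrite /orient; ring. Qed.

Lemma orient_cycle (p q r : 'rV[R]_2) : orient q r p = orient p q r.
Proof. by rewrite /orient; ring. Qed.

Lemma orient_xx (p q : 'rV[R]_2) : (orient p q p = 0)%R * (orient p q q = 0)%R.
Proof. by split; rewrite /orient; ring. Qed.

Hypothesis fr : free.

Lemma rside_compl x y : x != y -> rside x y + rside y x + 2 = #|T|.
Proof.
move=> nxy; pose B := [set z | (orient (pt x) (pt y) (pt z) < 0)%R].
have cB : #|~: B| = rside y x + 2.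
  rewrite (_ : ~: B = [set x; y] :|: [set z | (orient (pt y) (pt x) (pt z) < 0)%R]).
    rewrite cardsU cards2 nxy (_ : _ :&: _ = set0) ?cards0; first by rewrite /rside; lia.
    apply/setP => z; rewrite !inE.
    by case: eqVneq => [->|_]; [|case: eqVneq => [->|_]]; rewrite ?orient_xx ?ltxx ?andbF.
  apply/setP => z; rewrite !inE orient_swap oppr_lt0 -leNgt.
  have [->|zx] := eqVneq z x; first by rewrite orient_xx lexx.
  have [->|zy] := eqVneq z y; first by rewrite orient_xx lexx.
  by rewrite le_eqVlt (negPf (fr _ _ _)) // eq_sym.
by rewrite -addnA -cB addnC -[RHS](cardsC B) addnC.
Qed.

(** A shallow swap yields the flat pair obtained by directing the line so that
    the smaller side is on the right; distinct swaps concern distinct pairs. *)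
Lemma crit_le_flat K : injective pt -> 0 < K -> exists (H : nat) (lt : nat -> rel T),
  [/\ 0 < H, allowable H lt & num_crit H lt [set: T] K <= #|flat K|].
Proof.
move=> pt_inj K0; have [H [lt [H0 A sw]]] := direction_sweep pt_inj fr.
exists H, lt; split=> //.
have rk_right t x y : swap lt t x y -> rk lt [set: T] t x = rside x y.
  move=> h; apply: eq_card => z; rewrite !inE /=.
  have [->|zx] := eqVneq z x; first by rewrite (seq_irr A) orient_xx ltxx.
  have [->|zy] := eqVneq z y.
    by case/andP: h => xy _; rewrite (seq_asym A xy) orient_xx ltxx.
  exact: sw.
rewrite /num_crit (card_hits A).
apply: leq_trans (leq_imset_card (fun p : T * T => [set p.1; p.2]) (flat K)).
apply: subset_leq_card; apply/subsetP => _ /imsetP[t ht ->]; move: ht.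
rewrite inE => /exists_inP[x xT /exists_inP[y yT /andP[h hc]]].
rewrite (movers_swap A xT yT h); have nxy := swap_neq A h.
move: hc; rewrite (rk_right _ _ _ h) /crit => /orP[hc|hc]; apply/imsetP.
  by exists (x, y); rewrite // inE nxy.
exists (y, x); last by rewrite setUC.
by rewrite inE /= eq_sym nxy /=; have := rside_compl nxy; move: hc; rewrite cardsT; lia.
Qed.

End Sides.

(** * Edges as ordered pairs with few points on the right *)

Section Edges.
Variables (R : realType) (T : finType) (pt : T -> 'rV[R]_2).
Hypothesis pt_inj : injective pt.

Definition config : {fset 'rV[R]_2} := [fset pt x | x : T]%fset.

Lemma card_config : #|` config| = #|T|.
Proof. by rewrite card_imfset //= cardE. Qed.

Lemma card_config_sub (c : pred 'rV[R]_2) :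
  #|` [fset v in config | c v]%fset| = #|[set z | c (pt z)]|.
Proof.
have -> : [fset v in config | c v]%fset = [fset pt x | x in [set z | c (pt z)]]%fset.
  apply/fsetP => v; rewrite in_fset /=; apply/andP/imfsetP => /=.
    by case=> /imfsetP[x _ ->] hc; by exists x => //; rewrite in_set.
  by case=> x; rewrite ?inE => hc ->; split => //; apply/imfsetP; exists x.
by rewrite card_imfset //= -cardE.
Qed.

Lemma card_right x y : #|` right_side config (pt x) (pt y)| = rside pt x y.
Proof. exact: card_config_sub. Qed.

Lemma card_left x y : #|` left_side config (pt x) (pt y)| = rside pt y x.
Proof.
rewrite (card_config_sub (fun v => 0 < orient (pt x) (pt y) v)%R).
by apply: eq_card => z; rewrite !inE (orient_swap (pt x)) oppr_lt0.
Qed.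

Definition at_depth j := [set p : T * T | (p.1 != p.2) && (rside pt p.1 p.2 == j)].

Lemma card_flat K : #|flat pt K| = \sum_(0 <= j < K) #|at_depth j|.
Proof.
elim: K => [|K IH].
  rewrite big_geq //; apply/eqP; rewrite cards_eq0; apply/eqP/setP => p.
  by rewrite !inE ltn0 andbF.
rewrite big_nat_recr //= -IH.
have -> : flat pt K.+1 = flat pt K :|: at_depth K.
  by apply/setP => p; rewrite !inE -andb_orr ltnS leq_eqVlt orbC.
rewrite cardsU (_ : _ :&: _ = set0) ?cards0 ?subn0 //.
apply/setP => p; rewrite !inE; case: (_ != _) => //=.
by case: ltngtP; rewrite ?andbF.
Qed.

Lemma line_sym (p q : 'rV[R]_2) : line p q = line q p.
Proof.
have sub (u v : 'rV[R]_2) : (line u v `<=` line v u)%classic.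
  move=> _ [t _ <-]; exists (1 - t)%R => //.
  by rewrite scalerBl scale1r scalerBr scalerBr; apply/rowP => i; rewrite !mxE; ring.
by apply/seteqP; split.
Qed.

Lemma mem_line_l (p q : 'rV[R]_2) : line p q p.
Proof. by exists 0%R => //; rewrite scale0r addr0. Qed.

Lemma mem_line_r (p q : 'rV[R]_2) : line p q q.
Proof. by rewrite line_sym; apply: mem_line_l. Qed.

Lemma edges_ub j : E j config <= #|at_depth j|.
Proof.
have sub : (k_edges config j `<=` [fset line (pt p.1) (pt p.2) | p in at_depth j])%fset.
  apply/fsubsetP => l /imfset2P[u /= /imfsetP[x _ ->]].
  case=> v /= /andP[/imfsetP[y _ ->] /andP[nuv h]] ->.
  have nxy : x != y by apply: contraNneq nuv => ->.
  case/orP: h; rewrite ?card_left ?card_right => h; apply/imfsetP.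
    by exists (y, x); rewrite ?inE //= 1?eq_sym ?nxy // line_sym.
  by exists (x, y); rewrite ?inE //= nxy.
apply: leq_trans (fsubset_leq_card sub) _.
by apply: leq_trans (leq_imfset_card _ _ _) _; rewrite /= -cardE.
Qed.

Lemma E_le_ub k : E_le k config <= #|flat pt k.+1|.
Proof. by rewrite card_flat; apply: leq_sum => j _; apply: edges_ub. Qed.

Hypothesis fr : free pt.

(** A line leaving j points on its right in both directions would force
    2j + 2 = #|T|, so lines and directed lines correspond. *)
Lemma edges_lb j : 2 * j + 2 < #|T| -> #|at_depth j| <= E j config.
Proof.
move=> hj; pose f (p : T * T) := line (pt p.1) (pt p.2).
have inj : {in at_depth j &, injective f}.
  move=> [x y] [u v]; rewrite !inE /= /f /= => /andP[nxy /eqP dxy] /andP[nuv /eqP duv] e.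
  have on w : line (pt x) (pt y) (pt w) -> (w == x) || (w == y).
    move/line_orient => h0; case: eqVneq => //= nwx; case: eqVneq => //= nwy.
    by have := fr nxy; rewrite eq_sym in nwx; rewrite eq_sym in nwy => /(_ w nwx nwy); rewrite h0 eqxx.
  have /on/orP ux : line (pt x) (pt y) (pt u) by rewrite e; apply: mem_line_l.
  have /on/orP vx : line (pt x) (pt y) (pt v) by rewrite e; apply: mem_line_r.
  case: ux vx => /eqP ux [/eqP vx|/eqP vx]; rewrite ux vx ?eqxx // in nuv duv *.
  by have := rside_compl fr nxy; rewrite dxy duv; move: hj; clear; lia.
rewrite /E; have <- : #|` [fset f p | p in at_depth j]%fset| = #|at_depth j|.
  by rewrite card_in_imfset //= ?cardE // => p q hp hq; apply: inj.
apply: fsubset_leq_card; apply/fsubsetP => _ /imfsetP[[x y] /= h ->].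
move: h; rewrite inE /= => /andP[nxy d].
apply/imfset2P; exists (pt x) => /=; first by apply/imfsetP; exists x.
exists (pt y); rewrite //= inE /= card_right d orbT andbT.
by rewrite (inj_eq pt_inj) nxy andbT; apply/imfsetP; exists y.
Qed.

Lemma E_le_lb k : 2 * k + 2 < #|T| -> #|flat pt k.+1| <= E_le k config.
Proof.
move=> hk; rewrite card_flat [X in X <= _]big_nat /E_le [X in _ <= X]big_nat.
by apply: leq_sum => j hj; apply: edges_lb; lia.
Qed.

End Edges.

Section GeneralPosition.
Variable R : realType.

Lemma orient_line (p q x : 'rV[R]_2) : p != q -> orient p q x = 0%R -> line p q x.
Proof.
rewrite /orient => npq h.
have [e0|n0] := eqVneq (q 0 0)%R (p 0 0)%R.
  have n1 : (q 0 1 - p 0 1 != 0)%R.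
    rewrite subr_eq0; apply: contraNneq npq => e1; apply/eqP/rowP => i.
    case: i => -[|[|//]] hi.
      by rewrite (_ : Ordinal hi = 0%R) //; apply: val_inj.
    by rewrite (_ : Ordinal hi = 1%R) //; apply: val_inj.
  have x0 : (x 0 0 = p 0 0)%R.
    move/eqP: h; rewrite e0 subrr mul0r sub0r oppr_eq0 mulf_eq0 (negPf n1) /= subr_eq0.
    by move/eqP.
  exists ((x 0 1 - p 0 1) / (q 0 1 - p 0 1))%R => //; apply/rowP => i; rewrite !mxE.
  case: i => -[|[|//]] hi.
    by rewrite (_ : Ordinal hi = 0%R) ?x0 ?e0 ?subrr ?mulr0 ?addr0 //; apply: val_inj.
  have -> : Ordinal hi = 1%R :> 'I_2 by apply: val_inj.
  by rewrite divfK // addrC subrK.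
have {}n0 : (q 0 0 - p 0 0 != 0)%R by rewrite subr_eq0.
exists ((x 0 0 - p 0 0) / (q 0 0 - p 0 0))%R => //; apply/rowP => i; rewrite !mxE.
case: i => -[|[|//]] hi.
  have -> : Ordinal hi = 0%R :> 'I_2 by apply: val_inj.
  by rewrite divfK // addrC subrK.
have -> : Ordinal hi = 1%R :> 'I_2 by apply: val_inj.
apply: (mulfI n0); rewrite mulrDr mulrA (mulrC _ (_ / _))%R divfK //.
move/eqP: h; rewrite subr_eq0 => /eqP h.
have -> : ((x 0 0 - p 0 0) * (q 0 1 - p 0 1) = (q 0 0 - p 0 0) * (x 0 1 - p 0 1))%R.
  by rewrite h mulrC.
by ring.
Qed.

Lemma free_general_position (T : finType) (pt : T -> 'rV[R]_2) :
  free pt -> general_position (config pt).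
Proof.
move=> fr _ _ _ /imfsetP[x _ ->] /imfsetP[y _ ->] /imfsetP[z _ ->] xy xz yz.
move/line_orient/eqP; apply/negP; apply: fr.
- by apply: contraNneq xy => ->.
- by apply: contraNneq xz => ->.
- by apply: contraNneq yz => ->.
Qed.

Lemma general_position_free (P : {fset 'rV[R]_2}) : general_position P ->
  exists (T : finType) (pt : T -> 'rV[R]_2),
    [/\ injective pt, free pt & config pt = P].
Proof.
move=> gp; exists P, val; split; first exact: val_inj.
  move=> x y z nxy nxz nyz; apply/eqP => h.
  apply: (gp (val x) (val y) (val z)); rewrite ?(inj_eq val_inj) //; try exact: fsvalP.
  by apply: orient_line => //; rewrite (inj_eq val_inj).
apply/fsetP => v; apply/imfsetP/idP => [[x _ ->]|vP]; first exact: fsvalP.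
by exists [` vP]%fset.
Qed.

End GeneralPosition.

(** * Pairs separated by a vertical line *)

Section Bichromatic.
Variables (R : realType) (T : finType) (pt : T -> 'rV[R]_2).
Variables (A B : {set T}) (s : R).
Hypothesis free_pt : free pt.
Local Open Scope ring_scope.
Hypothesis A_left : forall a, a \in A -> pt a 0 0 < s.
Hypothesis B_right : forall b, b \in B -> s < pt b 0 0.

Definition below (S : {set T}) x y := [set z in S | orient (pt x) (pt y) (pt z) < 0].

Definition slope x y := (pt y 0 1 - pt x 0 1) / (pt y 0 0 - pt x 0 0).
(** Height of the line xy above the abscissa [X]. *)
Definition chord x y X := pt x 0 1 + slope x y * (X - pt x 0 0).

Lemma chord_orient a b z : a \in A -> b \in B ->
  orient (pt a) (pt b) (pt z) = (pt b 0 0 - pt a 0 0) * (pt z 0 1 - chord a b (pt z 0 0)).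
Proof.
move=> /A_left ha /B_right hb; have h : pt b 0 0 - pt a 0 0 != 0 by rewrite gt_eqF //; lra.
by rewrite /orient /chord /slope; field.
Qed.

Lemma mem_below (S : {set T}) a b z : a \in A -> b \in B ->
  (z \in below S a b) = (z \in S) && (pt z 0 1 < chord a b (pt z 0 0)).
Proof.
move=> ha hb; rewrite inE chord_orient // pmulr_rlt0 ?subr_lt0 //.
by have := A_left ha; have := B_right hb; lra.
Qed.

Lemma chord_l a b : chord a b (pt a 0 0) = pt a 0 1.
Proof. by rewrite /chord subrr mulr0 addr0. Qed.

Lemma chord_r a b : a \in A -> b \in B -> chord a b (pt b 0 0) = pt b 0 1.
Proof.
move=> ha hb; have /esym/eqP := chord_orient b ha hb.
have -> : orient (pt a) (pt b) (pt b) = 0 by rewrite /orient; ring.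
rewrite mulf_eq0 !subr_eq0 => /orP[/eqP h|/eqP //].
by have := A_left ha; have := B_right hb; rewrite h; lra.
Qed.

(** Raising a line over the whole of [S] keeps what was below it and adds the
    point [p] of [S] that it passed through. *)
Lemma raised_line (S : {set T}) a b a' b' p : a \in A -> b \in B -> a' \in A -> b' \in B ->
  p \in S -> p != a -> p != b -> a != b -> pt p 0 1 = chord a' b' (pt p 0 0) ->
  (forall z, z \in S -> chord a' b' (pt z 0 0) <= chord a b (pt z 0 0)) ->
  (#|below S a' b'| < #|below S a b|)%N.
Proof.
move=> ha hb ha' hb' hp pa pb ab e h; apply: proper_card; apply/properP; split.
  apply/fintype.subsetP => z; rewrite !mem_below // => /andP[zS lt]; rewrite zS /=.
  exact: lt_le_trans lt (h z zS).
exists p; rewrite !mem_below // hp /= -?e ?ltxx //.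
have le := h p hp; rewrite -e in le; rewrite lt_neqAle le andbT.
apply/eqP => e2; have : orient (pt a) (pt b) (pt p) = 0 by rewrite chord_orient // -e2 subrr mulr0.
by move/eqP; apply/negP; apply: free_pt; rewrite // eq_sym.
Qed.

(** The difference D of the two lines is nonincreasing.  If it is nonnegative at
    the separating abscissa it is nonnegative over [A], so that equal counts
    in [A] force a = a'; if it is nonpositive there it is nonpositive over
    [B] and b = b'.  Sharing one endpoint makes D vanish at it, which settles
    the other endpoint. *)
Lemma line_of_counts_wlog a b a' b' : a \in A -> b \in B -> a' \in A -> b' \in B ->
  slope a b <= slope a' b' ->
  #|below A a b| = #|below A a' b'| -> #|below B a b| = #|below B a' b'| -> a = a' /\ b = b'.
Proof.
move=> ha hb ha' hb' m cA cB.
have AB u v : u \in A -> v \in B -> u != v.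
  by move=> /A_left hu /B_right hv; apply: contraTneq hu => ->; rewrite -leNgt ltW.
pose D X := chord a b X - chord a' b' X.
have slopeD X Y : X <= Y -> D Y <= D X.
  move=> XY; rewrite -subr_ge0.
  have -> : D X - D Y = (slope a' b' - slope a b) * (Y - X) by rewrite /D /chord; ring.
  by rewrite mulr_ge0 ?subr_ge0.
have high : 0 <= D s -> a = a'.
  move=> Ds; apply/eqP/negPn/negP => na.
  have := @raised_line A a b a' b' a' ha hb ha' hb' ha'.
  rewrite cA ltnn chord_l eq_sym na AB // AB // => /(_ isT isT isT erefl) h.
  suff : false by []; apply: h => z /A_left /ltW /slopeD Dz.
  by rewrite -subr_ge0 -/(D _); apply: le_trans Ds Dz.
have low : D s <= 0 -> b = b'.
  move=> Ds; apply/eqP/negPn/negP => nb.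
  have := @raised_line B a' b' a b b ha' hb' ha hb hb.
  rewrite cB ltnn chord_r // nb [b == a']eq_sym AB // AB // => /(_ isT isT isT erefl) h.
  suff : false by []; apply: h => z /B_right /ltW /slopeD Dz.
  by rewrite -subr_le0 -/(D _); apply: le_trans Dz Ds.
have [Ds|Ds] := leP 0 (D s).
  have e := high Ds; split=> //; apply: low; have /ltW /slopeD := A_left ha.
  have -> // : D (pt a 0 0) = 0 by rewrite /D chord_l e chord_l subrr.
have e := low (ltW Ds); split=> //; apply: high; have /ltW /slopeD := B_right hb.
have -> // : D (pt b 0 0) = 0 by rewrite /D chord_r // e chord_r // subrr.
Qed.

Lemma line_of_counts a b a' b' : a \in A -> b \in B -> a' \in A -> b' \in B ->
  #|below A a b| = #|below A a' b'| -> #|below B a b| = #|below B a' b'| -> a = a' /\ b = b'.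
Proof.
move=> ha hb ha' hb' cA cB; have [m|/ltW m] := leP (slope a b) (slope a' b').
  exact: line_of_counts_wlog.
by have [] := line_of_counts_wlog ha' hb' ha hb m (esym cA) (esym cB).
Qed.

Lemma sum_indicator (I : finType) (c : pred I) : (\sum_i c i)%N = #|[set i | c i]|.
Proof. by rewrite -sum1_card [RHS]big_mkcond /=; apply: eq_bigr => i _; rewrite inE; case: (c i). Qed.

Lemma card_pairs (I J : finType) (c : I -> J -> bool) :
  #|[set p : I * J | c p.1 p.2]| = (\sum_i \sum_j c i j)%N.
Proof. by rewrite -sum_indicator pair_big. Qed.

Lemma sum_below m K i : (\sum_(j < m) (i + j < K) = minn m (K - i))%N.
Proof.
elim: m => [|m IH]; first by rewrite big_ord0 min0n.
by rewrite big_ord_recr /= IH; clear; case: ltnP; lia.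
Qed.

Lemma sum_staircase m K : (\sum_(i < m) (K - i) + 'C(K - m + 1, 2) = 'C(K + 1, 2))%N.
Proof.
elim: m => [|m IH]; first by rewrite big_ord0 subn0.
rewrite big_ord_recr /= -IH -addnA; congr (_ + _)%N.
by case E: (K - m)%N => [|u]; rewrite subnS E ?add0n // succnK !addn1 [RHS]binS bin1 addnC.
Qed.

Variables (C : {set T}) (m : nat).
Hypotheses (cA : #|A| = m) (cB : #|B| = m) (cT : #|T| = (3 * m)%N).
Hypothesis ABC : forall z, ((z \in A) + (z \in B) + (z \in C) = 1)%N.
Hypothesis C_left : forall a b c, a \in A -> b \in B -> c \in C -> 0 < orient (pt a) (pt b) (pt c).

Lemma rside_split a b : a \in A -> b \in B ->
  rside pt a b = (#|below A a b| + #|below B a b|)%N.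
Proof.
move=> ha hb; rewrite /rside.
have -> : [set z | orient (pt a) (pt b) (pt z) < 0] = below A a b :|: below B a b.
  apply/setP => z; rewrite !inE -andb_orl; have := ABC z.
  case: (boolP (z \in C)) => [hc|_]; last by case: (z \in A); case: (z \in B) => //=.
  rewrite lt_gtF ?andbF // C_left //.
rewrite cardsU (_ : _ :&: _ = set0) ?cards0 ?subn0 //.
by apply/setP => z; rewrite !inE; have := ABC z; case: (z \in A); case: (z \in B); rewrite /= ?andbF ?addSn.
Qed.

Lemma below_lt_l a b : a \in A -> (#|below A a b| < #|A|)%N.
Proof.
move=> ha; apply: proper_card; apply/properP; split.
  by apply/fintype.subsetP => z; rewrite inE => /andP[].
by exists a => //; rewrite inE (orient_xx (pt a) (pt b)).1 ltxx andbF.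
Qed.

Lemma below_lt_r a b : b \in B -> (#|below B a b| < #|B|)%N.
Proof.
move=> hb; apply: proper_card; apply/properP; split.
  by apply/fintype.subsetP => z; rewrite inE => /andP[].
by exists b => //; rewrite inE (orient_xx (pt a) (pt b)).2 ltxx andbF.
Qed.

(** Let i and j be the numbers of points of [A] and [B] below the line; both are
    less than m and (i, j) determines the pair.  The directed line from a to b
    has i + j points on its right, the opposite one 3m - 2 - (i + j), so one
    counts the (i, j) in an m by m square with i + j < K or
    (m-1-i) + (m-1-j) < K - m.  Row i contributes at most
    min(m, K-i) + (K-m-i) = K - i. *)
Lemma bichromatic_count K :
  (#|[set p in setX A B | rside pt p.1 p.2 < K]| + #|[set p in setX A B | rside pt p.2 p.1 < K]|
    + 'C(K - m + 1, 2) <= 'C(K + 1, 2))%N.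
Proof.
have AB u v : u \in A -> v \in B -> u != v.
  by move=> /A_left hu /B_right hv; apply: contraTneq hu => ->; rewrite -leNgt ltW.
case: m cA cB cT => [|m'] cA' cB' cT'.
  have A0 : A = set0 by apply/eqP; rewrite -cards_eq0 cA'.
  have E (c : pred (T * T)) : #|[set p in setX A B | c p]| = 0%N.
    by apply/eqP; rewrite cards_eq0; apply/eqP/setP => p; rewrite !inE A0 inE.
  by rewrite !E subn0.
set n := m'.+1 in cA' cB' cT' *.
pose f (p : T * T) : 'I_n * 'I_n := (inord #|below A p.1 p.2|, inord #|below B p.1 p.2|).
have fv p : p \in setX A B -> ((f p).1 = #|below A p.1 p.2| :> nat) * ((f p).2 = #|below B p.1 p.2| :> nat).
  rewrite inE => /andP[pA pB]; split; rewrite inordK //.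
    by apply: leq_trans (below_lt_l _ pA) _; rewrite cA'.
  by apply: leq_trans (below_lt_r _ pB) _; rewrite cB'.
have f_inj : {in setX A B &, injective f}.
  move=> p q hp hq e; have [p1 p2] := fv _ hp; have [q1 q2] := fv _ hq.
  move: hp hq; rewrite !inE => /andP[pA pB] /andP[qA qB].
  have [] := line_of_counts pA pB qA qB; first by rewrite -p1 -q1 e.
    by rewrite -p2 -q2 e.
  by case: p q {e p1 p2 q1 q2 pA pB qA qB} => ? ? [? ?] /= -> ->.
have count (c : pred (T * T)) (d : nat -> nat -> bool) :
    (forall p, p \in setX A B -> c p -> d (f p).1 (f p).2) ->
    (#|[set p in setX A B | c p]| <= \sum_(i < n) \sum_(j < n) d i j)%N.
  move=> cd; rewrite -(card_pairs (fun i j : 'I_n => d i j)) -(card_in_imset (f := f)); last first.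
    by move=> p q; rewrite !inE => /andP[hp _] /andP[hq _]; apply: f_inj; rewrite inE.
  apply: subset_leq_card; apply/fintype.subsetP => _ /imsetP[p hp ->].
  by move: hp; rewrite !inE -in_setX => /andP[hp hc]; apply: cd => //; rewrite -surjective_pairing in hp.
have N1 := count (fun p => rside pt p.1 p.2 < K)%N (fun i j => i + j < K)%N.
have N2 := count (fun p => rside pt p.2 p.1 < K)%N (fun i j => (m' - i) + (m' - j) < K - n)%N.
apply: leq_trans (leq_add (leq_add (N1 _) (N2 _)) (leqnn _)) _.
- move=> p hp; have [-> ->] := fv _ hp; move: hp; rewrite inE => /andP[pA pB].
  by rewrite rside_split.
- move=> p hp; have := fv _ hp; have := ltn_ord (f p).1; have := ltn_ord (f p).2.
  case=> + + [h1 h2]; move: hp; rewrite inE => /andP[pA pB].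
  have := rside_compl free_pt (AB _ _ pA pB); rewrite rside_split // cT' -h1 -h2 /n.
  move: ((f p).1 : nat) ((f p).2 : nat); clear; lia.
rewrite -(sum_staircase n K) leq_add2r -big_split /= [X in (X <= _)%N](_ : _ = \sum_(i < n) (minn n (K - i) + minn n (K - n - i)))%N.
  by apply: leq_sum => i _; clear; lia.
rewrite !big_split /=; congr (_ + _)%N; first by apply: eq_bigr => i _; rewrite sum_below.
rewrite (reindex_inj rev_ord_inj) /=; apply: eq_bigr => i _.
rewrite (reindex_inj rev_ord_inj) /= -sum_below; apply: eq_bigr => j _.
have := ltn_ord i; have := ltn_ord j; rewrite /n; clear; lia.
Qed.

End Bichromatic.

(** * The three-fold symmetric configuration *)

(** The powers of the linear map (x, y) -> (-y, x - y), of order three and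
    determinant one. *)
Definition rot (A : zmodType) (w : nat) (p : A * A) : A * A :=
  match w with 0 => p | 1 => (- p.2, p.1 - p.2)%R | _ => (p.2 - p.1, - p.1)%R end.

Definition det (A : pzRingType) (p q : A * A) : A := (p.1 * q.2 - p.2 * q.1)%R.

Definition sub2 (A : zmodType) (p q : A * A) : A * A := (p.1 - q.1, p.2 - q.2)%R.

(** Data of the four clusters of a wing: 0, 1, 2, 3 stand for P, Q, S, e.  The
    i-th point of cluster k is
      cen k + eps (off k + i vel k) + eps^3 i^2 bend k,
    so a cluster looks like a point at scale 1 and like equally spaced points
    of a line at scale eps; the last term only destroys collinearity inside
    the cluster. *)
Definition cen (k : nat) : int * int :=
  match k with 0 => (-12, 4)%Z | 1 => (-8, 0)%Z | 2 => (-14, 5)%Z | _ => (-9, 3)%Z end.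
Definition off (k : nat) : int * int :=
  match k with 0 => (-6, 0)%Z | 1 => (-2, 2)%Z | _ => (0, 0)%Z end.
Definition vel (k : nat) : int * int :=
  match k with 0 => (12, 0)%Z | 1 => (-8, 8)%Z | 2 => (2, -1)%Z | _ => (0, 0)%Z end.
Definition bend (k : nat) : int * int :=
  match k with 0 => (0, 1)%Z | 1 => (1, 0)%Z | 2 => (1, 0)%Z | _ => (0, 0)%Z end.

Section Configuration.
Local Open Scope ring_scope.
Variables (R : realType) (t : nat) (eps : R).

Definition wing := (('I_t + 'I_t.-1) + ('I_t + unit))%type.
Definition site := ('I_3 * wing)%type.

Definition kind (j : wing) : nat :=
  match j with inl (inl _) => 0 | inl (inr _) => 1 | inr (inl _) => 2 | inr (inr _) => 3 end%N.
Definition rank (j : wing) : nat :=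
  match j with inl (inl i) => i | inl (inr i) => i | inr (inl i) => i | inr (inr _) => 0 end%N.

Definition coord (c o v n : int) (i : R) : R :=
  c%:~R + (eps * (o%:~R + i * v%:~R) + eps ^+ 3 * i ^+ 2 * n%:~R).
Definition base (j : wing) : R * R :=
  let k := kind j in let i := (rank j)%:R in
  (coord (cen k).1 (off k).1 (vel k).1 (bend k).1 i,
   coord (cen k).2 (off k).2 (vel k).2 (bend k).2 i).

Definition loc (z : site) : R * R := rot z.1 (base z.2).
Definition pt (z : site) : 'rV[R]_2 := \row_(c < 2) (if c == 0 then (loc z).1 else (loc z).2).
Definition cens (z : site) : int * int := rot z.1 (cen (kind z.2)).
Definition vels (z : site) : int * int := rot z.1 (vel (kind z.2)).

Lemma orient_pt x y z : orient (pt x) (pt y) (pt z) =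
  det (sub2 (loc y) (loc x)) (sub2 (loc z) (loc x)).
Proof. by rewrite /orient !mxE. Qed.

Hypothesis t2 : (1 < t)%N.
Hypothesis eps0 : 0 < eps.
(** Displacements of order eps t and error terms of order eps t^2 are then
    negligible against nonzero integers. *)
Hypothesis epst : 10 ^+ 5 * (eps * t%:R ^+ 2) <= 1.

Lemma rank_lt j : (rank j < t)%N.
Proof. by move: t2; clear; case: j => [[i|i]|[i|u]] /=; try have := ltn_ord i; lia. Qed.

Lemma eps_rank j (i := (rank j)%:R : R) :
  [/\ 0 <= i, 0 <= eps * i, 10 ^+ 5 * (eps * i) <= 1 & 10 ^+ 5 * eps <= 1].
Proof.
have i0 : 0 <= i by rewrite ler0n.
have it : i <= t%:R by rewrite ler_nat ltnW ?rank_lt.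
have two_le_T : 2 <= t%:R :> R by rewrite ler_nat.
have e0 := eps0; have et := epst.
have h1 : eps * i <= eps * t%:R by rewrite ler_wpM2l // ltW.
have h2 : 2 * (eps * t%:R) <= eps * t%:R ^+ 2.
  have -> : eps * t%:R ^+ 2 = 2 * (eps * t%:R) + eps * t%:R * (t%:R - 2) by ring.
  by rewrite lerDl !mulr_ge0 ?ler0n ?subr_ge0 // ltW.
have h3 : eps * 2 <= eps * t%:R by rewrite ler_wpM2l // ltW.
by split => //; [rewrite mulr_ge0 // ltW | lra | lra].
Qed.

Lemma coord_close c o v n j : `|o| <= 6 -> `|v| <= 12 -> `|n| <= 1 ->
  `|coord c o v n (rank j)%:R - c%:~R| <= 1 / 2000.
Proof.
move=> ho hv hn; have [i0 ei0 ei e] := eps_rank j; have e0 := eps0.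
rewrite /coord addrC addKr; set i := (rank j)%:R in i0 ei0 ei *.
have {}ho : `|o%:~R : R| <= 6 by rewrite -intr_norm (_ : 6 = 6%:~R) // ler_int.
have {}hv : `|v%:~R : R| <= 12 by rewrite -intr_norm (_ : 12 = 12%:~R) // ler_int.
have {}hn : `|n%:~R : R| <= 1 by rewrite -intr_norm (_ : 1 = 1%:~R) // ler_int.
have -> : eps * (o%:~R + i * v%:~R) + eps ^+ 3 * i ^+ 2 * n%:~R =
  eps * o%:~R + (eps * i) * v%:~R + eps * (eps * i) ^+ 2 * n%:~R by ring.
set u := eps * i in ei0 ei *.
have {}ei : u <= 1 / 1000 * (1 / 100) by lra.
have {}e : eps <= 1 / 1000 * (1 / 100) by lra.
have h1 : `|eps * o%:~R| <= 1 / 1000 * (1 / 100) * 6.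
  by rewrite normrM gtr0_norm // ler_pM // ltW.
have h2 : `|u * v%:~R| <= 1 / 1000 * (1 / 100) * 12.
  by rewrite normrM ger0_norm // ler_pM.
have u0 : 0 <= u ^+ 2 by exact: exprn_ge0.
have u1 : u ^+ 2 <= 1 by rewrite exprn_ile1 //; lra.
have h3 : `|eps * u ^+ 2 * n%:~R| <= 1 / 1000 * (1 / 100) * 1 * 1.
  rewrite normrM; apply: ler_pM => //; rewrite normrM (gtr0_norm e0) (ger0_norm u0).
  by apply: ler_pM => //; exact: ltW.
by apply: le_trans (ler_normD _ _) _; have := ler_normD (eps * o%:~R) (u * v%:~R); lra.
Qed.

Lemma base_close j : `|(base j).1 - (cen (kind j)).1%:~R| <= 1 / 2000 /\
  `|(base j).2 - (cen (kind j)).2%:~R| <= 1 / 2000.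
Proof.
by split; apply: coord_close; case: j => [[i|i]|[i|u]].
Qed.

Lemma loc_close z : `|(loc z).1 - (cens z).1%:~R| <= 1 / 1000 /\
  `|(loc z).2 - (cens z).2%:~R| <= 1 / 1000.
Proof.
case: z => w j; have [h1 h2] := base_close j; rewrite /loc /cens /=.
move: h1 h2; rewrite !ler_norml.
case: (nat_of_ord w) => [|[|m]] /=; rewrite ?rmorphN ?rmorphB /=; lra.
Qed.

Lemma cens_bound z : `|(cens z).1| <= 20 /\ `|(cens z).2| <= 20.
Proof.
by case: z => -[[|[|[|//]]] hw] [[i|i]|[i|u]].
Qed.

Lemma int_lb (x : int) : 0 < x -> 1 <= x%:~R :> R.
Proof. by move=> h; rewrite (_ : 1 = 1%:~R) // ler_int -gtz0_ge1. Qed.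

(** An integer determinant that is positive is at least 1, which leaves room for
    small perturbations of its entries. *)
Lemma det_pos (D E : int * int) (d e : R * R) :
  `|D.1| <= 40 -> `|D.2| <= 40 -> `|E.1| <= 40 -> `|E.2| <= 40 ->
  `|d.1 - D.1%:~R| <= 1 / 500 -> `|d.2 - D.2%:~R| <= 1 / 500 ->
  `|e.1 - E.1%:~R| <= 1 / 500 -> `|e.2 - E.2%:~R| <= 1 / 500 ->
  0 < det D E -> 0 < det d e.
Proof.
case: D E d e => [D1 D2] [E1 E2] [d1 d2] [e1 e2] /=.
move=> hD1 hD2 hE1 hE2 hd1 hd2 he1 he2 /int_lb; rewrite /det /= rmorphB !rmorphM /=.
have cast (x : int) : `|x| <= 40 -> `|x%:~R : R| <= 40.
  by move=> h; rewrite -intr_norm (_ : 40 = 40%:~R) // ler_int.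
move: (cast _ hD1) (cast _ hD2) (cast _ hE1) (cast _ hE2).
move: (D1%:~R : R) (D2%:~R : R) (E1%:~R : R) (E2%:~R : R) hd1 hd2 he1 he2.
clear => D1 D2 E1 E2 hd1 hd2 he1 he2 hD1 hD2 hE1 hE2 h.
have bd (D d E e : R) : `|D| <= 40 -> `|E| <= 40 -> `|d - D| <= 1 / 500 -> `|e - E| <= 1 / 500 ->
    `|d * e - D * E| <= 1 / 5.
  move=> h1 h2 h3 h4.
  have -> : d * e - D * E = (d - D) * (e - E) + D * (e - E) + (d - D) * E by ring.
  have k1 : `|(d - D) * (e - E)| <= 1 / 500 * (1 / 500) by rewrite normrM ler_pM.
  have k2 : `|D * (e - E)| <= 40 * (1 / 500) by rewrite normrM ler_pM.
  have k3 : `|(d - D) * E| <= 1 / 500 * 40 by rewrite normrM ler_pM.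
  apply: le_trans (ler_normD _ _) _; have := ler_normD ((d - D) * (e - E)) (D * (e - E)); lra.
have := bd _ _ _ _ hD1 hE2 hd1 he2; have := bd _ _ _ _ hD2 hE1 hd2 he1.
by rewrite !ler_norml; lra.
Qed.

Lemma det_neg (D E : int * int) (d e : R * R) :
  `|D.1| <= 40 -> `|D.2| <= 40 -> `|E.1| <= 40 -> `|E.2| <= 40 ->
  `|d.1 - D.1%:~R| <= 1 / 500 -> `|d.2 - D.2%:~R| <= 1 / 500 ->
  `|e.1 - E.1%:~R| <= 1 / 500 -> `|e.2 - E.2%:~R| <= 1 / 500 ->
  det D E < 0 -> det d e < 0.
Proof.
have detC (A : comPzRingType) (p q : A * A) : det q p = - det p q by rewrite /det; ring.
move=> h1 h2 h3 h4 h5 h6 h7 h8 h; rewrite -oppr_gt0 -detC.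
by apply: det_pos h3 h4 h1 h2 h7 h8 h5 h6 _; rewrite detC oppr_gt0.
Qed.

Lemma diff_close (a b c d : R) : `|a - b| <= 1 / 1000 -> `|c - d| <= 1 / 1000 ->
  `|(a - c) - (b - d)| <= 1 / 500.
Proof. by rewrite !ler_norml; clear; lra. Qed.

Lemma diff_bound (a b : int) : `|a| <= 20 -> `|b| <= 20 -> `|a - b| <= 40.
Proof. by move=> ha hb; move: ha hb; rewrite !ler_norml; clear; lia. Qed.

Definition turnZ x y z := det (sub2 (cens y) (cens x)) (sub2 (cens z) (cens x)).

(** Orientations visible at scale 1. *)
Lemma far_pos x y z : 0 < turnZ x y z -> 0 < orient (pt x) (pt y) (pt z).
Proof.
rewrite orient_pt; have [b1 b2] := cens_bound x; have [b3 b4] := cens_bound y.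
have [b5 b6] := cens_bound z; have [c1 c2] := loc_close x; have [c3 c4] := loc_close y.
have [c5 c6] := loc_close z.
by apply: det_pos; rewrite /= ?rmorphB; try exact: diff_bound; exact: diff_close.
Qed.

Lemma far_neg x y z : turnZ x y z < 0 -> orient (pt x) (pt y) (pt z) < 0.
Proof.
move=> h; rewrite -oppr_gt0 -orient_swap; apply: far_pos.
move: h; rewrite /turnZ /det /sub2 /= -oppr_gt0; congr (_ < _); ring.
Qed.

End Configuration.

(** * Orientations decided inside a cluster *)

Section InsideCluster.
Local Open Scope ring_scope.
Variables (R : realType) (t : nat) (eps : R).
Hypothesis t2 : (1 < t)%N.
Hypothesis eps0 : 0 < eps.
Hypothesis epst : 10 ^+ 5 * (eps * t%:R ^+ 2) <= 1.
Local Notation site := (site t).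
Local Notation wing := (wing t).
Local Notation loc := (loc eps).
Local Notation pt := (pt eps).
Implicit Types (x y z : site) (j : wing).
(** Position relative to the centre of the cluster, at scale eps. *)
Definition drift j : R * R :=
  let k := kind j in let i := (rank j)%:R in
  ((off k).1%:~R + i * (vel k).1%:~R + eps ^+ 2 * i ^+ 2 * (bend k).1%:~R,
   (off k).2%:~R + i * (vel k).2%:~R + eps ^+ 2 * i ^+ 2 * (bend k).2%:~R).
Definition fine z : R * R := rot z.1 (drift z.2).

Lemma loc_fine z : loc z = ((cens z).1%:~R + eps * (fine z).1, (cens z).2%:~R + eps * (fine z).2).
Proof.
case: z => w j; rewrite /loc /cens /fine /base /coord /drift /=.
by case: (nat_of_ord w) => [|[|m]] /=; rewrite ?rmorphN ?rmorphB /=; congr (_, _); ring.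
Qed.

Lemma det_rot (A : comPzRingType) (w : nat) (p q : A * A) : det (rot w p) (rot w q) = det p q.
Proof. by case: w => [|[|w]]; rewrite /det /=; ring. Qed.

Lemma rot_sub (A : comPzRingType) (w : nat) (p q : A * A) :
  sub2 (rot w p) (rot w q) = rot w (sub2 p q).
Proof.
by case: p q => p1 p2 [q1 q2]; case: w => [|[|w]]; rewrite /sub2 /=; congr (_, _); ring.
Qed.

Local Notation T := (t%:R : R).

Lemma eps_small (a b : R) : `|a| <= T -> `|b| <= T -> `|eps * (a * b)| <= 1 / 1000 * (1 / 100).
Proof.
move=> ha hb; rewrite normrM gtr0_norm //; apply: le_trans (_ : eps * T ^+ 2 <= _).
  by rewrite ler_pM2l // normrM expr2 ler_pM.
by have := epst; lra.
Qed.

Lemma two_le_T : 2 <= T. Proof. by rewrite ler_nat. Qed.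

Lemma rank_T j : (0 : R) <= (rank j)%:R <= T.
Proof. by rewrite ler0n ler_nat ltnW // rank_lt. Qed.

Lemma drift_tiny j j' : 0 <= eps ^+ 2 * ((rank j)%:R * (rank j')%:R) <= 1 / 1000.
Proof.
have [i0 ei0 ei e] := eps_rank t2 eps0 epst j; have [i0' ei0' ei' _] := eps_rank t2 eps0 epst j'.
have -> : eps ^+ 2 * ((rank j)%:R * (rank j')%:R) = (eps * (rank j)%:R) * (eps * (rank j')%:R) by ring.
rewrite mulr_ge0 //=; apply: le_trans (_ : 1 / 1000 * 1 <= _); last by rewrite mulr1.
by apply: ler_pM => //; lra.
Qed.

Lemma fine_bound z : `|(fine z).1| <= 40 * T /\ `|(fine z).2| <= 40 * T.
Proof.
case: z => w j; rewrite /fine /=; have /andP[i0 iT] := rank_T j.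
have := two_le_T; have := drift_tiny j j; rewrite -expr2 => /andP[d0 d1] two_le_T.
have [h1 h2] : `|(drift j).1| <= 20 * T /\ `|(drift j).2| <= 20 * T.
  rewrite /drift; move: (rank j)%:R (eps ^+ 2 * _) i0 iT d0 d1 => i d i0 iT d0 d1.
  rewrite !ler_norml; case: j => [[j|j]|[j|u]] /=; rewrite ?rmorphN /=; split; lra.
move: h1 h2; rewrite !ler_norml.
by case: (nat_of_ord w) => [|[|m]] /=; lra.
Qed.

(** If the three centres are collinear, the sign is decided at scale eps by the
    part of the determinant linear in the displacements; the quadratic part
    is bounded by 1. *)
Lemma near_collinear x y z : turnZ x y z = 0 ->
  exists2 r : R, `|r| <= 1 & orient (pt x) (pt y) (pt z) =
    eps * (det (sub2 (fine y) (fine x)) ((sub2 (cens z) (cens x)).1%:~R, (sub2 (cens z) (cens x)).2%:~R)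
      + det ((sub2 (cens y) (cens x)).1%:~R, (sub2 (cens y) (cens x)).2%:~R) (sub2 (fine z) (fine x)) + r).
Proof.
move=> h; exists (eps * det (sub2 (fine y) (fine x)) (sub2 (fine z) (fine x))).
  have [x1 x2] := fine_bound x; have [y1 y2] := fine_bound y; have [z1 z2] := fine_bound z.
  have bd a b c d : `|a| <= 40 * T -> `|b| <= 40 * T -> `|c| <= 40 * T -> `|d| <= 40 * T ->
      `|eps * ((a - b) * (c - d))| <= 1 / 2.
    move=> ha hb hc hd.
    have -> : eps * ((a - b) * (c - d)) = 80 * 80 * (eps * (((a - b) / 80) * ((c - d) / 80))) by field.
    have h1 : `|(a - b) / 80| <= T.
      by rewrite normrM (ger0_norm (_ : 0 <= 80^-1)) ?invr_ge0 // ler_pdivrMr //;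
         apply: le_trans (ler_normB _ _) _; lra.
    have h2 : `|(c - d) / 80| <= T.
      by rewrite normrM (ger0_norm (_ : 0 <= 80^-1)) ?invr_ge0 // ler_pdivrMr //;
         apply: le_trans (ler_normB _ _) _; lra.
    by rewrite normrM ger0_norm //; have := eps_small h1 h2; lra.
  rewrite /det /= mulrBr; apply: le_trans (ler_normB _ _) _.
  by have := bd _ _ _ _ y1 x1 z2 x2; have := bd _ _ _ _ y2 x2 z1 x1; lra.
have h' : det ((sub2 (cens y) (cens x)).1%:~R, (sub2 (cens y) (cens x)).2%:~R)
   ((sub2 (cens z) (cens x)).1%:~R, (sub2 (cens z) (cens x)).2%:~R) = 0 :> R.
  by move/(congr1 (fun a : int => a%:~R : R)): h; rewrite /turnZ /det /= rmorphB !rmorphM.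
rewrite orient_pt !loc_fine /sub2 /=.
have e c d p q : c%:~R + eps * p - (d%:~R + eps * q) = (c - d)%:~R + eps * (p - q) :> R.
  by rewrite rmorphB /=; ring.
rewrite !e; move: h'; rewrite /det /=.
move: ((cens y).1 - _)%:~R ((cens y).2 - _)%:~R ((cens z).1 - _)%:~R ((cens z).2 - _)%:~R.
move: ((fine y).1 - _) ((fine y).2 - _) ((fine z).1 - _) ((fine z).2 - _).
move=> p1 p2 q1 q2 A B C D h'.
transitivity ((A * D - B * C) + eps * (p1 * D - p2 * C + (A * q2 - B * q1) + eps * (p1 * q2 - p2 * q1))).
  by ring.
by rewrite h' add0r.
Qed.

Definition bends z : int * int := rot z.1 (bend (kind z.2)).
(** Position of the centre of the cluster of z relative to the line supporting
    the cluster of x. *)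
Definition dirZ x z := det (vels x) (sub2 (cens z) (cens x)).

Section SameCluster.
Variables (w : 'I_3) (j j' : wing).
Hypotheses (kj : kind j = kind j') (ij : (rank j < rank j')%N).
Let x : site := (w, j).
Let y : site := (w, j').
Let i : R := (rank j)%:R.
Let i' : R := (rank j')%:R.

Lemma pair_diff : sub2 (loc y) (loc x) =
  (eps * (i' - i) * ((vels x).1%:~R + eps ^+ 2 * (i + i') * (bends x).1%:~R),
   eps * (i' - i) * ((vels x).2%:~R + eps ^+ 2 * (i + i') * (bends x).2%:~R)).
Proof.
rewrite /x /y /loc rot_sub /vels /bends /base /= -kj /coord -/i -/i' /sub2.
by case: (nat_of_ord w) => [|[|m]] /=; rewrite ?rmorphN ?rmorphB /=; congr (_, _); ring.
Qed.

Lemma ranks_pos : 0 < eps * (i' - i).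
Proof. by rewrite mulr_gt0 // subr_gt0 ltr_nat. Qed.

Lemma bends_bound : `|(bends x).1| <= 1 /\ `|(bends x).2| <= 1.
Proof. by rewrite /bends /x; case: w => -[|[|[|//]]] hw; case: j => [[a|a]|[a|a]]. Qed.

Lemma vels_bound : `|(vels x).1| <= 20 /\ `|(vels x).2| <= 20.
Proof. by rewrite /vels /x; case: w => -[|[|[|//]]] hw; case: j => [[a|a]|[a|a]]. Qed.

Lemma eps_sum : 0 <= eps * (i + i') <= 1 / 1000.
Proof.
have [_ e0 e1 _] := eps_rank t2 eps0 epst j; have [_ e0' e1' _] := eps_rank t2 eps0 epst j'.
by rewrite -/i -/i' in e0 e1 e0' e1'; rewrite mulrDr; lra.
Qed.

(** The secant of a cluster has nearly the direction of its supporting line, so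
    a point z whose centre is off that line lies on the side of its centre. *)
Lemma pair_sign z : (0 < dirZ x z -> 0 < orient (pt x) (pt y) (pt z)) /\
  (dirZ x z < 0 -> orient (pt x) (pt y) (pt z) < 0).
Proof.
rewrite orient_pt pair_diff.
set d := (_, _); set e := sub2 (loc z) _.
pose d' := ((vels x).1%:~R + eps ^+ 2 * (i + i') * (bends x).1%:~R,
            (vels x).2%:~R + eps ^+ 2 * (i + i') * (bends x).2%:~R) : R * R.
have -> : det d e = eps * (i' - i) * det d' e by rewrite /det /d /d' /=; ring.
rewrite pmulr_rgt0 ?pmulr_rlt0 ?ranks_pos //.
have [v1 v2] := vels_bound; have [n1 n2] := bends_bound.
have [x1 x2] := cens_bound x; have [z1 z2] := cens_bound z.
have [cx1 cx2] := loc_close t2 eps0 epst x; have [cz1 cz2] := loc_close t2 eps0 epst z.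
have le40 (a : int) : `|a| <= 20 -> `|a| <= 40 by move=> k; apply: le_trans k _.
have tiny (n v : int) : `|n| <= 1 -> `|v%:~R + eps ^+ 2 * (i + i') * n%:~R - v%:~R| <= 1 / 500 :> R.
  move=> hn; rewrite addrC addKr.
  have {}hn : `|n%:~R : R| <= 1 by rewrite -intr_norm (_ : 1 = 1%:~R) // ler_int.
  have /andP[s0 s1] := eps_sum.
  have [_ _ _ e1] := eps_rank t2 eps0 epst j.
  have -> : eps ^+ 2 * (i + i') * n%:~R = eps * (eps * (i + i')) * n%:~R by ring.
  rewrite normrM; apply: le_trans (_ : 1 / 500 * 1 <= _); last by rewrite mulr1.
  apply: ler_pM => //; rewrite normrM (gtr0_norm eps0) (ger0_norm s0).
  apply: le_trans (_ : 1 * (1 / 1000) <= _); last by lra.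
  by apply: ler_pM => //; [exact: ltW | lra].
split; [apply: det_pos | apply: det_neg].
all: try exact: (le40 _ v1); try exact: (le40 _ v2).
all: try exact: (diff_bound z1 x1); try exact: (diff_bound z2 x2).
all: try exact: (tiny _ _ n1); try exact: (tiny _ _ n2).
all: rewrite /e /sub2 /= rmorphB.
all: try exact: (diff_close cz1 cx1); exact: (diff_close cz2 cx2).
Qed.

(** When the centre of z is on the supporting line, the displacement of z
    relative to x decides. *)
Lemma pair_fine z : dirZ x z = 0 -> exists2 r : R, `|r| <= 1 &
  orient (pt x) (pt y) (pt z) = eps * (eps * (i' - i)) *
    (det ((vels x).1%:~R, (vels x).2%:~R) (sub2 (fine z) (fine x)) + r).
Proof.
move=> h; set E1 := (sub2 (cens z) (cens x)).1%:~R : R; set E2 := (sub2 (cens z) (cens x)).2%:~R : R.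
set n1 := (bends x).1%:~R : R; set n2 := (bends x).2%:~R : R.
pose F := sub2 (fine z) (fine x).
exists (eps * (i + i') * ((n1 * E2 - n2 * E1) + eps * (n1 * F.2 - n2 * F.1))).
  have [b1 b2] := bends_bound.
  have [x1 x2] := fine_bound x; have [z1 z2] := fine_bound z.
  have [c1 c2] := cens_bound x; have [d1 d2] := cens_bound z.
  have /andP[s0 s1] := eps_sum.
  have e1 : eps * T <= 1 / 1000.
    have := @eps_small T 1; rewrite mulr1 (ger0_norm (ler0n _ _)) lexx normr1 => /(_ isT).
    rewrite (le_trans _ two_le_T) ?ler1n // => /(_ isT).
    by rewrite ger0_norm ?mulr_ge0 ?ler0n ?(ltW eps0) //; lra.
  have n1b : `|n1| <= 1 by rewrite /n1 -intr_norm (_ : 1 = 1%:~R) // ler_int.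
  have n2b : `|n2| <= 1 by rewrite /n2 -intr_norm (_ : 1 = 1%:~R) // ler_int.
  have E1b : `|E1| <= 40 by rewrite /E1 -intr_norm (_ : 40 = 40%:~R) // ler_int; apply: diff_bound.
  have E2b : `|E2| <= 40 by rewrite /E2 -intr_norm (_ : 40 = 40%:~R) // ler_int; apply: diff_bound.
  have Fb (a b : R) : `|a| <= 40 * T -> `|b| <= 40 * T -> `|eps * (a - b)| <= 1.
    move=> ha hb; rewrite normrM gtr0_norm //; apply: le_trans (_ : eps * (80 * T) <= _); last by lra.
    by rewrite ler_pM2l //; apply: le_trans (ler_normB _ _) _; lra.
  have F1 := Fb _ _ z1 x1; have F2 := Fb _ _ z2 x2; rewrite -/F in F1 F2.
  have pr (a b k : R) : `|a| <= 1 -> `|b| <= k -> `|a * b| <= k.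
    by move=> ha hb; rewrite normrM -[k]mul1r ler_pM.
  have -> : (n1 * E2 - n2 * E1) + eps * (n1 * F.2 - n2 * F.1) =
     n1 * E2 - n2 * E1 + (n1 * (eps * F.2) - n2 * (eps * F.1)) by ring.
  rewrite normrM (ger0_norm s0); apply: le_trans (_ : 1 / 1000 * 100 <= _); last by lra.
  apply: ler_pM => //; apply: le_trans (ler_normD _ _) _.
  have := ler_normB (n1 * E2) (n2 * E1); have := ler_normB (n1 * (eps * F.2)) (n2 * (eps * F.1)).
  by have := pr _ _ _ n1b E2b; have := pr _ _ _ n2b E1b; have := pr _ _ _ n1b F2; have := pr _ _ _ n2b F1; lra.
have h' : (vels x).1%:~R * E2 - (vels x).2%:~R * E1 = 0 :> R.
  by move/(congr1 (fun a : int => a%:~R : R)): h; rewrite /dirZ /det /= rmorphB !rmorphM.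
rewrite orient_pt pair_diff -/n1 -/n2.
have -> : sub2 (loc z) (loc x) = (E1 + eps * F.1, E2 + eps * F.2).
  by rewrite !loc_fine /sub2 /E1 /E2 /F /= !rmorphB /=; congr (_, _); ring.
rewrite -/F /det /=.
move: ((vels x).1%:~R : R) ((vels x).2%:~R : R) h' => v1 v2 h'.
move: E1 E2 h' ((fine z).1 - _) ((fine z).2 - _) => E1 E2 h' p q.
transitivity (eps * (i' - i) * ((v1 * E2 - v2 * E1)
  + eps * (v1 * q - v2 * p + eps * (i + i') * (n1 * E2 - n2 * E1 + eps * (n1 * q - n2 * p))))).
  by ring.
by rewrite h' add0r; ring.
Qed.

End SameCluster.

(** Inside a cluster the points follow a parabola. *)
Lemma triple_same (w : 'I_3) (j j1 j2 : wing) :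
  kind j = kind j1 -> kind j = kind j2 -> rank j != rank j1 -> rank j != rank j2 ->
  rank j1 != rank j2 -> orient (pt (w, j)) (pt (w, j1)) (pt (w, j2)) != 0.
Proof.
move=> k1 k2 n1 n2 n12; rewrite orient_pt /loc !rot_sub det_rot /base -k1 -k2.
set i := (rank j)%:R; set i1 := (rank j1)%:R; set i2 := (rank j2)%:R.
have -> : det (sub2 (coord eps (cen (kind j)).1 (off (kind j)).1 (vel (kind j)).1 (bend (kind j)).1 i1,
    coord eps (cen (kind j)).2 (off (kind j)).2 (vel (kind j)).2 (bend (kind j)).2 i1)
    (coord eps (cen (kind j)).1 (off (kind j)).1 (vel (kind j)).1 (bend (kind j)).1 i,
    coord eps (cen (kind j)).2 (off (kind j)).2 (vel (kind j)).2 (bend (kind j)).2 i))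
   (sub2 (coord eps (cen (kind j)).1 (off (kind j)).1 (vel (kind j)).1 (bend (kind j)).1 i2,
    coord eps (cen (kind j)).2 (off (kind j)).2 (vel (kind j)).2 (bend (kind j)).2 i2)
    (coord eps (cen (kind j)).1 (off (kind j)).1 (vel (kind j)).1 (bend (kind j)).1 i,
    coord eps (cen (kind j)).2 (off (kind j)).2 (vel (kind j)).2 (bend (kind j)).2 i)) =
   eps ^+ 4 * (det (vel (kind j)) (bend (kind j)))%:~R * ((i1 - i) * (i2 - i) * (i2 - i1)).
  by rewrite /det /sub2 /coord /= !rmorphB !rmorphM /=; ring.
have d0 (a b : nat) : a != b -> a%:R - b%:R != 0 :> R by move=> ab; rewrite subr_eq0 eqr_nat.
apply: mulf_neq0; last by do !apply: mulf_neq0; apply: d0; rewrite // eq_sym.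
apply: mulf_neq0; first by rewrite expf_neq0 // gt_eqF.
rewrite intr_eq0; clear i i1 i2 d0; case: j k1 k2 n1 n2 => [[a|a]|[a|a]] //= _ k2 n1 n2.
by case: j2 k2 n2 {n12} => [[b|b]|[b|[]]] //=; case: a n1.
Qed.

End InsideCluster.

(** * General position of the configuration *)

Section Spreading.
Local Open Scope ring_scope.
Variables (R : realType) (t : nat) (eps : R).
Hypothesis t2 : (1 < t)%N.
Hypothesis eps0 : 0 < eps.
Hypothesis epst : 10 ^+ 5 * (eps * t%:R ^+ 2) <= 1.
Local Notation site := (site t).
Local Notation wing := (wing t).
Local Notation loc := (loc eps).
Local Notation pt := (pt eps).
Implicit Types (x y z : site) (j : wing).
Definition spin (v : 'I_3) z : site := (v + z.1, z.2).

(** Spinning permutes the wings cyclically and preserves orientation, which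
    reduces most statements to the wing 0. *)
Lemma loc_spin v z : loc (spin v z) = rot v (loc z).
Proof.
case: z => w j; rewrite /spin /loc /=.
case: v => [[|[|[|//]]] hv]; case: w => [[|[|[|//]]] hw]; case: (base _ _) => a b //=;
  by congr (_, _); ring.
Qed.

Lemma orient_spin v x y z : orient (pt (spin v x)) (pt (spin v y)) (pt (spin v z)) =
  orient (pt x) (pt y) (pt z).
Proof. by rewrite !orient_pt !loc_spin !rot_sub det_rot. Qed.

Definition Pt (w : 'I_3) (a : 'I_t) : site := (w, inl (inl a)).
Definition Qt (w : 'I_3) (b : 'I_t.-1) : site := (w, inl (inr b)).
Definition St (w : 'I_3) (a : 'I_t) : site := (w, inr (inl a)).
Definition et (w : 'I_3) : site := (w, inr (inr tt)).

Lemma drift2 j : exists2 d : R, 0 <= d <= 1 / 1000 & drift eps j =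
  ((off (kind j)).1%:~R + (rank j)%:R * (vel (kind j)).1%:~R + d * (bend (kind j)).1%:~R,
   (off (kind j)).2%:~R + (rank j)%:R * (vel (kind j)).2%:~R + d * (bend (kind j)).2%:~R).
Proof.
by exists (eps ^+ 2 * (rank j)%:R ^+ 2); rewrite ?expr2 ?(drift_tiny t2 eps0 epst).
Qed.

(** The centres of P and Q in a wing and of Q in the next one are collinear.
    At scale eps the lines joining a point of P to the points of the first Q
    pass between the points of the second Q: exactly those with index c < a
    are on the left. *)
Lemma PQQ0 (a : 'I_t) (b c : 'I_t.-1) : (c < a)%N && (0 < orient (pt (Pt 0 a)) (pt (Qt 0 b)) (pt (Qt 1 c))) ||
  (a <= c)%N && (orient (pt (Pt 0 a)) (pt (Qt 0 b)) (pt (Qt 1 c)) < 0).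
Proof.
have [r /ler_normlP[r1 r2] ->] := @near_collinear _ _ _ t2 eps0 epst (Pt 0 a) (Qt 0 b) (Qt 1 c) erefl.
rewrite pmulr_rgt0 // pmulr_rlt0 //.
have [d1 b1 e1] := drift2 (inl (inl a)); have [d2 b2 e2] := drift2 (inl (inr b)).
have [d3 b3 e3] := drift2 (inl (inr c)).
rewrite /fine e1 e2 e3 /sub2 /det /=.
rewrite ?NegzE ?rmorphB ?rmorphN /= -?pmulrn.
case: ltnP => h; rewrite /= ?orbF.
  have h' : (c.+1%:R <= a%:R :> R) by rewrite ler_nat.
  by move: h'; rewrite -addn1 natrD => h'; lra.
have h' : (a%:R <= c%:R :> R) by rewrite ler_nat.
lra.
Qed.

(** The line supporting Q passes through the centre of P, and at scale eps
    between the first and the second point of P. *)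
Lemma QQP0 (b b' : 'I_t.-1) (a : 'I_t) : (b < b')%N ->
  (a == 0 :> nat) && (0 < orient (pt (Qt 0 b)) (pt (Qt 0 b')) (pt (Pt 0 a))) ||
  (0 < a)%N && (orient (pt (Qt 0 b)) (pt (Qt 0 b')) (pt (Pt 0 a)) < 0).
Proof.
move=> bb'; have /(mulr_gt0 eps0) pos := ranks_pos eps0 (j := inl (inr b)) (j' := inl (inr b')) bb'.
have [//|r /ler_normlP[r1 r2] ->] := @pair_fine _ _ _ t2 eps0 epst 0 (inl (inr b)) (inl (inr b')) erefl (Pt 0 a).
rewrite (pmulr_rgt0 _ pos) (pmulr_rlt0 _ pos).
have [d1 b1 e1] := drift2 (inl (inl a)); have [d2 b2 e2] := drift2 (inl (inr b)).
rewrite /fine e1 e2 /sub2 /det /=.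
rewrite ?NegzE ?rmorphB ?rmorphN /= -?pmulrn.
case: posnP => h; rewrite /= ?orbF.
  by rewrite h; lra.
have h' : (1 <= a%:R :> R) by rewrite (ler_nat _ 1).
lra.
Qed.

(** The line supporting Q also passes through the centre of the next Q, whose
    points are all on one side. *)
Lemma QQQ0 (b b' c : 'I_t.-1) : (b < b')%N ->
  0 < orient (pt (Qt 0 b)) (pt (Qt 0 b')) (pt (Qt 1 c)).
Proof.
move=> bb'; have /(mulr_gt0 eps0) pos := ranks_pos eps0 (j := inl (inr b)) (j' := inl (inr b')) bb'.
have [//|r /ler_normlP[r1 r2] ->] := @pair_fine _ _ _ t2 eps0 epst 0 (inl (inr b)) (inl (inr b')) erefl (Qt 1 c).
rewrite (pmulr_rgt0 _ pos).
have [d1 b1 e1] := drift2 (inl (inr c)); have [d2 b2 e2] := drift2 (inl (inr b)).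
rewrite /fine e1 e2 /sub2 /det /=.
rewrite ?NegzE ?rmorphB ?rmorphN /= -?pmulrn.
have h' : (0 <= c%:R :> R) by rewrite ler0n.
lra.
Qed.

(** The line supporting S passes through the centre of P, and at scale eps
    between the first and the second point of P. *)
Lemma SSP0 (a a' b : 'I_t) : (a < a')%N ->
  (b == 0 :> nat) && (orient (pt (St 0 a)) (pt (St 0 a')) (pt (Pt 0 b)) < 0) ||
  (0 < b)%N && (0 < orient (pt (St 0 a)) (pt (St 0 a')) (pt (Pt 0 b))).
Proof.
move=> aa'; have /(mulr_gt0 eps0) pos := ranks_pos eps0 (j := inr (inl a)) (j' := inr (inl a')) aa'.
have [//|r /ler_normlP[r1 r2] ->] := @pair_fine _ _ _ t2 eps0 epst 0 (inr (inl a)) (inr (inl a')) erefl (Pt 0 b).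
rewrite (pmulr_rgt0 _ pos) (pmulr_rlt0 _ pos).
have [d1 b1 e1] := drift2 (inl (inl b)); have [d2 b2 e2] := drift2 (inr (inl a)).
rewrite /fine e1 e2 /sub2 /det /=.
rewrite ?NegzE ?rmorphB ?rmorphN /= -?pmulrn.
case: posnP => h; rewrite /= ?orbF.
  by rewrite h; lra.
have h' : (1 <= b%:R :> R) by rewrite (ler_nat _ 1).
lra.
Qed.

Definition cenc (c : nat * nat) : int * int := rot c.1 (cen c.2).
Definition turnC c1 c2 c3 : int := det (sub2 (cenc c2) (cenc c1)) (sub2 (cenc c3) (cenc c1)).
Definition dirC (c1 c2 : nat * nat) : int := det (rot c1.1 (vel c1.2)) (sub2 (cenc c2) (cenc c1)).
Definition code z : nat * nat := (nat_of_ord z.1, kind z.2).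
Definition codes : seq (nat * nat) := [seq (w, k) | w <- iota 0 3, k <- iota 0 4].

Lemma code_in z : code z \in codes.
Proof. by case: z => -[[|[|[|//]]] hw] [[i|i]|[i|i]]. Qed.

Definition is_PQQ (c1 c2 c3 : nat * nat) :=
  ((c1.2 == 0) && (c2 == (c1.1, 1)) && (c3 == ((c1.1 + 1) %% 3, 1)))%N.
Definition is_fine (c1 c2 : nat * nat) :=
  ((c1.2 == 1) && ((c2 == (c1.1, 0)) || (c2 == ((c1.1 + 1) %% 3, 1))) || (c1.2 == 2) && (c2 == (c1.1, 0)))%N.

(** Up to order and spinning, the only collinear triple of distinct centres is
    the one of [PQQ0]; likewise [dir_table] says that supporting lines meet no
    other centres than those of [QQP0], [QQQ0] and [SSP0].  The cluster e is a
    single point and supports no line. *)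
Lemma turn_table : all (fun c1 => all (fun c2 => all (fun c3 =>
  [|| ~~ uniq [:: c1; c2; c3], turnC c1 c2 c3 != 0, is_PQQ c1 c2 c3, is_PQQ c1 c3 c2,
    is_PQQ c2 c1 c3, is_PQQ c2 c3 c1, is_PQQ c3 c1 c2 | is_PQQ c3 c2 c1]) codes) codes) codes.
Proof. by vm_compute. Qed.

Lemma dir_table : all (fun c1 => all (fun c2 =>
  [|| c1 == c2, c1.2 == 3%N, dirC c1 c2 != 0 | is_fine c1 c2]) codes) codes.
Proof. by vm_compute. Qed.

Definition apart x y z := orient (pt x) (pt y) (pt z) != 0.

Lemma apart_swap x y z : apart y x z = apart x y z.
Proof. by rewrite /apart orient_swap oppr_eq0. Qed.
Lemma apart_cycle x y z : apart y z x = apart x y z.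
Proof. by rewrite /apart orient_cycle. Qed.
Lemma apart_spin v x y z : apart (spin v x) (spin v y) (spin v z) = apart x y z.
Proof. by rewrite /apart orient_spin. Qed.

Lemma neg_neq0 (u : R) : u < 0 -> u != 0. Proof. by move=> h; rewrite lt_eqF. Qed.
Lemma pos_neq0 (u : R) : 0 < u -> u != 0. Proof. by move=> h; rewrite gt_eqF. Qed.

Lemma spin0 w j : (w, j) = spin w (0, j).
Proof. by rewrite /spin /= addr0. Qed.

Lemma spin1 (w w' : 'I_3) j : w' = ((w + 1) %% 3)%N :> nat -> (w', j) = spin w (1, j).
Proof. by move=> e; congr (_, _); apply: val_inj; rewrite /= e. Qed.

Lemma apart_PQQ x y z : is_PQQ (code x) (code y) (code z) -> apart x y z.
Proof.
case: x => w [[a|a]|[a|a]] //; case: y => w' [[b|b]|[b|b]]; rewrite /is_PQQ /code ?andbF //=.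
  by case: z => ? ?; rewrite !xpair_eqE andbF.
  all: case: z => w'' [[c|c]|[c|c]]; rewrite !xpair_eqE ?andbF // ?andbT.
case/andP=> /eqP/val_inj-> /eqP /spin1 ->; rewrite !(spin0 w) apart_spin.
by rewrite /apart; have /orP[/andP[_ /pos_neq0]|/andP[_ /neg_neq0]] := PQQ0 a b c.
Qed.

Lemma site_inj x y : code x = code y -> rank x.2 = rank y.2 -> x = y.
Proof.
case: x y => w [[a|a]|[a|[]]] [w' [[b|b]|[b|[]]]] [] //= /val_inj-> // /val_inj-> //.
Qed.

Lemma apart_pair x y z : code x = code y -> rank x.2 != rank y.2 -> code z != code x ->
  apart x y z.
Proof.
have wlg x' y' : code x' = code y' -> (rank x'.2 < rank y'.2)%N -> code z != code x' -> apart x' y' z.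
  case: x' y' => w j [w' j'] [/val_inj <- k] /= ij cz.
  have /allP/(_ _ (code_in (w, j)))/allP/(_ _ (code_in z)) := dir_table.
  rewrite eq_sym (negPf cz) /= => /or3P[/eqP k3| |].
  - by move: ij k3 k {cz}; rewrite /code /=; case: j => [[?|?]|[?|?]] //; case: j' => [[?|?]|[?|?]].
  - have := pair_sign t2 eps0 epst w k ij z; rewrite /apart -[dirZ _ _]/(dirC (code (w, j)) (code z)).
    by case=> pos neg; rewrite neq_lt => /orP[/neg/neg_neq0|/pos/pos_neq0].
  rewrite /is_fine /code /=; case: j j' k ij {cz} => [[a|a]|[a|a]] [[a'|a']|[a'|a']] //= _ lt.
    rewrite orbF => /orP[]; case: z => v [[b|b]|[b|b]]; rewrite !xpair_eqE ?andbF //= ?andbT.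
      move=> /eqP/val_inj->; rewrite !(spin0 w) apart_spin /apart.
      by have /orP[/andP[_ /pos_neq0]|/andP[_ /neg_neq0]] := QQP0 b lt.
    by move=> /eqP/spin1->; rewrite !(spin0 w) apart_spin; apply: pos_neq0; apply: QQQ0.
  case: z => v [[b|b]|[b|b]]; rewrite !xpair_eqE ?andbF //= andbT.
  move=> /eqP/val_inj->; rewrite !(spin0 w) apart_spin /apart.
  by have /orP[/andP[_ /neg_neq0]|/andP[_ /pos_neq0]] := SSP0 b lt.
move=> e; rewrite neq_lt => /orP[|] r cz; first exact: wlg.
by rewrite -apart_swap; apply: wlg => //; rewrite -e.
Qed.

(** Three points in one cluster are separated by the parabola, two in one cluster
    by [apart_pair], and three in distinct clusters by [turn_table]. *)
Lemma free_pt : free (pt : site -> 'rV[R]_2).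
Proof.
move=> x y z xy xz yz; rewrite -/(apart x y z).
have ranks u v : u != v -> code u = code v -> rank u.2 != rank v.2.
  by move=> uv e; apply: contra uv => /eqP r; rewrite (site_inj e r).
have [exy|nxy] := eqVneq (code x) (code y).
  have [exz|nxz] := eqVneq (code z) (code x); last by apply: apart_pair; rewrite ?ranks.
  have r1 := ranks _ _ xy exy; have r2 := ranks _ _ xz (esym exz).
  have r3 := ranks _ _ yz (etrans (esym exy) (esym exz)).
  case: x y z exy exz r1 r2 r3 {xy xz yz} => w j [w1 j1] [w2 j2] [/val_inj <- k1] [/val_inj -> k2] /=.
  exact: triple_same.
have [eyz|nyz] := eqVneq (code y) (code z).
  by rewrite -apart_cycle; apply: apart_pair; rewrite ?ranks.
have [exz|nxz] := eqVneq (code z) (code x).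
  by rewrite -apart_cycle -apart_cycle; apply: apart_pair; rewrite ?ranks 1?eq_sym // exz.
have /allP/(_ _ (code_in x))/allP/(_ _ (code_in y))/allP/(_ _ (code_in z)) := turn_table.
rewrite /= !inE negb_or nxy nyz [code x == _]eq_sym nxz /=.
case/orP=> [|].
  by rewrite neq_lt => /orP[/(far_neg t2 eps0 epst)/neg_neq0|/(far_pos t2 eps0 epst)/pos_neq0].
case/or4P=> [|||/or3P[||]] /apart_PQQ //.
- by rewrite apart_cycle apart_swap.
- by rewrite apart_swap.
- by rewrite apart_cycle.
- by rewrite -apart_cycle.
- by rewrite apart_swap apart_cycle.
Qed.

Lemma pt_inj : injective (pt : site -> 'rV[R]_2).
Proof.
move=> x y e; apply/eqP/negPn/negP => nxy.
have [z [zx zy]] : exists z : site, z != x /\ z != y.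
  case: (boolP [exists z : site, (z != x) && (z != y)]) => [/existsP[z /andP[]]|no]; first by exists z.
  have : (#|{: site}| <= #|[set x; y]|)%N.
    apply: subset_leq_card; apply/fintype.subsetP => z _; rewrite !inE.
    by move: no; rewrite negb_exists => /forallP/(_ z); rewrite negb_and !negbK.
  by rewrite cards2 card_prod !card_sum !card_ord card_unit => h; move: h t2; clear; case: (x != y); lia.
have := free_pt nxy _ _; move/(_ z); rewrite ![_ == z]eq_sym zx zy => /(_ isT isT).
by rewrite e /orient; apply/negP/negPn/eqP; ring.
Qed.
End Spreading.

(** * Pairs inside one wing *)

Section InsideWing.
Variables (R : realType) (t : nat) (eps : R).
Hypothesis t2 : (1 < t)%N.
Hypothesis eps0 : (0 < eps)%R.
Hypothesis epst : (10 ^+ 5 * (eps * t%:R ^+ 2) <= 1)%R.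
Local Notation site := (site t).
Local Notation wing := (wing t).
Local Notation pt := (@pt R t eps).
Implicit Types (x y z : site) (j : wing).
Local Notation "x -- y --> z" := (orient (pt x) (pt y) (pt z)) (at level 10, y, z at next level).

Local Notation rside := (rside pt).

Lemma sum_range (n a b : nat) (f : 'I_n -> bool) :
  (forall i : 'I_n, a <= i < b -> f i) -> minn b n - a <= \sum_i f i.
Proof.
move=> h; have E k : \sum_(i < k) (a <= i < b) = minn b k - a.
  elim: k => [|k IH]; first by rewrite big_ord0; lia.
  by rewrite big_ord_recr /= IH; clear; case: (boolP (a <= k < b)) => /=; lia.
rewrite -E; apply: leq_sum => i _; case: (boolP (a <= i < b)) => // /h -> //.
Qed.

Lemma sum_full (n : nat) (f : 'I_n -> bool) : (forall i, f i) -> n <= \sum_i f i.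
Proof. by move=> h; apply: leq_trans (@sum_range n 0 n f _) => //; rewrite minnn subn0. Qed.

Definition inP (f : pred wing) := \sum_(a < t) f (inl (inl a)).
Definition inQ (f : pred wing) := \sum_(b < t.-1) f (inl (inr b)).
Definition inS (f : pred wing) := \sum_(a < t) f (inr (inl a)).
Definition in_wing (f : pred wing) := \sum_j f j.

Lemma wing_split f : in_wing f = (inP f + inQ f) + (inS f + f (inr (inr tt))).
Proof.
rewrite /in_wing big_sumType /= !big_sumType /=; congr (_ + (_ + _)).
by rewrite (bigD1 tt) //= big1 ?addn0 // => -[].
Qed.

Lemma count_site (c : pred site) : #|[set z | c z]| =
  in_wing (fun j => c (0%R, j)) + in_wing (fun j => c (1%R, j)) + in_wing (fun j => c (1 + 1, j)%R).
Proof.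
transitivity (\sum_(w < 3) \sum_j c (w, j)).
  by rewrite -sum_indicator pair_bigA; apply: eq_bigr => -[].
rewrite !big_ord_recl big_ord0 addn0 addnA.
by congr (_ + _ + _); apply: eq_bigr => j _; congr (nat_of_bool (c (_, j))); apply: val_inj.
Qed.

Lemma fullP (f : pred wing) : (forall a, f (inl (inl a))) -> t <= inP f.
Proof. exact: sum_full. Qed.
Lemma fullQ (f : pred wing) : (forall b, f (inl (inr b))) -> t.-1 <= inQ f.
Proof. exact: sum_full. Qed.
Lemma fullS (f : pred wing) : (forall a, f (inr (inl a))) -> t <= inS f.
Proof. exact: sum_full. Qed.
Lemma full_e (f : pred wing) : f (inr (inr tt)) -> 1 <= f (inr (inr tt)).
Proof. by move=> ->. Qed.

Lemma full_wing (f : pred wing) : (forall j, f j) -> 3 * t <= in_wing f.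
Proof.
move=> h; rewrite wing_split; have := fullP (fun a => h (inl (inl a))).
have := fullQ (fun a => h (inl (inr a))); have := fullS (fun a => h (inr (inl a))).
by have := full_e (h (inr (inr tt))); move: t2; clear; lia.
Qed.

Definition on_right x y (w : 'I_3) : pred wing := fun j => (x -- y --> (w, j) < 0)%R.
Definition on_left x y (w : 'I_3) : pred wing := fun j => (0 < x -- y --> (w, j))%R.

Lemma right_count x y : rside x y =
  in_wing (on_right x y 0%R) + in_wing (on_right x y 1%R) + in_wing (on_right x y (1 + 1)%R).
Proof. exact: count_site. Qed.

Lemma left_count x y : rside y x =
  in_wing (on_left x y 0%R) + in_wing (on_left x y 1%R) + in_wing (on_left x y (1 + 1)%R).
Proof.
transitivity #|[set z | (0 < x -- y --> z)%R]|; last exact: count_site.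
by apply: eq_card => z; rewrite !inE (orient_swap (pt x)) oppr_lt0.
Qed.

(** With the third point in the cluster of the first one, [pair_sign] applied to
    these two gives the orientation in terms of their ranks. *)
Lemma same_left w j j' y : kind j = kind j' ->
  [/\ dirZ (w, j) y < 0 -> (rank j < rank j')%N -> 0 < (w, j) -- y --> (w, j'),
      dirZ (w, j) y < 0 -> (rank j' < rank j)%N -> (w, j) -- y --> (w, j') < 0,
      0 < dirZ (w, j) y -> (rank j < rank j')%N -> (w, j) -- y --> (w, j') < 0 &
      0 < dirZ (w, j) y -> (rank j' < rank j)%N -> 0 < (w, j) -- y --> (w, j')]%R.
Proof.
move=> k; have e : (w, j) -- y --> (w, j') = (- (w, j) -- (w, j') --> y)%R.
  by rewrite orient_cycle orient_swap.
have e' : (w, j) -- y --> (w, j') = ((w, j') -- (w, j) --> y)%R by rewrite orient_cycle.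
have ed : dirZ (w, j) y = dirZ (w, j') y by rewrite /dirZ /vels /cens /= k.
split.
- by move=> d /(pair_sign t2 eps0 epst w k)/(_ y)[_ /(_ d)]; rewrite e oppr_gt0.
- by rewrite ed => d /(pair_sign t2 eps0 epst w (esym k))/(_ y)[_ /(_ d)]; rewrite e'.
- by move=> d /(pair_sign t2 eps0 epst w k)/(_ y)[/(_ d) + _]; rewrite e oppr_lt0.
- by rewrite ed => d /(pair_sign t2 eps0 epst w (esym k))/(_ y)[/(_ d) + _]; rewrite e'.
Qed.

(** The same with the third point in the cluster of the second one. *)
Lemma same_right w j j' y : kind j = kind j' ->
  [/\ dirZ (w, j) y < 0 -> (rank j < rank j')%N -> y -- (w, j) --> (w, j') < 0,
      dirZ (w, j) y < 0 -> (rank j' < rank j)%N -> 0 < y -- (w, j) --> (w, j'),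
      0 < dirZ (w, j) y -> (rank j < rank j')%N -> 0 < y -- (w, j) --> (w, j') &
      0 < dirZ (w, j) y -> (rank j' < rank j)%N -> y -- (w, j) --> (w, j') < 0]%R.
Proof.
move=> k; have e : y -- (w, j) --> (w, j') = (- (w, j) -- y --> (w, j'))%R by rewrite orient_swap.
by have [h1 h2 h3 h4] := same_left w y k; rewrite e; split=> d r; rewrite ?oppr_gt0 ?oppr_lt0; auto.
Qed.

Local Notation P a := (inl (inl a) : wing).
Local Notation Q b := (inl (inr b) : wing).
Local Notation S a := (inr (inl a) : wing).
Local Notation e := (inr (inr tt) : wing).
(** Lower bounds for the two sides of a pair of the wing 0.  They come from
    whole clusters, located by their centres, and from initial or final
    segments of the clusters that the line cuts. *)
Local Notation sides j j' n m :=
  (n <= rside (0%R, j) (0%R, j') /\ m <= rside (0%R, j') (0%R, j)).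

(** Computes an orientation from the tables of centres and directions. *)
Ltac sgn := first
  [ by apply: (far_neg t2 eps0 epst) | by apply: (far_pos t2 eps0 epst)
  | match goal with h : is_true (_ < _) |- context [orient (pt (?w, ?j)) (pt (_, ?j')) (pt ?z)] =>
      first [ by apply: (@pair_sign _ _ _ t2 eps0 epst w j j' erefl h z).1
            | by apply: (@pair_sign _ _ _ t2 eps0 epst w j j' erefl h z).2 ] end ].

Ltac full := repeat match goal with f := _ : _ -> pred _ |- _ => subst f end; rewrite /on_right /on_left;
  solve [move=> [[?|?]|[?|[]]]; sgn | move=> ?; sgn | sgn].

Lemma PP_sides (a a' : 'I_t) : a < a' -> sides (P a) (P a') (4 * t) (4 * t).
Proof.
move=> h; rewrite right_count left_count !(wing_split (_ 0%R)).
set r := on_right _ _; set l := on_left _ _; split.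
  have /full_wing B : forall j, r 1%R j by full.
  have /fullQ q : forall b, r 0%R (Q b) by full.
  have /full_e e : r 0%R e by full.
  by clear -t2 B q e; lia.
have /full_wing C : forall j, l (1 + 1)%R j by full.
have /fullS s : forall b, l 0%R (S b) by full.
by clear -t2 C s; lia.
Qed.

Lemma rangeP (f : pred wing) n m : (forall a : 'I_t, n <= a < m -> f (inl (inl a))) -> minn m t - n <= inP f.
Proof. exact: sum_range. Qed.
Lemma rangeQ (f : pred wing) n m : (forall b : 'I_t.-1, n <= b < m -> f (inl (inr b))) -> minn m t.-1 - n <= inQ f.
Proof. exact: sum_range. Qed.
Lemma rangeS (f : pred wing) n m : (forall a : 'I_t, n <= a < m -> f (inr (inl a))) -> minn m t - n <= inS f.
Proof. exact: sum_range. Qed.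

Lemma QQ_sides (b b' : 'I_t.-1) : b < b' -> sides (Q b) (Q b') (4 * t) (4 * t).
Proof.
move=> h; rewrite right_count left_count !(wing_split (_ 0%R)).
set r := on_right _ _; set l := on_left _ _; split.
  have /full_wing C : forall j, r (1 + 1)%R j by full.
  have /full_e e : r 0%R e by full.
  have /rangeP p : forall a : 'I_t, 1 <= a < t -> r 0%R (P a).
    move=> a a0; have := QQP0 t2 eps0 epst a h; rewrite /r /on_right /Qt /Pt.
    by case/orP=> /andP[] //; move: a0; clear; case: (nat_of_ord a).
  by clear -t2 C p e; lia.
have /full_wing B : forall j, l 1%R j.
  have q c : l 1%R (Q c) := QQQ0 t2 eps0 epst c h.
  by case=> [[?|c]|[?|[]]]; [full | exact: q | full | full].
have /fullS s : forall b, l 0%R (S b) by full.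
by clear -t2 B s; lia.
Qed.

Lemma SS_sides (a a' : 'I_t) : a < a' -> sides (S a) (S a') (4 * t) (4 * t).
Proof.
move=> h; rewrite right_count left_count !(wing_split (_ 0%R)).
set r := on_right _ _; set l := on_left _ _; split.
  have /full_wing B : forall j, r 1%R j by full.
  have /fullQ q : forall b, r 0%R (Q b) by full.
  have /rangeP p : forall b : 'I_t, 0 <= b < 1 -> r 0%R (P b).
    move=> b b0; have := SSP0 t2 eps0 epst b h; rewrite /r /on_right /St /Pt.
    by case/orP=> /andP[] //; move: b0; clear; case: (nat_of_ord b).
  by clear -t2 B p q; lia.
have /full_wing C : forall j, l (1 + 1)%R j by full.
have /full_e e : l 0%R e by full.
have /rangeP p : forall b : 'I_t, 1 <= b < t -> l 0%R (P b).
  move=> b b0; have := SSP0 t2 eps0 epst b h; rewrite /l /on_left /St /Pt.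
  by case/orP=> /andP[] //; move: b0; clear; case: (nat_of_ord b).
by clear -t2 C p e; lia.
Qed.

Lemma PQ_sides (a : 'I_t) (b : 'I_t.-1) : sides (P a) (Q b) (4 * t) (4 * t).
Proof.
rewrite right_count left_count !(wing_split (_ 0%R)) !(wing_split (_ 1%R)).
set r := on_right _ _; set l := on_left _ _.
have la := ltn_ord a; have fine c := PQQ0 t2 eps0 epst a b c; rewrite /Pt /Qt in fine.
split.
  have /fullS s : forall i, r 0%R (S i) by full.
  have /fullP p1 : forall i, r 1%R (P i) by full.
  have /fullS s1 : forall i, r 1%R (S i) by full.
  have /full_e e1 : r 1%R e by full.
  have /rangeP p : forall i : 'I_t, 0 <= i < a -> r 0%R (P i).
    by move=> i ia; have [_ + _ _] := same_left 0%R (0%R, Q b) (erefl : kind (P a) = kind (P i)); apply.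
  have /rangeQ q : forall c : 'I_t.-1, a <= c < t.-1 -> r 1%R (Q c).
    move=> c hc; have := fine c; rewrite /r /on_right.
    by case/orP=> /andP[] //; move: hc; clear; lia.
  by clear -t2 la s p1 s1 e1 p q; lia.
have /full_wing C : forall j, l (1 + 1)%R j by full.
have /full_e e0 : l 0%R e by full.
have /rangeP p : forall i : 'I_t, a.+1 <= i < t -> l 0%R (P i).
  move=> i /andP[ia _]; have [+ _ _ _] := same_left 0%R (0%R, Q b) (erefl : kind (P a) = kind (P i)).
  by apply.
have /rangeQ q : forall c : 'I_t.-1, 0 <= c < a -> l 1%R (Q c).
  move=> c hc; have := fine c; rewrite /l /on_left.
  by case/orP=> /andP[] //; move: hc; clear; lia.
by clear -t2 la C e0 p q; lia.
Qed.

(** By [SSP0] the points of S on the left of the line change from lower to higher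
    indices when a becomes positive. *)
Lemma PS_sides (a j : 'I_t) :
  if a == 0 :> nat then sides (P a) (S j) (4 * t) (4 * t - 1 + j)
  else sides (P a) (S j) (4 * t + j - a) (4 * t).
Proof.
rewrite right_count left_count !(wing_split (_ 0%R)).
set r := on_right _ _; set l := on_left _ _.
have la := ltn_ord a; have lj := ltn_ord j.
have /full_wing B : forall j, l 1%R j by full.
have /full_wing C : forall j, r (1 + 1)%R j by full.
have /fullQ q : forall i, l 0%R (Q i) by full.
have /full_e e0 : r 0%R e by full.
have /rangeP pl : forall i : 'I_t, 0 <= i < a -> l 0%R (P i).
  by move=> i ia; have [_ _ _ +] := same_left 0%R (0%R, S j) (erefl : kind (P a) = kind (P i)); apply.
have /rangeP pr : forall i : 'I_t, a.+1 <= i < t -> r 0%R (P i).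
  by move=> i /andP[ia _]; have [_ _ + _] := same_left 0%R (0%R, S j) (erefl : kind (P a) = kind (P i)); apply.
have fine (i i' : 'I_t) (h : i < i') := SSP0 t2 eps0 epst a h; rewrite /St /Pt in fine.
have cyc1 i : l 0%R (S i) = (0 < (0%R, S j) -- (0%R, S i) --> (0%R, P a))%R.
  by rewrite /l /on_left -(orient_cycle (pt (0%R, P a))).
have cyc2 i : l 0%R (S i) = ((0%R, S i) -- (0%R, S j) --> (0%R, P a) < 0)%R.
  by rewrite cyc1 orient_swap oppr_gt0.
have cyc3 i : r 0%R (S i) = ((0%R, S j) -- (0%R, S i) --> (0%R, P a) < 0)%R.
  by rewrite /r /on_right -(orient_cycle (pt (0%R, P a))).
have cyc4 i : r 0%R (S i) = (0 < (0%R, S i) -- (0%R, S j) --> (0%R, P a))%R.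
  by rewrite cyc3 orient_swap oppr_lt0.
case: posnP => a0.
  have /rangeS sl : forall i : 'I_t, 0 <= i < j -> l 0%R (S i).
    by move=> i ij; rewrite cyc2; have := fine _ _ ij; rewrite a0 orbF.
  have /rangeS sr : forall i : 'I_t, j.+1 <= i < t -> r 0%R (S i).
    by move=> i /andP[ij _]; rewrite cyc3; have := fine _ _ ij; rewrite a0 orbF.
  by clear -t2 la lj B C q e0 pl pr sl sr a0; lia.
have /rangeS sr : forall i : 'I_t, 0 <= i < j -> r 0%R (S i).
  by move=> i ij; rewrite cyc4; have := fine _ _ ij; rewrite a0 (gtn_eqF a0).
have /rangeS sl : forall i : 'I_t, j.+1 <= i < t -> l 0%R (S i).
  by move=> i /andP[ij _]; rewrite cyc1; have := fine _ _ ij; rewrite a0 (gtn_eqF a0).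
by clear -t2 la lj B C q e0 pl pr sl sr a0; lia.
Qed.

Lemma Pe_sides (a : 'I_t) : sides (P a) e (4 * t - 1 + a) (4 * t).
Proof.
rewrite right_count left_count !(wing_split (_ 0%R)).
set r := on_right _ _; set l := on_left _ _; have la := ltn_ord a; split.
  have /full_wing B : forall j, r 1%R j by full.
  have /fullQ q : forall i, r 0%R (Q i) by full.
  have /rangeP p : forall i : 'I_t, 0 <= i < a -> r 0%R (P i).
    by move=> i ia; have [_ + _ _] := same_left 0%R (0%R, e) (erefl : kind (P a) = kind (P i)); apply.
  by clear -t2 la B q p; lia.
have /full_wing C : forall j, l (1 + 1)%R j by full.
have /fullS s : forall i, l 0%R (S i) by full.
have /rangeP p : forall i : 'I_t, a.+1 <= i < t -> l 0%R (P i).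
  by move=> i /andP[ia _]; have [+ _ _ _] := same_left 0%R (0%R, e) (erefl : kind (P a) = kind (P i)); apply.
by clear -t2 la C s p; lia.
Qed.

Lemma QS_sides (b : 'I_t.-1) (j : 'I_t) : sides (Q b) (S j) (4 * t) (3 * t + b + j).
Proof.
rewrite right_count left_count !(wing_split (_ 0%R)).
set r := on_right _ _; set l := on_left _ _; have lb := ltn_ord b; have lj := ltn_ord j; split.
  have /full_wing C : forall j, r (1 + 1)%R j by full.
  have /fullP p : forall i, r 0%R (P i) by full.
  have /full_e e0 : r 0%R e by full.
  by clear -t2 C p e0; lia.
have /full_wing B : forall j, l 1%R j by full.
have /rangeQ q : forall i : 'I_t.-1, 0 <= i < b -> l 0%R (Q i).
  by move=> i ib; have [_ _ _ +] := same_left 0%R (0%R, S j) (erefl : kind (Q b) = kind (Q i)); apply.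
have /rangeS s : forall i : 'I_t, 0 <= i < j -> l 0%R (S i).
  by move=> i ij; have [_ + _ _] := same_right 0%R (0%R, Q b) (erefl : kind (S j) = kind (S i)); apply.
by clear -t2 lb lj B q s; lia.
Qed.

Lemma Qe_sides (b : 'I_t.-1) : sides (Q b) e (4 * t) (4 * t).
Proof.
rewrite right_count left_count !(wing_split (_ 0%R)) !(wing_split (_ 1%R)).
set r := on_right _ _; set l := on_left _ _; split.
  have /full_wing C : forall j, r (1 + 1)%R j by full.
  have /fullQ q : forall i, r 1%R (Q i) by full.
  have /full_e e0 : r 1%R e by full.
  by clear -t2 C q e0; lia.
have /fullP p0 : forall i, l 0%R (P i) by full.
have /fullS s0 : forall i, l 0%R (S i) by full.
have /fullP p1 : forall i, l 1%R (P i) by full.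
have /fullS s1 : forall i, l 1%R (S i) by full.
by clear -t2 p0 s0 p1 s1; lia.
Qed.

Lemma Se_sides (a : 'I_t) : sides (S a) e (4 * t) (3 * t + a).
Proof.
rewrite right_count left_count !(wing_split (_ 0%R)).
set r := on_right _ _; set l := on_left _ _; have la := ltn_ord a; split.
  have /full_wing B : forall j, r 1%R j by full.
  have /fullP p : forall i, r 0%R (P i) by full.
  have /fullQ q : forall i, r 0%R (Q i) by full.
  by clear -t2 B p q; lia.
have /full_wing C : forall j, l (1 + 1)%R j by full.
have /rangeS s : forall i : 'I_t, 0 <= i < a -> l 0%R (S i).
  by move=> i ia; have [_ _ _ +] := same_left 0%R (0%R, e) (erefl : kind (S a) = kind (S i)); apply.
by clear -t2 la C s; lia.
Qed.
End InsideWing.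

(** * Flat pairs of the configuration *)

Section FlatPairs.
Variables (R : realType) (t : nat) (eps : R).
Hypothesis t2 : (1 < t)%N.
Hypothesis eps0 : (0 < eps)%R.
Hypothesis epst : (10 ^+ 5 * (eps * t%:R ^+ 2) <= 1)%R.
Local Notation site := (site t).
Local Notation wing := (wing t).
Local Notation pt := (@pt R t eps).
Implicit Types (x y z : site) (j : wing).
Local Notation rside := (rside pt).
Lemma sum_ramp m d : \sum_(a < m) (a - d) = 'C(m - d, 2).
Proof.
elim: m => [|m IH]; first by rewrite big_ord0.
rewrite big_ord_recr /= IH; case: (leqP d m) => h; first by rewrite subSn // binS bin1.
by have -> : m.+1 - d = 0; [|have -> : m - d = 0]; move: h; clear; lia.
Qed.

Lemma sum_triangle_cut m u : u <= m.+1 ->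
  \sum_(i < m.+1) \sum_(b < m) (i + b < u) + (u == m.+1) <= 'C(u + 1, 2).
Proof.
move=> um; rewrite -(sum_staircase m.+1 u) (_ : 'C(u - m.+1 + 1, 2) = 0) ?addn0; last first.
  by rewrite (eqP (_ : u - m.+1 == 0)) ?subn_eq0.
rewrite !big_ord_recl /= addnAC; apply: leq_add.
  by rewrite sum_below; move: um; clear; lia.
by apply: leq_sum => i _; rewrite sum_below geq_minr.
Qed.

(** The pairs inside a wing for which the bounds of the lemmas on sides allow
    fewer than [K] points on the right, when K is at most 4t. *)
Definition cheap K j j' : bool :=
  match j, j' with
  | inl (inl a), inr (inl i) => (0 < a) && (4 * t + i - a < K)
  | inr (inl i), inl (inl a) => (a == 0 :> nat) && (4 * t - 1 + i < K)
  | inl (inl a), inr (inr _) => 4 * t - 1 + a < K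
  | inr (inl i), inl (inr b) => i + b < K - 3 * t
  | inr (inr _), inr (inl i) => 3 * t + i < K
  | _, _ => false
  end.

Lemma cheap_pairs K j j' : K <= 4 * t -> j != j' -> rside (0%R, j) (0%R, j') < K -> cheap K j j'.
Proof.
move=> hK; have far n (m := rside (0%R, j) (0%R, j')) : 4 * t <= m -> m < K -> n.
  by move: m; clear -hK; lia.
have cl n m : n <= m -> m < K -> n < K by exact: leq_ltn_trans.
case: j j' far => [[a|b]|[a|[]]] [[a'|b']|[a'|[]]] //= far ne.
- have : a != a' :> nat by apply: contra ne => /eqP/val_inj->.
  by rewrite neq_ltn => /orP[] h; apply: far; have [] := PP_sides t2 eps0 epst h.
- by apply: far; have [] := PQ_sides t2 eps0 epst a b'.
- have := PS_sides t2 eps0 epst a a'; case: posnP => a0 [h _]; last exact: cl.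
  by apply: far.
- by have [h _] := Pe_sides t2 eps0 epst a; apply: cl.
- by apply: far; have [] := PQ_sides t2 eps0 epst a' b.
- have : b != b' :> nat by apply: contra ne => /eqP/val_inj->.
  by rewrite neq_ltn => /orP[] h; apply: far; have [] := QQ_sides t2 eps0 epst h.
- by apply: far; have [] := QS_sides t2 eps0 epst b a'.
- by apply: far; have [] := Qe_sides t2 eps0 epst b.
- have := PS_sides t2 eps0 epst a' a; case: posnP => a0 [_ h]; first exact: cl.
  by apply: far.
- have [_ h] := QS_sides t2 eps0 epst b' a; move=> /(leq_ltn_trans h).
  by rewrite -addnA ltn_subRL [b' + a]addnC.
- have : a != a' :> nat by apply: contra ne => /eqP/val_inj->.
  by rewrite neq_ltn => /orP[] h; apply: far; have [] := SS_sides t2 eps0 epst h.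
- by apply: far; have [] := Se_sides t2 eps0 epst a.
- by apply: far; have [] := Pe_sides t2 eps0 epst a'.
- by apply: far; have [] := Qe_sides t2 eps0 epst b'.
- by have [_ h] := Se_sides t2 eps0 epst a'; apply: cl.
Qed.

(** With u = K - 3t, the pairs PS contribute C(u, 2), the pairs SQ contribute
    C(u+1, 2) and the pairs eS contribute u.  When u = t there is one more pair
    of each of the types SP and Pe, but one fewer of type SQ because Q has only
    t - 1 points. *)
Lemma cheap_count K : K <= 4 * t ->
  \sum_j \sum_j' cheap K j j' <= 2 * 'C(K - 3 * t + 1, 2) + (K == 4 * t).
Proof.
move=> hK; set u := K - 3 * t; have ut : u <= t by rewrite /u; clear -hK; lia.
rewrite !big_sumType /=.
have split3 (I : finType) (f : I -> wing -> nat) : \sum_i \sum_j f i j =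
   (\sum_i \sum_a f i (inl (inl a)) + \sum_i \sum_b f i (inl (inr b))) +
   (\sum_i \sum_a f i (inr (inl a)) + \sum_i f i (inr (inr tt))).
  rewrite -!big_split; apply: eq_bigr => i _; rewrite !big_sumType /=; congr (_ + (_ + _)).
  by rewrite (bigD1 tt) //= big1 ?addn0 // => -[].
rewrite !split3 /=.
have unitE (f : unit -> nat) : \sum_i f i = f tt by rewrite (bigD1 tt) //= big1 ?addn0 // => -[].
rewrite !big1_eq !add0n !addn0 unitE.
rewrite (sum_below t K (4 * t - 1)) (sum_below t K (3 * t)).
have PS : \sum_(i < t) \sum_(a < t) ((0 < i) && (4 * t + a - i < K)) <= 'C(u, 2).
  rewrite -[u](subKn ut) -sum_ramp; apply: leq_sum => i _; have it := ltn_ord i.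
  apply: leq_trans (_ : \sum_(a < t) (0 + a < K + i - 4 * t) <= _).
    apply: leq_sum => a _; case: (posnP i) => //= i0.
    by case: ltnP => // h; rewrite (_ : 0 + a < _) //; move: h it i0; clear; lia.
  by rewrite sum_below; rewrite /u; clear -hK it; lia.
have SP : \sum_(i < t) \sum_(a < t) ((a == 0 :> nat) && (4 * t - 1 + i < K)) <= (K == 4 * t).
  apply: leq_trans (_ : \sum_(i < t) (4 * t - 1 + i < K) <= _); last first.
    by rewrite sum_below; clear -hK; lia.
  apply: leq_sum => i _; apply: leq_trans (_ : \sum_(a < t) (0 + a < (4 * t - 1 + i < K)) <= _).
    by apply: leq_sum => a _; case: (nat_of_ord a) => [|?]; case: ltnP.
  by rewrite sum_below subn0 geq_minr.
have SQ : \sum_(i < t) \sum_(b < t.-1) (i + b < u) + (K == 4 * t) <= 'C(u + 1, 2).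
  have <- : (u == t) = (K == 4 * t) by rewrite /u; clear -hK t2; lia.
  by have := @sum_triangle_cut t.-1 u; rewrite prednK //; [apply | clear -t2; lia].
have bin : 'C(u + 1, 2) = 'C(u, 2) + u by rewrite addn1 binS bin1.
have eC : (K == 4 * t) <= 'C(u + 1, 2) by exact: leq_trans (leq_addl _ _) SQ.
have {}SQ : \sum_(i < t) \sum_(b < t.-1) (i + b < u) <= 'C(u + 1, 2) - (K == 4 * t).
  by rewrite leq_subRL // addnC.
have Pe : minn t (K - (4 * t - 1)) <= (K == 4 * t) by clear -hK; lia.
apply: leq_trans (leq_add (leq_add PS Pe) (leq_add (leq_add SP SQ) (geq_minr t u))) _.
by move: eC bin; clear; lia.
Qed.

Lemma spin_inj v : injective (@spin t v).
Proof. by apply: (can_inj (g := spin (- v)%R)) => -[w j]; rewrite /spin /= addKr. Qed.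

Lemma rside_spin v x y : rside (spin v x) (spin v y) = rside x y.
Proof.
rewrite /rside -!sum_indicator (reindex_inj (@spin_inj v)).
by apply: eq_bigr => z _; rewrite orient_spin.
Qed.

Definition flat_between K (w w' : 'I_3) :=
  #|[set p : wing * wing | ((w, p.1) != (w', p.2)) && (rside (w, p.1) (w', p.2) < K)]|.

Lemma flat_spin K v w w' : flat_between K (v + w)%R (v + w')%R = flat_between K w w'.
Proof.
apply: eq_card => -[j j']; rewrite !inE /=.
rewrite -[(_, j)]/(spin v (w, j)) -[(_, j')]/(spin v (w', j')) rside_spin.
by rewrite (inj_eq (@spin_inj v)).
Qed.

Lemma card_flat_between K : #|flat pt K| = \sum_w \sum_w' flat_between K w w'.
Proof.
rewrite /flat (card_pairs (fun x y => (x != y) && (rside x y < K))) /=.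
transitivity (\sum_w \sum_j \sum_w' \sum_j' (((w, j) != (w', j')) && (rside (w, j) (w', j') < K))).
  by rewrite [RHS]pair_bigA; apply: eq_bigr => -[w j] _; rewrite [RHS]pair_bigA; apply: eq_bigr => -[].
apply: eq_bigr => w _; rewrite exchange_big; apply: eq_bigr => w' _.
by rewrite /flat_between (card_pairs (fun j j' => ((w, j) != (w', j')) && (rside (w, j) (w', j') < K))).
Qed.

Lemma flat_rotations K : #|flat pt K| =
  3 * (flat_between K 0%R 0%R + (flat_between K 0%R 1%R + flat_between K 1%R 0%R)).
Proof.
rewrite card_flat_between !big_ord_recl !big_ord0.
have E (a b c d v : 'I_3) : (v + c = a)%R -> (v + d = b)%R -> flat_between K a b = flat_between K c d.
  by move=> <- <-; rewrite flat_spin.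
have -> : lift ord0 (lift ord0 ord0) = (1 + 1)%R :> 'I_3 by apply: val_inj.
have -> : lift ord0 ord0 = 1%R :> 'I_3 by apply: val_inj.
have -> : ord0 = 0%R :> 'I_3 by apply: val_inj.
rewrite (E 1 1 0 0 1)%R ?(E (1 + 1) (1 + 1) 0 0 (1 + 1))%R; try exact: val_inj.
rewrite (E 1 (1 + 1) 0 1 1)%R ?(E (1 + 1) 0 0 1 (1 + 1))%R; try exact: val_inj.
rewrite (E 0 (1 + 1) 1 0 (1 + 1))%R ?(E (1 + 1) 1 1 0 1)%R; try exact: val_inj.
by clear; lia.
Qed.

Definition wing_set (w : 'I_3) : {set site} := [set z | z.1 == w].

Lemma card_wing_set w : #|wing_set w| = 3 * t.
Proof.
have -> : wing_set w = setX [set w] setT by apply/setP => -[v j]; rewrite !inE andbT.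
rewrite cardsX cards1 mul1n cardsT !card_sum !card_ord card_unit.
by clear -t2; lia.
Qed.

Lemma card_site : #|{: site}| = 9 * t.
Proof.
rewrite card_prod !card_sum !card_ord card_unit; clear -t2; lia.
Qed.

(** The wing 0 lies to the left of the abscissa -13/2 and the wing 1 to its right;
    a line from a point of wing 0 to a point of wing 1 leaves the wing 2 on its
    left. *)
Lemma between_count K : flat_between K 0%R 1%R + flat_between K 1%R 0%R + 'C(K - 3 * t + 1, 2) <= 'C(K + 1, 2).
Proof.
have AB (z : site) :
   [/\ z.1 = 0%R -> ((pt z) 0 0 < - 13 / 2)%R & z.1 = 1%R -> (- 13 / 2 < (pt z) 0 0)%R].
  have := loc_close t2 eps0 epst z; rewrite /pt mxE /= => -[+ _].
  rewrite ler_norml => /andP[h1 h2].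
  split=> z1; move: h1 h2; case: z z1 => w [[?|?]|[?|?]] /= ->; rewrite /cens /= ?NegzE ?rmorphN /= -?pmulrn; lra.
have := @bichromatic_count R site pt (wing_set 0%R) (wing_set 1%R) (- 13 / 2)%R
  (free_pt t2 eps0 epst) _ _ (wing_set (1 + 1)%R) (3 * t) (card_wing_set _) (card_wing_set _).
rewrite card_site mulnA => /(_ _ _ erefl) h.
apply: leq_trans (h _ _ _ _ K).
- rewrite leq_add2r; apply: leq_add.
    pose f (p : wing * wing) : site * site := ((0%R, p.1), (1%R, p.2)).
    rewrite /flat_between -(card_imset (f := f)); last by move=> [? ?] [? ?] [-> ->].
    apply: subset_leq_card; apply/fintype.subsetP => _ /imsetP[p hp ->].
    by move: hp; rewrite !inE /= => ->.
  pose f (p : wing * wing) : site * site := ((0%R, p.2), (1%R, p.1)).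
  rewrite /flat_between -(card_imset (f := f)); last by move=> [? ?] [? ?] [-> ->].
  apply: subset_leq_card; apply/fintype.subsetP => _ /imsetP[p hp ->].
  by move: hp; rewrite !inE /= => ->.
- by move=> a; rewrite inE => /eqP; have [] := AB a.
- by move=> b; rewrite inE => /eqP; have [] := AB b.
- by move=> [[[|[|[|//]]] hw] j]; rewrite !inE.
move=> [w a] [w' b] [w'' c]; rewrite !inE /= => /eqP-> /eqP-> /eqP->.
by apply: (far_pos t2 eps0 epst); case: a b c => [[?|?]|[?|?]] [[?|?]|[?|?]] [[?|?]|[?|?]].
Qed.

Lemma flat_ub K : K <= 4 * t ->
  #|flat pt K| <= 3 * 'C(K + 1, 2) + 3 * 'C(K - 3 * t + 1, 2) + 3 * (K == 4 * t).
Proof.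
move=> hK; rewrite flat_rotations.
have mono : flat_between K 0%R 0%R <= 2 * 'C(K - 3 * t + 1, 2) + (K == 4 * t).
  apply: leq_trans (cheap_count hK); rewrite -(card_pairs (cheap K)).
  apply: subset_leq_card; apply/fintype.subsetP => -[j j']; rewrite !inE /= => /andP[ne].
  by apply: cheap_pairs => //; apply: contra ne => /eqP->.
by move: mono (between_count K); clear; lia.
Qed.
End FlatPairs.

(** * The minimum *)

(** The common value of the two bounds, for n = 9t and K = k + 1. *)
Definition profile t K := 3 * 'C(K + 1, 2) + 3 * 'C(K - 3 * t + 1, 2) + 3 * (K == 4 * t).

Lemma profile_le_E (R : realType) (P : {fset 'rV[R]_2}) t k : 2 < t ->
  general_position P -> #|` P| = 9 * t -> k < 4 * t -> profile t k.+1 <= E_le k P.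
Proof.
move=> t2 /general_position_free[T [pt [inj fr <-]]]; rewrite card_config // => cT kt.
apply: leq_trans (E_le_lb inj fr _); last by rewrite cT; clear -t2 kt; lia.
have [H [lt [H0 A le]]] := crit_le_flat fr inj (ltn0Sn k); apply: leq_trans le.
have cS : #|[set: T]| = 9 * t by rewrite cardsT.
have [e|ne] := eqVneq k.+1 (4 * t).
  have := middle_lb A H0 t2 cS; rewrite /profile e eqxx.
  by rewrite (_ : 4 * t - 3 * t = t) //; clear; lia.
rewrite /profile (negPf ne) muln0 addn0 -(sum_excess (3 * t)) addn1 mulnA -cS.
by apply: shallow_lb => //; rewrite cS; clear -ne kt t2; lia.
Qed.

Lemma profile_attained (R : realType) t : 1 < t ->
  exists P : {fset 'rV[R]_2}, [/\ #|` P| = 9 * t, general_position P &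
    forall k, k < 4 * t -> E_le k P <= profile t k.+1].
Proof.
move=> t2; pose eps : R := ((10 ^+ 5 * t%:R ^+ 2)^-1)%R.
have T0 : (0 < 10 ^+ 5 * t%:R ^+ 2 :> R)%R by rewrite mulr_gt0 ?exprn_gt0 // ltr0n ltnW.
have eps0 : (0 < eps)%R by rewrite invr_gt0.
have epst : (10 ^+ 5 * (eps * t%:R ^+ 2) <= 1)%R.
  by rewrite mulrCA mulVf // gt_eqF.
exists (config (@pt R t eps)); split.
- by rewrite card_config ?card_site //; apply: pt_inj.
- by apply: free_general_position; apply: free_pt.
move=> k kt; apply: leq_trans (E_le_ub _ _) _; first exact: pt_inj.
exact: flat_ub.
Qed.

Theorem mainTheorem6 (R : realType) (n : nat) (hn9 : 9 %| n) (hn : 27 <= n) :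
  exists P : {fset 'rV[R]_2},
    [/\ #|` P| = n,
        general_position P
      & forall k : nat, k <= 4 * n %/ 9 - 1 ->
          E_le k P = E_le_min R n k /\
          E_le_min R n k =
            if k <= n %/ 3 - 1 then 3 * 'C(k + 2, 2)
            else if k <= 4 * n %/ 9 - 2 then
              3 * 'C(k + 2, 2) + 3 * 'C(k - n %/ 3 + 2, 2)
            else
              3 * 'C((4 * n %/ 9 - 1) + 2, 2)
              + 3 * 'C((4 * n %/ 9 - 1) - n %/ 3 + 2, 2) + 3].
Proof.
have [t en] : exists t, n = 9 * t by exists (n %/ 9); rewrite mulnC divnK.
have t2 : 2 < t by move: hn; rewrite en; clear; lia.
have [P [cP gP ub]] := profile_attained R (ltnW t2); rewrite en.
exists P; split=> // k; have -> : 4 * (9 * t) %/ 9 = 4 * t by clear; lia.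
have -> : 9 * t %/ 3 = 3 * t by clear; lia.
move=> hk; have {hk} kt : k < 4 * t by clear -hk t2; lia.
have E : E_le k P = profile t k.+1.
  by apply/eqP; rewrite eqn_leq ub //= profile_le_E.
have min : E_le_min R (9 * t) k = profile t k.+1.
  rewrite /E_le_min; case: ex_minnP => m /asboolP[P' [cP' gP' <-]] least; apply/eqP.
  rewrite eqn_leq profile_le_E // andbT -E; apply: least; apply/asboolP.
  by exists P.
have k2 : k.+1 + 1 = k + 2 by rewrite addn1 addn2.
rewrite E min; split=> //; rewrite /profile k2.
case: leqP => h1.
  have -> : k.+1 - 3 * t = 0 by clear -h1 t2; lia.
  have -> : (k.+1 == 4 * t) = false by clear -h1 t2; lia.
  by rewrite (_ : 'C(0 + 1, 2) = 0) // !muln0 !addn0.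
have -> : k.+1 - 3 * t + 1 = k - 3 * t + 2 by clear -h1 t2; lia.
case: leqP => h2; first by have -> : (k.+1 == 4 * t) = false; [clear -h2 t2; lia | rewrite addn0].
have -> : 4 * t - 1 = k by clear -h2 kt t2; lia.
by have -> : k.+1 == 4 * t by clear -h2 kt t2; lia.
Qed.
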